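(* Assume the standing setup below and $\beta_n n^{-\alpha}\to\infty$. Let $a_n=(C(q)n)^\alpha$. Then $\sqrt{a_n}\,\mathcal Y_n(q)\to V\Phi$ in distribution, where $\Phi=\sqrt{2R_1}\,\Theta_1$, $R_1\ge0$ is a random variable with $\mathbb P(R_1>r)=e^{-r^{1/\alpha}}$ for $r\ge0$, and $\Theta_1$ is independent of $R_1$ and uniformly distributed on $\mathbb S_q^{d-2}$. In particular $\mathcal Y_n(q)\to0$ and $\mathrm{ATT}(n)\to Vq$ in probability.
   Context: Standing setup: Fix an integer $d\ge 2$; let $\mathbb S^{d-1}\subset\mathbb R^d$ be the unit sphere with surface measure $\sigma$. Fix $q\in\mathbb S^{d-1}$. Let $x_1,x_2,\dots$ be i.i.d. random vectors on $\mathbb S^{d-1}$ with law $\rho(x)\,d\sigma(x)$, where $\rho$ is a $C^2$ probability density on $\mathbb S^{d-1}$ with $\rho(q)>0$. Let $(\beta_n)_{n\ge1}$ be positive reals and set $\alpha=2/(d-1)$. Define $T_i=1-\langle q,x_i\rangle$, $Z_n=\sum_{j=1}^n e^{-\beta_nT_j}$, $A_i=e^{-\beta_nT_i}/Z_n$. Let $V\in\mathbb R^{d\times d}$ be fixed, $\mathrm{ATT}(n)=V\sum_{j=1}^nA_jx_j$ and $\mathcal Y_n(q)=\mathrm{ATT}(n)-Vq=V\sum_{i=1}^nA_i(x_i-q)$. Let $C(q)=\frac{2^{1/\alpha}\sigma_{d-2}}{d-1}\rho(q)$ with $\sigma_{d-2}$ the surface area of $\mathbb S^{d-2}$. Let $\mathbb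 S_q^{d-2}=\{\theta\in\mathbb R^d:\langle\theta,q\rangle=0,\ \|\theta\|=1\}$ be the unit sphere of the tangent space at $q$. *)

(* Defs.v *)
From HB Require Import structures.
From mathcomp Require Import all_boot all_order all_algebra.
From mathcomp Require Import all_classical all_reals all_analysis.

Set Implicit Arguments.
Unset Strict Implicit.
Unset Printing Implicit Defensive.

Import Order.TTheory GRing.Theory Num.Theory.
Import numFieldNormedType.Exports.

Local Open Scope classical_set_scope.
Local Open Scope ring_scope.

Section Defs.
Variable R : realType.

Definition dotv n (x y : 'cV[R]_n) : R := \sum_(i < n) x i 0 * y i 0.

Definition enorm n (x : 'cV[R]_n) : R := Num.sqrt (dotv x x).

Definition usphere n : set 'cV[R]_n := [set x | enorm x = 1].

Definition tsphere n (q : 'cV[R]_n) : set 'cV[R]_n :=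
  [set th | dotv th q = 0 /\ enorm th = 1].

Definition borel n : set (set 'cV[R]_n) := <<s open >>.

Definition updc n (x : 'cV[R]_n) (k : nat) (t : R) : 'cV[R]_n :=
  \col_(j < n) (if (j : nat) == k then t else x j 0).

Fixpoint iint n (k : nat) (g : 'cV[R]_n -> \bar R) (x : 'cV[R]_n) : \bar R :=
  match k with
  | 0 => g x
  | k'.+1 => (\int[@lebesgue_measure R]_t iint k' g (updc x k' t))%E
  end.

(* Lebesgue integral over R^n of a nonnegative function
   (as an iterated integral over the n coordinates; Tonelli) *)
Definition leb_int n (g : 'cV[R]_n -> \bar R) : \bar R := iint n g 0.

(* integral w.r.t. the surface measure sigma of S^{n-1}, of a nonnegative
   function f, via the cone formula
     int_{S^{n-1}} f dsigma = n * int_{0 < |x| <= 1} f(x/|x|) dx *)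
Definition sph_int n (f : 'cV[R]_n -> \bar R) : \bar R :=
  ((n%:R)%:E * leb_int (fun x : 'cV[R]_n =>
     if ((0 < enorm x) && (enorm x <= 1))%R then f ((enorm x)^-1 *: x)%R
     else 0%E))%E.

Definition sph_area n : R := fine (sph_int (fun _ : 'cV[R]_n => 1%E)).

Definition evec n (i : 'I_n) : 'cV[R]_n := delta_mx i 0.

Definition C2_on n (U : set 'cV[R]_n) (g : 'cV[R]_n -> R) : Prop :=
  open U /\ {within U, continuous g} /\
  forall i j : 'I_n,
    (forall x, U x -> derivable g x (evec i)) /\
    {within U, continuous (fun x => 'D_(evec i) g x)} /\
    (forall x, U x -> derivable (fun y => 'D_(evec i) g y) x (evec j)) /\
    {within U, continuous (fun x => 'D_(evec j) (fun y => 'D_(evec i) g y) x)}.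

Definition C2_on_sphere n (rho : 'cV[R]_n -> R) : Prop :=
  exists (U : set 'cV[R]_n) (g : 'cV[R]_n -> R),
    @usphere n `<=` U /\ C2_on U g /\ (forall x, @usphere n x -> g x = rho x).

Definition sphere_density n (rho : 'cV[R]_n -> R) : Prop :=
  (forall x, @usphere n x -> 0 <= rho x) /\
  sph_int (fun x => (rho x)%:E) = 1%E.

Context {dO : measure_display} {Omega : measurableType dO}.

Definition random_vector n (X : Omega -> 'cV[R]_n) : Prop :=
  forall A, borel A -> measurable (X @^-1` A).

Definition has_sphere_law (P : probability Omega R) n
    (rho : 'cV[R]_n -> R) (X : Omega -> 'cV[R]_n) : Prop :=
  forall A, borel A ->
    P (X @^-1` A) = sph_int (fun x => (\1_A x)%:E * ((rho x)%:E))%E.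

(* Theta is uniformly distributed on S_q^{n-2}: its law is the image of the
   normalised surface measure of S^{n-2} (in R^{n-1}) under a linear
   isometry U of R^{n-1} onto the hyperplane q^perp *)
Definition uniform_tsphere (P : probability Omega R) n (q : 'cV[R]_n)
    (Th : Omega -> 'cV[R]_n) : Prop :=
  exists U : 'M[R]_(n, n.-1),
    U^T *m U = 1%:M /\ U^T *m q = 0 /\
    forall A, borel A ->
      P (Th @^-1` A) =
      ((sph_int (fun y : 'cV[R]_(n.-1) => (\1_A (U *m y))%:E))
        * ((sph_area n.-1)^-1)%:E)%E.

Definition mutually_independent (P : probability Omega R) n
    (X : nat -> Omega -> 'cV[R]_n) : Prop :=
  forall (N : nat) (A : nat -> set 'cV[R]_n), (forall i, borel (A i)) ->
    P (\bigcap_(i in `I_N) (X i @^-1` A i)) =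
    (\prod_(i < N) P (X i @^-1` A i))%E.

Definition independent2 (P : probability Omega R) n
    (Y : Omega -> R) (X : Omega -> 'cV[R]_n) : Prop :=
  forall (B : set R) (A : set 'cV[R]_n), measurable B -> borel A ->
    P (Y @^-1` B `&` X @^-1` A) = (P (Y @^-1` B) * P (X @^-1` A))%E.

End Defs.
Arguments usphere {R} n.
Arguments sph_area {R} n.

Definition cvg_distr (R : realType) n
    {d1 : measure_display} {O1 : measurableType d1} (P : probability O1 R)
    (Z : nat -> O1 -> 'cV[R]_n)
    {d2 : measure_display} {O2 : measurableType d2} (Q : probability O2 R)
    (W : O2 -> 'cV[R]_n) : Prop :=
  forall f : 'cV[R]_n -> R, continuous f -> (exists M, forall x, `|f x| <= M) ->
    (fun k => \int[P]_w (f (Z k w))%:E)%E @ \oo --> (\int[Q]_w (f (W w))%:E)%E.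

Definition cvg_prob (R : realType) n
    {d1 : measure_display} {O1 : measurableType d1} (P : probability O1 R)
    (Z : nat -> O1 -> 'cV[R]_n) (c : 'cV[R]_n) : Prop :=
  forall e : R, 0 < e ->
    (fun k => P [set w | e < enorm (Z k w - c)]) @ \oo --> 0%E.

Section Attention.
Variables (R : realType) (d : nat) (T : Type).
Variables (q : 'cV[R]_d) (V : 'M[R]_d) (x : nat -> T -> 'cV[R]_d)
          (beta : nat -> R).

Definition Tsc (i : nat) (w : T) : R := 1 - dotv q (x i w).
Definition Zsum (n : nat) (w : T) : R :=
  \sum_(j < n) expR (- beta n * Tsc j w).
Definition Aw (n i : nat) (w : T) : R := expR (- beta n * Tsc i w) / Zsum n w.
Definition ATT (n : nat) (w : T) : 'cV[R]_d :=
  V *m (\sum_(i < n) Aw n i w *: x i w).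
Definition Yn (n : nat) (w : T) : 'cV[R]_d :=
  V *m (\sum_(i < n) Aw n i w *: (x i w - q)).
End Attention.

(* Main.v *)
Require Import Defs.
From HB Require Import structures.
From mathcomp Require Import all_boot all_order all_algebra.
From mathcomp Require Import all_classical all_reals all_analysis.
From mathcomp Require Import measurable_realfun.
From mathcomp Require Import ring lra.

(** Because [beta_n >> n ^ alpha], the softmax average concentrates on the sample point
nearest to [q], so it suffices to find the limit law of that point.

With [rad x = sqrt (1 - <q, x>)], the law of [x_1] gives a spherical cap
[{rad <= y, direction in B}] the mass [(1 + o(1)) C(q) y ^ (d - 1) S(B)], where [S] is the
uniform law on [S ^ (d - 2)]. By the cone formula this is a computation of Lebesgue volumes of
cones, once iterated Lebesgue integration is known to be rotation invariant; that follows from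
the uniqueness of translation invariant measures.

With [c_n = sqrt a_n], consider the events that [c_n rad x_i] lies in [(A - eta, A]] while all
other sample points have [c_n rad x_j > A + eta]. They are disjoint when [i < n] and [A] in
[eta N] vary, so no measurable choice of a nearest point is needed, and independence gives their
probabilities. On such an event [c_n Y_n] is close to [V (sqrt 2 A theta_i)], the other points
contributing a factor [exp (- beta_n eta / c_n ^ 2 ...)]. Summing over [i] and [A] yields
[liminf E f (c_n Y_n) >= E f (V Phi)] for every bounded continuous [f >= 0]; applying this to
[M + f] and [M - f] gives convergence. *)

Set Implicit Arguments.
Unset Strict Implicit.
Unset Printing Implicit Defensive.
Import Order.TTheory GRing.Theory Num.Theory.
Import numFieldNormedType.Exports.
Local Open Scope classical_set_scope.
Local Open Scope ring_scope.

(** The scale is fixed by [c_n ^ (d - 1) = C(q) n]: a cap of scaled radius [A] then holds about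
    [A ^ (d - 1)] sample points on average, and the nearest point lies beyond [A] with probability
    close to [exp (- A ^ (d - 1))], which is the tail of [sqrt R1]. The isolated events do not fill
    the probability space: the empty gap of width [eta] loses mass that disappears only with the
    mesh. This is why the method yields a lower bound, for [f >= 0], and not a limit at once. The
    gap is what makes the other weights small: with [R_j = c_n rad x_j], it gives
    [R_j ^ 2 - R_i ^ 2 >= eta R_j]. The contribution of the other points is not small uniformly. It
    is a deterministic factor tending to 0 times [sum_j exp (- R_j)], a random sum whose expectation
    stays bounded in [n]; where the product is large, [f >= 0] and [f <= M] are used instead of
    continuity. The growth of [beta_n] enters as [beta_n / c_n ^ 2 -> oo]. *)

Notation BV R n := (g_sigma_algebraType (@open 'cV[R]_n)).

(** * Borel sets and iterated Lebesgue measure *)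

Section Borel.
Variable R : realType.

Lemma open_borel n (A : set 'cV[R]_n) : open A -> borel A.
Proof. by move=> oA; exact: sub_gen_smallest. Qed.

Lemma continuous_measurable_BV_real n (f : 'cV[R]_n -> R) :
  continuous f -> measurable_fun [set: BV R n] (f : BV R n -> R).
Proof.
move=> cf; apply: (measurability _ (RGenOpens.measurableE R)).
move=> _ [_ [a [b ->] <-]]; rewrite setTI; apply: open_borel.
by move/continuousP : cf; apply; exact: interval_open.
Qed.

Lemma measurable_coord n (i : 'I_n) :
  measurable_fun [set: BV R n] (fun x : BV R n => x i 0).
Proof. by apply: continuous_measurable_BV_real; exact: coord_continuous. Qed.

(** The sigma-algebra is generated by all open sets, so the coordinates suffice by second
    countability: an open set is the union of the countably many boxes it contains with rational
    centre and radius [1 / (k + 1)]. *)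
Lemma measurable_to_BV d (T : measurableType d) n (f : T -> BV R n) :
  (forall i : 'I_n, measurable_fun [set: T] (fun t => f t i 0)) ->
  measurable_fun [set: T] f.
Proof.
have dist3 (a b c e k : R) : k < e / 2 -> `|c - a| < k -> `|c - b| < k -> `|a - b| < e.
  rewrite !ltr_norml => ? /andP[? ?] /andP[? ?]; apply/andP; split; lra.
move=> mf; apply: (@measurability _ _ T (BV R n) _ _ open) => //.
move=> _ [A oA <-]; rewrite setTI.
pose box (p : 'cV[rat]_n * nat) : set 'cV[R]_n :=
  [set y | forall i, `|ratr (p.1 i 0) - y i 0| < p.2.+1%:R^-1].
have -> : f @^-1` A = \bigcup_(p in [set p | box p `<=` A]) (f @^-1` box p).
  rewrite predeqE => t; split => [|[p /= pA]]; last exact: pA.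
  move=> /= Aft; have := open_nbhs_nbhs (conj oA Aft).
  move=> nA; have [e e0 eA] : exists2 e : R, 0 < e & ball (f t : 'cV[R]_n) e `<=` A.
    by move: nA => /nbhs_ballP[e /= e0 eA]; exists e.
  have [k ke] : exists k : nat, (k.+1%:R^-1 : R) < e / 2.
    have e20 : 0 < e / 2 by rewrite divr_gt0.
    have [k _ kP] := near_infty_natSinv_lt (PosNum e20).
    by exists k; apply: (kP k) => /=.
  have k0 : (0 : R) < k.+1%:R^-1 by rewrite invr_gt0 ltr0n.
  have q_ i : {r : rat | `|(ratr r : R) - f t i 0| < k.+1%:R^-1}.
    apply: cid.
    have [|r] := @rat_in_itvoo _ (f t i 0 - k.+1%:R^-1) (f t i 0 + k.+1%:R^-1).
      by rewrite ltrD2l gtrN.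
    by rewrite in_itv/= => /andP[r1 r2]; exists r; rewrite ltr_distl r1 r2.
  exists (\col_i sval (q_ i), k) => /=; last by move=> i; rewrite mxE; case: (q_ i).
  move=> y ybox; apply: eA; split => // i j; rewrite (ord1 j) /ball/=.
  have := ybox i; have := svalP (q_ i); rewrite mxE /=.
  exact: dist3 ke.
rewrite bigcup_mkcond; apply: countable_bigcupT_measurable => [//|].
move=> p; case: ifPn => // _.
have -> : f @^-1` box p =
    \bigcap_(i in [set: 'I_n]) [set t | `|ratr (p.1 i 0) - f t i 0| < p.2.+1%:R^-1].
  by apply/seteqP; split => t /= h i; [move=> _ /=|]; apply: h.
apply: fin_bigcap_measurable => // i _.
have -> : [set t | `|ratr (p.1 i 0) - f t i 0| < p.2.+1%:R^-1] =
  setT `&` (fun t => `|ratr (p.1 i 0) - f t i 0|) @^-1` `]-oo, p.2.+1%:R^-1[%classic.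
  by rewrite setTI; apply/seteqP; split => t /=; rewrite in_itv/=.
have : measurable_fun setT (fun t => `|ratr (p.1 i 0) - f t i 0| : R).
  apply: measurableT_comp => //; exact: measurable_funB.
by apply => //; exact: measurable_itv.
Qed.

End Borel.

Section Push.
Local Open Scope ereal_scope.
Context d d' (T1 : measurableType d) (T2 : measurableType d') (R : realType).
Variables (m : {measure set T1 -> \bar R}) (f : T1 -> T2).

(** The measurability proof is an argument so that the structures attached to [push] can be inferred
    from the term alone. *)
Definition push of measurable_fun [set: T1] f := fun A : set T2 => m (f @^-1` A).

Hypothesis mf : measurable_fun [set: T1] f.

Let push0 : push mf set0 = 0.
Proof. by rewrite /push preimage_set0 measure0. Qed.

Let push_ge0 A : 0 <= push mf A.
Proof. exact: measure_ge0. Qed.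

Let push_sigma_additive : semi_sigma_additive (push mf).
Proof. exact: (@measure_semi_sigma_additive _ _ _ (pushforward m f)). Qed.

HB.instance Definition _ := isMeasure.Build _ _ _ (push mf)
  push0 push_ge0 push_sigma_additive.

Lemma ge0_integral_push (g : T2 -> \bar R) :
  measurable_fun setT g -> (forall y, 0 <= g y) ->
  \int[push mf]_y g y = \int[m]_x g (f x).
Proof.
move=> mg g0; rewrite -(ge0_integral_pushforward mf m measurableT mg (fun y _ => g0 y)).
exact: eq_measure_integral.
Qed.

End Push.

Section Line.
Variable R : realType.
Local Notation mu := (@lebesgue_measure R).

(** Lebesgue measure and its image under the translation agree on half-open intervals, hence on all
    measurable sets. *)
Lemma integral_lebesgue_shift (g : R -> \bar R) (h : R) :
  measurable_fun setT g -> (forall t, (0 <= g t)%E) ->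
  (\int[mu]_t g (t + h)%R = \int[mu]_t g t)%E.
Proof.
move=> mg g0.
have mh : measurable_fun [set: measurableTypeR R] (fun t : R => t + h : measurableTypeR R).
  exact: measurable_funD.
have E : forall A : set R, measurable A -> mu A = push mu mh A.
  apply: lebesgue_measure_unique => _ [[a b] _ <-] /=.
  rewrite /push.
  have -> : (fun t : R => t + h) @^-1` [set` `]a, b]] = [set` `]a - h, b - h]].
    by apply/seteqP; split => t /=; rewrite !in_itv/= ltrBlDr lerBrDr.
  rewrite !lebesgue_measure_itv/= !lte_fin ltrD2r; case: ifP => // _.
  by rewrite -!EFinD; congr EFin; ring.
transitivity (\int[push mu mh]_t g t)%E.
  by rewrite ge0_integral_push.
apply: eq_measure_integral => A mA _.
by apply/esym; exact: E.
Qed.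

Lemma integral_lebesgue_scale (g : R -> \bar R) (c : R) : 0 < c ->
  measurable_fun setT g -> (forall t, (0 <= g t)%E) ->
  (c%:E * \int[mu]_t g (c * t)%R = \int[mu]_t g t)%E.
Proof.
move=> c0 mg g0.
have mh : measurable_fun [set: measurableTypeR R] (fun t : R => c * t : measurableTypeR R).
  exact: measurable_funM.
pose nu := mscale (NngNum (ltW c0)) (push mu mh).
have E : forall A : set R, measurable A -> mu A = nu A.
  apply: lebesgue_measure_unique => _ [[a b] _ <-] /=.
  rewrite /nu /mscale/= /push.
  have -> : (fun t : R => c * t) @^-1` [set` `]a, b]] = [set` `]c^-1 * a, c^-1 * b]].
    by apply/seteqP; split => t /=; rewrite !in_itv/= ltr_pdivrMl// ler_pdivlMl.
  rewrite !lebesgue_measure_itv/= !lte_fin ltr_pM2l ?invr_gt0//.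
  case: ifP => _; last by rewrite mule0.
  by rewrite -!EFinD -EFinM mulrBr !mulrA divff ?gt_eqF// !mul1r.
transitivity (\int[nu]_t g t)%E.
  rewrite ge0_integral_mscale//=; congr (_ * _)%E.
  by rewrite ge0_integral_push.
apply: eq_measure_integral => A mA _.
by apply/esym; exact: E.
Qed.

End Line.

Section Iint.
Variables (R : realType) (n : nat).
Local Notation mu := (@lebesgue_measure R).
Implicit Types (g : BV R n -> \bar R) (x y : BV R n).

Lemma BVP x y : (forall j : 'I_n, x j 0 = y j 0) -> x = y.
Proof. by move=> h; exact/colP. Qed.

Lemma measurable_updc k :
  measurable_fun [set: BV R n * R] (fun p : BV R n * R => updc p.1 k p.2 : BV R n).
Proof.
apply: measurable_to_BV => i.
case: (boolP ((i : nat) == k)) => ik.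
  rewrite [X in measurable_fun _ X](_ : _ = snd) //.
  by apply/funext => p; rewrite mxE ik.
rewrite [X in measurable_fun _ X](_ : _ = (fun y : BV R n => y i 0) \o fst).
  by apply: measurableT_comp => //; exact: measurable_coord.
by apply/funext => p; rewrite mxE (negbTE ik).
Qed.

Lemma measurable_scale_BV (c : R) :
  measurable_fun [set: BV R n] (fun y : BV R n => c *: y : BV R n).
Proof.
apply: measurable_to_BV => i.
under eq_fun do rewrite mxE.
by apply: measurable_funM => //; exact: measurable_coord.
Qed.

Lemma iint_ge0 k g x : (forall y, (0 <= g y)%E) -> (0 <= iint k g x)%E.
Proof.
by move=> g0; elim: k x => [|k ih] x //=; apply: integral_ge0 => t _.
Qed.

(** Each step of the induction is the measurability part of Tonelli's theorem on [BV R n * R]. *)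
Lemma measurable_iint k g : (forall y, (0 <= g y)%E) ->
  measurable_fun setT g -> measurable_fun [set: BV R n] (iint k g).
Proof.
move=> g0 mg; elim: k => [//|k ih].
pose f (p : BV R n * measurableTypeR R) := iint k g (updc p.1 k p.2).
have mf : measurable_fun setT f.
  by apply: (measurableT_comp ih); exact: measurable_updc.
have f0 p : (0 <= f p)%E by exact: iint_ge0.
exact: (@measurable_fun_fubini_tonelli_F _ _ _ _ _ mu f mf f0).
Qed.

Lemma measurable_iint_updc k j g x : (forall y, (0 <= g y)%E) ->
  measurable_fun setT g -> measurable_fun [set: R] (fun t => iint k g (updc x j t)).
Proof.
move=> g0 mg.
have mx : measurable_fun [set: measurableTypeR R] (fun t : measurableTypeR R => (x, t)).
  exact: pair1_measurable.
exact: (measurableT_comp (measurable_iint k g0 mg) (measurableT_comp (measurable_updc j) mx)).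
Qed.

Lemma iint_nneseries k (g : nat -> BV R n -> \bar R) x :
  (forall i y, (0 <= g i y)%E) -> (forall i, measurable_fun setT (g i)) ->
  iint k (fun y => (\sum_(i <oo) g i y)%E) x = (\sum_(i <oo) iint k (g i) x)%E.
Proof.
move=> g0 mg; elim: k x => [//|k ih] x /=.
under eq_integral do rewrite ih.
rewrite integral_nneseries//.
  by move=> i; exact: measurable_iint_updc.
by move=> i t _; exact: iint_ge0.
Qed.

Lemma iintZ k (r : R) g x : 0 <= r -> (forall y, (0 <= g y)%E) -> measurable_fun setT g ->
  iint k (fun y => (r%:E * g y)%E) x = (r%:E * iint k g x)%E.
Proof.
move=> r0 g0 mg; elim: k x => [//|k ih] x /=.
under eq_integral do rewrite ih.
rewrite ge0_integralZl//.
- exact: measurable_iint_updc.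
- by move=> t _; exact: iint_ge0.
Qed.

(** The coordinates below [k] are overwritten by integration variables before [g] is evaluated. For
    [k = n] the base point therefore does not matter at all. *)
Lemma iint_coords k g x y : (forall j : 'I_n, (k <= j)%N -> x j 0 = y j 0) ->
  iint k g x = iint k g y.
Proof.
elim: k x y => [|k ih] x y xy /=.
  by congr g; apply: BVP => j; rewrite xy.
apply: eq_integral => t _; apply: ih => j kj; rewrite !mxE.
by case: eqP => // /eqP jk; apply: xy; rewrite ltn_neqAle eq_sym jk.
Qed.

Lemma leb_intE g x : leb_int g = iint n g x.
Proof. by apply: iint_coords => j; rewrite leqNgt ltn_ord. Qed.

(** The coordinates from [k] on are not integrated and keep the shift, which reappears in the base
    point; this lets the induction treat one variable at a time. *)
Lemma iint_shift k g x h : (k <= n)%N -> (forall y, (0 <= g y)%E) -> measurable_fun setT g ->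
  iint k (fun y => g (y + h)) x = iint k g (x + h).
Proof.
move=> + g0 mg; elim: k x => [//|k ih] x kn /=.
rewrite -[RHS](@integral_lebesgue_shift _ _ (h (Ordinal kn) 0)).
- apply: eq_integral => t _; rewrite ih ?(ltnW kn)//; congr iint.
  apply: BVP => j; rewrite !mxE; case: eqP => // jk.
 by have -> : j = Ordinal kn by exact/val_inj.
- exact: measurable_iint_updc.
- by move=> t; exact: iint_ge0.
Qed.

Lemma iint_scale k g x (c : R) : 0 < c -> (k <= n)%N -> (forall y, (0 <= g y)%E) ->
  measurable_fun setT g ->
  ((c ^+ k)%:E * iint k (fun y => g (c *: y)%R) x)%E = iint k g (c *: x).
Proof.
move=> c0 + g0 mg; elim: k x => [x _|k ih x kn] /=; first by rewrite mul1e.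
rewrite -[RHS](integral_lebesgue_scale c0).
- rewrite exprS EFinM -muleA; congr (_ * _)%E.
  rewrite -ge0_integralZl//.
  + apply: eq_integral => t _; rewrite ih ?(ltnW kn)//; congr iint.
    by apply: BVP => j; rewrite !mxE; case: eqP.
  + apply: measurable_iint_updc => //.
    exact: (measurableT_comp mg (measurable_scale_BV c)).
  + by move=> t _; exact: iint_ge0.
  + by rewrite lee_fin exprn_ge0// ltW.
- exact: measurable_iint_updc.
- by move=> t; exact: iint_ge0.
Qed.

End Iint.

Section Leb.
Variables (R : realType) (n : nat).
Local Open Scope ereal_scope.

Definition Leb (A : set (BV R n)) : \bar R := leb_int (fun x => (\1_A x)%:E).

Lemma indic_EFin_ge0 T (A : set T) x : 0 <= (\1_A x : R)%:E.
Proof. by rewrite lee_fin. Qed.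

Lemma measurable_indic_EFin d (T : measurableType d) (A : set T) : measurable A ->
  measurable_fun [set: T] (fun x => (\1_A x : R)%:E).
Proof. by move=> mA; apply/measurable_EFinP; exact: measurable_indic. Qed.

Hint Resolve indic_EFin_ge0 : core.

Let Leb0 : Leb set0 = 0.
Proof.
have H k x : iint k (fun x : BV R n => (\1_(set0 : set (BV R n)) x)%:E) x = 0.
  elim: k x => [|k ih] x /=; first by rewrite indicE in_set0.
  by apply: integral0_eq => t _.
exact: H.
Qed.

Let Leb_ge0 A : 0 <= Leb A.
Proof. exact: iint_ge0. Qed.

(** Countable additivity amounts to exchanging a series of nonnegative functions with each
    one-dimensional integral. *)
Let Leb_sigma_additive : semi_sigma_additive Leb.
Proof.
move=> F mF tF mUF; rewrite {2}/Leb.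
have -> : leb_int (fun x => (\1_(\bigcup_k F k) x)%:E) = \sum_(0 <= k <oo) Leb (F k).
  rewrite -(@iint_nneseries R n n (fun k x => (\1_(F k) x)%:E))//.
    by congr iint; apply/funext => x; rewrite indic_bigcup.
  by move=> i; exact: (measurable_indic_EFin (mF i)).
by apply: is_cvg_nneseries => i _ _; exact: Leb_ge0.
Qed.

HB.instance Definition _ := isMeasure.Build _ _ _ Leb Leb0 Leb_ge0 Leb_sigma_additive.

Lemma Leb_shift (A : set (BV R n)) (h : BV R n) : measurable A ->
  Leb [set x | A (x + h)%R] = Leb A.
Proof.
move=> mA; rewrite /Leb [RHS](leb_intE _ (0 + h : BV R n)%R).
rewrite -(iint_shift (g := fun x => (\1_A x)%:E))//.
exact: measurable_indic_EFin.
Qed.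

Lemma Leb_scale (A : set (BV R n)) (c : R) : (0 < c)%R -> measurable A ->
  (c ^+ n)%:E * Leb [set x | A (c *: x)%R] = Leb A.
Proof.
move=> c0 mA; rewrite /Leb.
rewrite [RHS](leb_intE _ (c *: (0 : BV R n))%R) -(iint_scale (g := fun x => (\1_A x)%:E) _ c0)//.
exact: measurable_indic_EFin.
Qed.

Definition cube (a : R) : set (BV R n) := [set x | forall i : 'I_n, (`|x i ord0| <= a)%R].

Lemma measurable_cube a : measurable (cube a).
Proof.
have -> : cube a = \bigcap_(i in [set: 'I_n]) (fun x : BV R n => x i ord0) @^-1` `[(- a)%R, a]%classic.
  apply/seteqP; split => x /= h i.
    by move=> _; rewrite /= in_itv/= -ler_norml; exact: h.
  by have := h i Logic.I; rewrite /= in_itv/= -ler_norml.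
apply: fin_bigcap_measurable => // i _; rewrite -[X in measurable X]setTI.
by apply: measurable_coord => //; exact: measurable_itv.
Qed.

(** The case [a = 0] says that a point is null in positive dimension; [Leb_apex] relies on it. *)
Lemma Leb_cube a : (0 <= a)%R -> Leb (cube a) = ((2 * a) ^+ n)%:E.
Proof.
move=> a0.
(* After [k] integrations the constraint survives on the coordinates from [k] on; each further step
   splits off the one at [k]. *)
have H k x : (k <= n)%N -> iint k (fun x => (\1_(cube a) x)%:E) x =
    ((2 * a) ^+ k)%:E * (\1_[set x : BV R n | forall i : 'I_n, (k <= i)%N -> (`|x i ord0| <= a)%R] x)%:E.
  elim: k x => [|k ih] x kn /=.
    rewrite mul1e; congr (\1__ _)%:E; apply/seteqP; split => y h i; first by move=> _; exact: h.
    exact: h.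
  under eq_integral do rewrite ih ?(ltnW kn)//.
  have -> : (fun t => ((2 * a) ^+ k)%:E * (\1_[set x0 : BV R n | forall i : 'I_n, (k <= i)%N -> (`|x0 i ord0| <= a)%R] (updc x k t))%:E) =
     (fun t => ((2 * a) ^+ k * \1_[set x0 : BV R n | forall i : 'I_n, (k < i)%N -> (`|x0 i ord0| <= a)%R] x)%:E * (\1_(`[(-a)%R, a]%classic : set R) t)%:E).
    apply/funext => t; rewrite -!EFinM -mulrA; congr (_ * _)%:E.
    rewrite !indicE -natrM; congr (_%:R); rewrite mulnb; congr nat_of_bool.
    apply/idP/idP; rewrite !inE/=.
      move=> h; apply/andP; split; rewrite inE/=.
        by move=> i ki; have := h i (ltnW ki); rewrite mxE gtn_eqF.
      by have := h (Ordinal kn) (leqnn _); rewrite mxE eqxx ler_norml in_itv.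
    move=> /andP[]; rewrite !inE/= => h1 h2 i ki; rewrite mxE; case: ifPn => ik.
      by move: h2; rewrite in_itv/= ler_norml.
    by apply: h1; rewrite ltn_neqAle eq_sym ik.
  rewrite ge0_integralZl//; last 2 first.
  - by apply: measurable_indic_EFin; exact: measurable_itv.
  - by rewrite lee_fin mulr_ge0// exprn_ge0// mulr_ge0.
  rewrite integral_indic//= setIT lebesgue_measure_itv/= lte_fin.
  have -> : (if (- a < a)%R then a%:E - (- a)%:E else 0) = (2 * a)%:E.
    case: ifPn => [_|]; first by rewrite -EFinD opprK; congr EFin; ring.
    by rewrite -leNgt => h; congr EFin; lra.
  by rewrite -!EFinM; congr EFin; rewrite exprS; ring.
rewrite /Leb /leb_int H// indicE mem_set ?mule1//= => i.
by rewrite leqNgt ltn_ord.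
Qed.

End Leb.

(** * Rotation invariance *)

Section Enorm.
Variable R : realType.

Lemma dotvC n (x y : 'cV[R]_n) : dotv x y = dotv y x.
Proof. by apply: eq_bigr => i _; rewrite mulrC. Qed.

Lemma dotvDl n (x y z : 'cV[R]_n) : dotv (x + y) z = dotv x z + dotv y z.
Proof. by rewrite -big_split; apply: eq_bigr => i _; rewrite mxE mulrDl. Qed.

Lemma dotvZl n c (x y : 'cV[R]_n) : dotv (c *: x) y = c * dotv x y.
Proof. by rewrite mulr_sumr; apply: eq_bigr => i _; rewrite mxE mulrA. Qed.

Lemma dotvDr n (x y z : 'cV[R]_n) : dotv z (x + y) = dotv z x + dotv z y.
Proof. by rewrite dotvC dotvDl !(dotvC z). Qed.

Lemma dotvZr n c (x y : 'cV[R]_n) : dotv y (c *: x) = c * dotv y x.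
Proof. by rewrite dotvC dotvZl dotvC. Qed.

Lemma dotv_ge0 n (x : 'cV[R]_n) : 0 <= dotv x x.
Proof. by apply: sumr_ge0 => i _; rewrite -expr2 sqr_ge0. Qed.

Lemma enorm_ge0 n (x : 'cV[R]_n) : 0 <= enorm x.
Proof. exact: sqrtr_ge0. Qed.

Lemma enorm_sqr n (x : 'cV[R]_n) : enorm x ^+ 2 = dotv x x.
Proof. by rewrite sqr_sqrtr// dotv_ge0. Qed.

Lemma enormZ n c (x : 'cV[R]_n) : enorm (c *: x) = `|c| * enorm x.
Proof. by rewrite /enorm dotvZl dotvZr mulrA -expr2 sqrtrM ?sqr_ge0// sqrtr_sqr. Qed.

Lemma coord_le_enorm n (x : 'cV[R]_n) i : `|x i 0| <= enorm x.
Proof.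
rewrite -sqrtr_sqr ler_sqrt ?dotv_ge0// /dotv (bigD1 i)//= -expr2 lerDl.
by apply: sumr_ge0 => j _; rewrite -expr2 sqr_ge0.
Qed.

(** The topology of column vectors comes from the maximum norm, the geometry from [enorm]. This
    bound and [enorm_le_norm] translate between the two. *)
Lemma norm_le_enorm n (x : 'cV[R]_n) : `|x| <= enorm x.
Proof.
rewrite [leLHS]/Num.Def.normr/= mx_normrE (bigmax_le _ (enorm_ge0 x))//= => -[i j] _ /=.
by rewrite (ord1 j) coord_le_enorm.
Qed.

Lemma enorm_eq0 n (x : 'cV[R]_n) : (enorm x == 0) = (x == 0).
Proof.
apply/idP/idP => [/eqP x0|/eqP ->].
  by rewrite -normr_le0 -x0 norm_le_enorm.
by rewrite -(scale0r 0) enormZ normr0 mul0r.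
Qed.

Lemma coord_le_norm n (x : 'cV[R]_n) i : `|x i 0| <= `|x|.
Proof.
rewrite [leRHS]/Num.Def.normr/= mx_normrE.
by apply/bigmax_geP; right; exists (i, 0).
Qed.

Lemma enorm_le_norm n (x : 'cV[R]_n) : enorm x <= n%:R * `|x|.
Proof.
rewrite -[leRHS]ger0_norm ?mulr_ge0// -sqrtr_sqr ler_sqrt ?sqr_ge0// exprMn.
apply: (@le_trans _ _ (\sum_(i < n) `|x| ^+ 2)).
  apply: ler_sum => i _; rewrite -expr2 -real_normK ?num_real//.
  by rewrite ler_pXn2r ?nnegrE// coord_le_norm.
rewrite sumr_const card_ord -[leLHS]mulr_natl ler_wpM2r ?sqr_ge0//.
by rewrite -natrX ler_nat; case: (n) => // k; rewrite -mulnn leq_pmulr.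
Qed.

Lemma dotv_mulmx n k (M : 'M[R]_(n, k)) (x : 'cV[R]_k) (y : 'cV[R]_n) :
  dotv (M *m x) y = dotv x (M^T *m y).
Proof.
have dE j (u v : 'cV[R]_j) : dotv u v = (u^T *m v) 0 0.
  by rewrite mxE; apply: eq_bigr => i _; rewrite mxE.
by rewrite !dE trmx_mul mulmxA.
Qed.

Lemma enorm_isometry n k (M : 'M[R]_(n, k)) (x : 'cV[R]_k) :
  M^T *m M = 1%:M -> enorm (M *m x) = enorm x.
Proof. by move=> h; rewrite /enorm dotv_mulmx mulmxA h mul1mx. Qed.

Lemma measurable_mulmx n k (M : 'M[R]_(k, n)) :
  measurable_fun [set: BV R n] (fun x : BV R n => M *m x : BV R k).
Proof.
apply: measurable_to_BV => i; under eq_fun do rewrite mxE.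
by apply: measurable_sum => j; apply: measurable_funM => //; exact: measurable_coord.
Qed.

Lemma measurable_dotv d (T : measurableType d) n (f g : T -> BV R n) :
  measurable_fun [set: T] f -> measurable_fun [set: T] g ->
  measurable_fun [set: T] (fun t => dotv (f t) (g t)).
Proof.
move=> mf mg; apply: measurable_sum => j; apply: measurable_funM.
- exact: (measurableT_comp (measurable_coord j) mf).
- exact: (measurableT_comp (measurable_coord j) mg).
Qed.

Lemma measurable_enorm n : measurable_fun [set: BV R n] (fun x : BV R n => enorm x).
Proof.
have h := @measurable_dotv _ (BV R n) n id id (@measurable_id _ _ _) (@measurable_id _ _ _).
have h2 : measurable_fun [set: R] (@Num.sqrt R).
  by apply: continuous_measurable_fun; exact: sqrt_continuous.
exact: (measurableT_comp h2 h).
Qed.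

End Enorm.

Section Fubini_sets.
Local Open Scope ereal_scope.
Context d1 d2 (T1 : measurableType d1) (T2 : measurableType d2) (R : realType).
Variables (m1 : {sigma_finite_measure set T1 -> \bar R})
  (m2 : {sigma_finite_measure set T2 -> \bar R}).

Lemma fubini_set (E : set (T1 * T2)) : measurable E ->
  \int[m1]_x m2 [set y | E (x, y)] = \int[m2]_y m1 [set x | E (x, y)].
Proof.
move=> mE.
have := @fubini_tonelli _ _ T1 T2 R m1 m2 (fun p => (\1_E p)%:E) (measurable_indic_EFin mE)
  (indic_EFin_ge0 R E).
have m1E y : measurable [set x | E (x, y)].
  by rewrite -[X in measurable X]setTI; apply: (@pair2_measurable _ _ T1 T2 y).
have m2E x : measurable [set y | E (x, y)].
  by rewrite -[X in measurable X]setTI; apply: (@pair1_measurable _ _ T1 T2 x).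
congr (_ = _); apply: eq_integral => t _.
- by rewrite -[in RHS](setIT [set y | E (t, y)]) -integral_indic.
- by rewrite -[in RHS](setIT [set y | E (y, t)]) -integral_indic.
Qed.

End Fubini_sets.

Section Rotation.
Variables (R : realType) (n : nat).
Local Open Scope ereal_scope.

(** The Euclidean ball is the reference set that fixes the constant in the uniqueness argument: it
    is symmetric, of positive finite measure, and preserved by rotations. *)
Let ball_ (r : R) : set (BV R n) := [set x | (enorm x <= r)%R].

Let mball r : measurable (ball_ r).
Proof.
rewrite -[X in measurable X]setTI.
have -> : ball_ r = (fun x : BV R n => enorm x) @^-1` `]-oo, r]%classic.
  by apply/seteqP; split => x /=; rewrite in_itv.
by apply: measurable_enorm => //; exact: measurable_itv.
Qed.

Let Leb_ball_fin r : (0 <= r)%R -> Leb (ball_ r) < +oo.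
Proof.
move=> r0; apply: le_lt_trans (ltry ((2 * r) ^+ n)); rewrite -Leb_cube//.
apply: le_measure; rewrite ?inE//; first exact: measurable_cube.
by move=> x /= xr i; exact: le_trans (coord_le_enorm _ _) xr.
Qed.

Let Leb_ball_gt0 : 0 < Leb (ball_ 1).
Proof.
(* Since [enorm x <= n * |x|], a cube of half-side [1 / (n + 1)] lies in the unit ball, in dimension
   0 as well. *)
have a0 : (0 < n.+1%:R^-1 :> R)%R by rewrite invr_gt0 ltr0n.
apply: (@lt_le_trans _ _ (Leb (cube n.+1%:R^-1 : set (BV R n)))).
  by rewrite Leb_cube ?ltW// lte_fin exprn_gt0// mulr_gt0.
apply: le_measure; rewrite ?inE//; first exact: measurable_cube.
move=> x /= xr.
have := enorm_le_norm x; move/le_trans; apply.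
apply: (@le_trans _ _ (n%:R * n.+1%:R^-1)%R).
  rewrite ler_wpM2l// [leLHS]/Num.Def.normr/= mx_normrE (bigmax_le _ (ltW a0))//=.
  by move=> -[i j] _ /=; rewrite (ord1 j); exact: xr.
by rewrite ler_pdivrMr// mul1r ler_nat.
Qed.

Let ball_cover : [set: BV R n] = \bigcup_k ball_ k%:R.
Proof.
apply/esym/seteqP; split => // x _.
exists (Num.truncn (enorm x)).+1 => //=; rewrite /ball_/= ltW//.
exact: truncnS_gt.
Qed.

Let Leb_sigma_finite : sigma_finite setT (@Leb R n).
Proof.
exists (fun k => ball_ k%:R) => [|k]; first exact: ball_cover.
by split => //; exact: Leb_ball_fin.
Qed.

HB.instance Definition _ := Measure_isSigmaFinite.Build _ _ _ (@Leb R n) Leb_sigma_finite.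

(* Computing the (Leb x nu)-measure of {(x, y) | x in B, x + y in A} in both orders gives
   Leb B * nu A = Leb A * nu (- B). *)
Lemma translation_invariant_unique (nu : {sigma_finite_measure set (BV R n) -> \bar R})
    (B : set (BV R n)) :
  measurable B -> (forall x : BV R n, B (- x)%R <-> B x) ->
  (forall (A : set (BV R n)) (h : BV R n), measurable A -> nu [set x | A (x + h)%R] = nu A) ->
  nu B = Leb B -> 0 < Leb B -> Leb B < +oo ->
  forall A, measurable A -> nu A = Leb A.
Proof.
move=> mB BN nu_inv nuB B0 Boo A mA.
have mD : measurable_fun [set: BV R n * BV R n]
    (fun p : BV R n * BV R n => (p.2 + p.1)%R : BV R n).
  apply: measurable_to_BV => i; under eq_fun do rewrite mxE.
  by apply: measurable_funD; apply: (measurableT_comp (measurable_coord i)).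
have mS : measurable_fun [set: BV R n * BV R n]
    (fun p : BV R n * BV R n => (p.2 - p.1)%R : BV R n).
  apply: measurable_to_BV => i; under eq_fun do rewrite !mxE.
  by apply: measurable_funB; apply: (measurableT_comp (measurable_coord i)).
pose E1 := [set p : BV R n * BV R n | B p.1 /\ A (p.2 + p.1)%R].
pose E2 := [set p : BV R n * BV R n | A p.1 /\ B (p.2 - p.1)%R].
have mE1 : measurable E1.
  rewrite (_ : E1 = fst @^-1` B `&` (fun p => p.2 + p.1)%R @^-1` A)//.
  by apply: measurableI; rewrite -[X in measurable X]setTI; [exact: measurable_fst|exact: mD].
have mE2 : measurable E2.
  rewrite (_ : E2 = fst @^-1` A `&` (fun p => p.2 - p.1)%R @^-1` B)//.
  by apply: measurableI; rewrite -[X in measurable X]setTI; [exact: measurable_fst|exact: mS].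
have setE (X Y : set (BV R n)) : measurable X -> measurable Y -> forall c : \bar R,
    \int[@Leb R n]_x (if x \in X then c else 0) = Leb X * c.
  move=> mX mY c; under eq_integral do rewrite -patchE/=.
  by rewrite -integral_mkcond integral_cst// muleC.
have I1 : \int[@Leb R n]_x nu [set y | E1 (x, y)] = Leb B * nu A.
  rewrite -(setE _ _ mB mA); apply: eq_integral => x _.
  case: ifPn => xB.
    rewrite -(nu_inv _ x mA); congr (nu _); apply/seteqP; split => y /=; first by case.
    by split => //=; exact: set_mem.
  rewrite (_ : [set y | _] = set0) ?measure0//; apply/seteqP; split => y //= -[/= h _].
  by move: xB; rewrite mem_set.
have I2 : \int[@Leb R n]_x nu [set y | E2 (x, y)] = Leb A * Leb B.
  rewrite -(setE _ _ mA mB); apply: eq_integral => x _.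
  case: ifPn => xA.
    rewrite -nuB -(nu_inv _ (- x)%R mB); congr (nu _); apply/seteqP; split => y /=; first by case.
    by split => //=; exact: set_mem.
  rewrite (_ : [set y | _] = set0) ?measure0//; apply/seteqP; split => y //= -[/= h _].
  by move: xA; rewrite mem_set.
have I12 : Leb B * nu A = Leb A * Leb B.
  rewrite -I1 -I2.
  apply: (etrans (@fubini_set _ _ _ _ R (@Leb R n) nu E1 mE1)).
  apply: (etrans _ (esym (@fubini_set _ _ _ _ R (@Leb R n) nu E2 mE2))).
  apply: eq_integral => y _.
  have mE1y : measurable [set x | E1 (x, y)].
    by rewrite -[X in measurable X]setTI; apply: (@pair2_measurable _ _ (BV R n) (BV R n) y).
  (* Translating by [- y] carries the slice of [E1] at [y] to that of [E2]; here the symmetry of [B]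
     enters. *)
  apply: (etrans (esym (Leb_shift (- y)%R mE1y))); congr Leb.
  apply/seteqP; split => x /=; rewrite /E1 /E2/=.
    by move=> [Bx]; rewrite addrCA subrr addr0 => Ax; split => //; rewrite -BN opprB.
  by move=> [Ax Bx]; rewrite addrCA subrr addr0; split => //; rewrite -BN opprB.
move: I12; rewrite muleC => I12.
have fB : Leb B \is a fin_num by rewrite ge0_fin_numE.
rewrite -[LHS]mule1 -[RHS]mule1.
rewrite -(@divee _ (Leb B)) ?gt_eqF//.
by rewrite !muleA I12.
Qed.

Variable M : 'M[R]_n.
Hypothesis MM : M^T *m M = 1%:M.

Let nu := push (@Leb R n) (measurable_mulmx M).

Let nu_ball r : nu (ball_ r) = Leb (ball_ r).
Proof.
by congr Leb; apply/seteqP; split => x; rewrite /ball_/= enorm_isometry.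
Qed.

Let nu_sigma_finite : sigma_finite setT nu.
Proof.
exists (fun k => ball_ k%:R) => [|k]; first exact: ball_cover.
by split => //; rewrite nu_ball Leb_ball_fin.
Qed.

HB.instance Definition _ := Measure_isSigmaFinite.Build _ _ _
  (push (@Leb R n) (measurable_mulmx M)) nu_sigma_finite.

Lemma Leb_isometry (A : set (BV R n)) : measurable A ->
  Leb [set x : BV R n | A (M *m x)%R] = Leb A.
Proof.
have MM' : (M *m M^T = 1%:M)%R by rewrite -(mulmx1C MM).
apply: (@translation_invariant_unique (push (@Leb R n) (measurable_mulmx M)) (ball_ 1)) => //.
- by move=> x; rewrite /ball_/= -scaleN1r enormZ normrN1 mul1r.
- move=> {}A h mA.
  have mMA : measurable [set x : BV R n | A (M *m x)%R].
    by rewrite -[X in measurable X]setTI; exact: measurable_mulmx.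
  (* Translating the image by [h] is translating the source by [M^T h], because [M M^T] is the
     identity too. *)
  apply: (etrans _ (Leb_shift (M^T *m h)%R mMA)).
  by congr Leb; apply/seteqP; split => x /=; rewrite mulmxDr mulmxA MM' mul1mx.
- exact: Leb_ball_fin.
Qed.

End Rotation.

(** * Cones and spherical caps *)

Section Monotone.
Local Open Scope ereal_scope.

(** Monotonicity is read off the supremum over simple functions, so it covers the integrands built
    from [rho], whose measurability is never established. *)
Lemma ge0_integral_le d (T : measurableType d) (R : realType)
    (mu : {measure set T -> \bar R}) (f1 f2 : T -> \bar R) :
  (forall x, 0 <= f1 x) -> (forall x, f1 x <= f2 x) ->
  \int[mu]_x f1 x <= \int[mu]_x f2 x.
Proof.
move=> f10 f12; rewrite !ge0_integralTE//; last by move=> x; exact: le_trans (f12 x).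
apply: le_ereal_sup => _ [h /= hf <-].
by exists h => // x; exact: le_trans (hf x) (f12 x).
Qed.

Lemma ge0_leb_int_le (R : realType) n (g1 g2 : 'cV[R]_n -> \bar R) :
  (forall y, 0 <= g1 y) -> (forall y, g1 y <= g2 y) -> leb_int g1 <= leb_int g2.
Proof.
move=> g10 g12; rewrite /leb_int.
have H k x : iint k g1 x <= iint k g2 x.
  elim: k x => [|k ih] x //=; apply: ge0_integral_le => // t.
  exact: (@iint_ge0 _ _ k g1).
exact: H.
Qed.

End Monotone.

Section Cone.
Variable R : realType.

(** As the inverse of 0 is 0, [dir 0 = 0]. *)
Definition dir n (x : BV R n) : BV R n := (enorm x)^-1 *: x.

Lemma dirZ n (c : R) (x : BV R n) : 0 < c -> dir (c *: x) = dir x.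
Proof.
move=> c0; rewrite /dir enormZ gtr0_norm// scalerA invfM -mulrA mulrC -mulrA divff ?mulr1//.
exact: lt0r_neq0.
Qed.

Lemma enorm_dir n (x : BV R n) : 0 < enorm x -> enorm (dir x) = 1.
Proof. by move=> x0; rewrite enormZ ger0_norm ?invr_ge0 ?ltW// mulVf ?gt_eqF. Qed.

Lemma measurable_dir n : measurable_fun [set: BV R n] (@dir n).
Proof.
apply: measurable_to_BV => i; under eq_fun do rewrite mxE.
apply: measurable_funM; last exact: measurable_coord.
rewrite (_ : (fun t => _) = (fun t : BV R n => enorm t `^ (-1))).
  by apply: (measurableT_comp (measurable_powR _)); exact: measurable_enorm.
by apply/funext => x; rewrite powR_inv1// enorm_ge0.
Qed.

Definition cone n (B : set (BV R n)) (r : R) : set (BV R n) :=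
  [set x | 0 < enorm x /\ enorm x <= r /\ B (dir x)].

Lemma measurable_preimageT d1 d2 (T1 : measurableType d1) (T2 : measurableType d2)
  (f : T1 -> T2) (A : set T2) : measurable_fun [set: T1] f -> measurable A ->
  measurable [set x | A (f x)].
Proof. by move=> mf mA; rewrite -[X in measurable X]setTI; exact: mf. Qed.

Lemma measurable_ltr d (T : measurableType d) (f g : T -> R) :
  measurable_fun [set: T] f -> measurable_fun [set: T] g ->
  measurable [set x | f x < g x].
Proof.
move=> mf mg; rewrite (_ : [set x | _] = [set x | `]0, +oo[%classic (g x - f x)]).
  apply: (@measurable_preimageT _ _ _ _ (fun x => g x - f x)) => //.
  exact: measurable_funB.
by apply/seteqP; split => x /=; rewrite in_itv/= andbT subr_gt0.
Qed.

Lemma measurable_ler d (T : measurableType d) (f g : T -> R) :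
  measurable_fun [set: T] f -> measurable_fun [set: T] g ->
  measurable [set x | f x <= g x].
Proof.
move=> mf mg; rewrite (_ : [set x | _] = ~` [set x | g x < f x]).
  by apply: measurableC; exact: measurable_ltr.
by apply/seteqP; split => x /=; rewrite leNgt => /negP.
Qed.

Lemma measurable_cone n (B : set (BV R n)) r : measurable B -> measurable (cone B r).
Proof.
move=> mB; apply: measurableI.
  by apply: measurable_ltr => //; exact: measurable_enorm.
apply: measurableI; first by apply: measurable_ler => //; exact: measurable_enorm.
by apply: measurable_preimageT => //; exact: measurable_dir.
Qed.

Lemma sph_int_indic n (B : set (BV R n)) :
  sph_int (fun x => (\1_B x)%:E) = (n%:R%:E * Leb (cone B 1))%E.
Proof.
rewrite /sph_int /Leb; congr (_ * leb_int _)%E; apply/funext => x.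
rewrite indicE; case: ifPn => [/andP[x0 x1]|x01].
  rewrite indicE; congr (_%:R%:E); congr nat_of_bool.
  by apply/idP/idP; rewrite !inE /cone/=; [|move=> [_ []]].
by rewrite indicE memNset//= => -[x0 [x1 _]]; move: x01; rewrite x0 x1.
Qed.

Lemma Leb_cone n (B : set (BV R n)) r : 0 < r -> measurable B ->
  Leb (cone B r) = ((r ^+ n)%:E * Leb (cone B 1))%E.
Proof.
move=> r0 mB; rewrite -(Leb_scale r0 (measurable_cone r mB)); congr (_ * Leb _)%E.
apply/seteqP; split => x; rewrite /cone/= dirZ// enormZ gtr0_norm//.
  by rewrite pmulr_rgt0// ger_pMr.
by rewrite pmulr_rgt0// ger_pMr.
Qed.

Lemma Leb_cone_fin n (B : set (BV R n)) : measurable B -> Leb (cone B 1) \is a fin_num.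
Proof.
move=> mB; rewrite ge0_fin_numE//; apply: le_lt_trans (ltry ((2 * 1) ^+ n)).
rewrite -Leb_cube//; apply: le_measure; rewrite ?inE.
- exact: measurable_cone.
- exact: measurable_cube.
- by move=> x [_ [x1 _]] i; exact: le_trans (coord_le_enorm _ _) x1.
Qed.

End Cone.

Section Slices.
Variables (R : realType) (m : nat).

(** The added coordinate is the last one, the outermost variable of [leb_int], so [Leb_slices] is an
    unfolding of the iterated integral. *)
Definition ext (v : BV R m) (s : R) : BV R m.+1 :=
  \col_j (if unlift ord_max j is Some i then v i 0 else s).

Definition res (w : BV R m.+1) : BV R m := \col_i w (lift ord_max i) 0.

Lemma ext_lift v s i : ext v s (lift ord_max i) 0 = v i 0.
Proof. by rewrite mxE liftK. Qed.

Lemma ext_max v s : ext v s ord_max 0 = s.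
Proof. by rewrite mxE unlift_none. Qed.

Lemma resK w : ext (res w) (w ord_max 0) = w.
Proof.
apply: BVP => j; case: (unliftP ord_max j) => [i ->|->].
  by rewrite ext_lift mxE.
by rewrite ext_max.
Qed.

Lemma extK v s : res (ext v s) = v.
Proof. by apply: BVP => i; rewrite mxE ext_lift. Qed.

Lemma measurable_res : measurable_fun [set: BV R m.+1] res.
Proof.
apply: measurable_to_BV => i; under eq_fun do rewrite mxE.
exact: measurable_coord.
Qed.

Lemma updc_ext v s k t : (k < m)%N -> updc (ext v s) k t = ext (updc v k t) s.
Proof.
move=> km; apply: BVP => j; case: (unliftP ord_max j) => [i ->|->].
  rewrite ext_lift !mxE liftK /= /bump leqNgt ltn_ord add0n.
  by case: ifP.
by rewrite ext_max mxE /= gtn_eqF// ext_max.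
Qed.

Lemma iint_ext k v s (g : BV R m.+1 -> \bar R) : (k <= m)%N ->
  iint k g (ext v s) = iint k (fun v => g (ext v s)) v.
Proof.
elim: k v => [//|k ih] v km /=; apply: eq_integral => t _.
by rewrite updc_ext// ih// ltnW.
Qed.

Lemma Leb_slices (A : set (BV R m.+1)) :
  Leb A = (\int[@lebesgue_measure R]_s Leb [set v | A (ext v s)])%E.
Proof.
rewrite /Leb /leb_int /=; apply: eq_integral => s _.
have -> : updc 0 m s = ext 0 s.
  apply: BVP => j; case: (unliftP ord_max j) => [i ->|->].
    by rewrite ext_lift !mxE /= /bump leqNgt ltn_ord add0n ltn_eqF.
  by rewrite ext_max mxE eqxx.
by rewrite iint_ext.
Qed.

Lemma integral_exprn0 (c : R) : 0 < c ->
  (\int[@lebesgue_measure R]_(s in `[0%R, c]) (s ^+ m)%:E = (c ^+ m.+1 / m.+1%:R)%:E)%E.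
Proof.
move=> c0.
have dF (x : R) : is_derive x 1 (fun s : R => m.+1%:R^-1 * s ^+ m.+1) (x ^+ m).
  have -> : (fun s : R => m.+1%:R^-1 * s ^+ m.+1) = m.+1%:R^-1 \*: (fun s : R => s ^+ m.+1) by [].
  apply: DeriveDef; first by apply: derivableZ; exact: exprn_derivable.
  rewrite deriveZ; last exact: exprn_derivable.
  rewrite exp_derive /GRing.scale/= mulr1 mulrA mulVf ?mul1r// pnatr_eq0.
have cX k (x : R) : {for x, continuous (fun s : R => s ^+ k)} by exact: exprn_continuous.
rewrite (@continuous_FTC2 _ _ (fun s => m.+1%:R^-1 * s ^+ m.+1))//.
- by rewrite expr0n mulr0 sube0 mulrC.
- by apply: continuous_subspaceT => x; exact: cX.
- split => [x _||].
  + by have [] := dF x.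
  + apply: cvg_at_right_filter; apply: cvgM; [exact: cvg_cst|exact: cX].
  + apply: cvg_at_left_filter; apply: cvgM; [exact: cvg_cst|exact: cX].
- by move=> x _; rewrite derive1E; have [] := dF x.
Qed.

End Slices.

Section Cap.
Variables (R : realType) (m : nat) (q : 'cV[R]_m.+1) (U : 'M[R]_(m.+1, m)).

(* On the sphere [rad x ^+ 2] is the score [T = 1 - <q, x>] and [sqrt 2 * rad x] is the distance
   from [x] to [q]; [ang x] is the direction of the component of [x] orthogonal to [q]. *)
Definition rad (x : BV R m.+1) : R := Num.sqrt (1 - dotv q x).
Definition ang (x : BV R m.+1) : BV R m := dir (U^T *m x : BV R m).
Definition cap (y : R) (B : set (BV R m)) : set (BV R m.+1) :=
  [set x | 0 < rad x /\ rad x <= y /\ B (ang x)].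

Lemma measurable_rad : measurable_fun [set: BV R m.+1] rad.
Proof.
have h2 : measurable_fun [set: R] (@Num.sqrt R).
  by apply: continuous_measurable_fun; exact: sqrt_continuous.
apply: (measurableT_comp h2); apply: measurable_funB => //.
exact: (@measurable_dotv R _ (BV R m.+1) m.+1 (fun=> q) id (measurable_cst _) (@measurable_id _ _ _)).
Qed.

Lemma measurable_ang : measurable_fun [set: BV R m.+1] ang.
Proof. exact: (measurableT_comp (@measurable_dir R m) (measurable_mulmx U^T)). Qed.

Lemma measurable_cap y B : measurable B -> measurable (cap y B).
Proof.
move=> mB; apply: measurableI.
  by apply: measurable_ltr => //; exact: measurable_rad.
apply: measurableI; first by apply: measurable_ler => //; exact: measurable_rad.
by apply: measurable_preimageT => //; exact: measurable_ang.
Qed.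

Hypotheses (UU : U^T *m U = 1%:M) (Uq : U^T *m q = 0) (q1 : enorm q = 1).

(** The orthogonal matrix with the columns of [U] followed by [q]. It sends the last axis to [q], so
    the last coordinate becomes the height along [q]. *)
Definition frame : 'M[R]_m.+1 :=
  \matrix_(i, j) (if unlift ord_max j is Some k then U i k else q i 0).

Lemma frame_ext v s : frame *m ext v s = U *m v + s *: q.
Proof.
apply/colP => i; rewrite !mxE (bigD1_ord ord_max)//= addrC.
congr (_ + _); last by rewrite !mxE unlift_none mulrC.
by apply: eq_bigr => k _; rewrite !mxE liftK.
Qed.

Lemma dotqq : dotv q q = 1. Proof. by rewrite -enorm_sqr q1 expr1n. Qed.

Lemma frame_orthogonal : frame^T *m frame = 1%:M.
Proof.
apply/matrixP => i j; rewrite !mxE.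
case: (unliftP ord_max i) => [k ->|->]; case: (unliftP ord_max j) => [l ->|->].
- have /matrixP/(_ k l) := UU; rewrite !mxE (inj_eq lift_inj) => <-.
  by apply: eq_bigr => t _; rewrite !mxE !liftK.
- have /colP/(_ k) := Uq; rewrite !mxE eq_sym (negbTE (neq_lift _ _)) => h.
  transitivity (\sum_j U^T k j * q j 0); last exact: h.
  by apply: eq_bigr => t _; rewrite !mxE liftK unlift_none.
- have /colP/(_ l) := Uq; rewrite !mxE (negbTE (neq_lift _ _)) => h.
  transitivity (\sum_j U^T l j * q j 0); last exact: h.
  by apply: eq_bigr => t _; rewrite !mxE liftK unlift_none mulrC.
- rewrite eqxx -dotqq.
  by apply: eq_bigr => t _; rewrite !mxE !unlift_none.
Qed.

Lemma dotv_q_frame v s : dotv q (U *m v + s *: q) = s.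
Proof.
rewrite dotvDr dotvZr dotqq mulr1 dotvC dotv_mulmx Uq -(scale0r 0) dotvZr.
by rewrite mul0r add0r.
Qed.

Lemma trU_frame v s : U^T *m (U *m v + s *: q) = v.
Proof. by rewrite mulmxDr mulmxA UU mul1mx -scalemxAr Uq scaler0 addr0. Qed.

Lemma enorm_frame v s : enorm (U *m v + s *: q) ^+ 2 = enorm v ^+ 2 + s ^+ 2.
Proof.
rewrite !enorm_sqr dotvDl dotvDr dotvZl dotv_q_frame dotvZr -expr2; congr (_ + _).
by rewrite !dotv_mulmx mulmxA UU mul1mx Uq -(scale0r 0) dotvZr mul0r mulr0 addr0.
Qed.

(** A solid cone of slope [k], cut by the hyperplane at height [c] instead of by the sphere: its
    horizontal slices are cones of radius [k s], so its volume is the integral of a power of [s]. *)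
Definition wedge (B : set (BV R m)) (k c : R) : set (BV R m.+1) :=
  [set w : BV R m.+1 | 0 <= w ord_max 0 /\ w ord_max 0 <= c /\ cone B (k * w ord_max 0) (res w)].

Lemma measurable_wedge B k c : measurable B -> measurable (wedge B k c).
Proof.
move=> mB.
have mc : measurable_fun [set: BV R m.+1] (fun w : BV R m.+1 => w ord_max 0).
  exact: measurable_coord.
have mr : measurable_fun [set: BV R m.+1] (fun w => enorm (res w)).
  exact: (measurableT_comp (@measurable_enorm R m) (@measurable_res R m)).
apply: measurableI; first by apply: measurable_ler.
apply: measurableI; first by apply: measurable_ler.
apply: measurableI; first by apply: measurable_ltr.
apply: measurableI.
  by apply: measurable_ler => //; apply: measurable_funM.
apply: (@measurable_preimageT _ _ _ _ (fun w => dir (res w))) => //.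
exact: (measurableT_comp (@measurable_dir R m) (@measurable_res R m)).
Qed.

Hypothesis m0 : (0 < m)%N.

Lemma Leb_wedge B k c : measurable B -> 0 < k -> 0 < c ->
  Leb (wedge B k c) = ((k ^+ m * (c ^+ m.+1 / m.+1%:R))%:E * Leb (cone B 1))%E.
Proof.
move=> mB k0 c0; rewrite Leb_slices.
set LB := Leb (cone B 1).
have LBfin : LB \is a fin_num by exact: Leb_cone_fin.
transitivity (\int[@lebesgue_measure R]_(s in `[0%R, c]) ((k ^+ m * s ^+ m)%:E * LB))%E.
  rewrite [RHS]integral_mkcond; apply: eq_integral => s _.
  rewrite patchE; case: ifPn; rewrite ?inE ?notin_setE /= in_itv/=; last first.
    move=> h.
    rewrite (_ : [set v | _] = set0) ?measure0//; apply/seteqP; split => v //=.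
    by rewrite /wedge/= ext_max => -[s0 [sc _]]; apply: h; rewrite s0 sc.
  move=> /andP[s0 sc].
  rewrite (_ : [set v | _] = cone B (k * s)); last first.
    apply/seteqP; split => v; rewrite /wedge/= ext_max extK//.
      by move=> [_ []].
  (* At height 0 the slice is empty, while [Leb_cone] speaks of positive radii; the right side
     vanishes because [m > 0]. *)
  have [->|sn0] := eqVneq s 0.
    rewrite expr0n eqn0Ngt m0 !mulr0 mul0e.
    rewrite (_ : cone _ _ = set0) ?measure0//; apply/seteqP; split => v //= -[v0 [v1 _]].
    by move: v0; rewrite ltNge v1.
  by rewrite Leb_cone// ?mulr_gt0// ?lt_def ?sn0// exprMn.
rewrite -(fineK LBfin).
under eq_integral do rewrite -EFinM mulrAC EFinM.
rewrite ge0_integralZl//=.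
- by rewrite integral_exprn0// -!EFinM; congr EFin; ring.
- apply/measurable_EFinP; apply: measurable_funTS; exact: measurable_funX.
- by move=> s /=; rewrite in_itv/= => /andP[s0 _]; rewrite lee_fin exprn_ge0.
- by rewrite lee_fin; apply: mulr_ge0; [exact/exprn_ge0/ltW|apply: fine_ge0; exact: measure_ge0].
Qed.

Variables (y : R) (B : set (BV R m)).
Hypotheses (y0 : 0 < y) (y1 : y < 1) (mB : measurable B).

(* Writing [x = U v + s q], the cone over [cap y B] is [{|v| <= k s, |x| <= 1, dir v in B}], which
   lies between the wedges of heights [a] and [1]. *)
Let a : R := 1 - y ^+ 2.
Let k : R := Num.sqrt (a ^- 2 - 1).

Let a0 : 0 < a.
Proof. by rewrite subr_gt0 expr_lt1// ltW. Qed.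

Let a1 : a < 1.
Proof. by rewrite ltrBlDr ltrDl exprn_gt0. Qed.

Let k2 : k ^+ 2 = a ^- 2 - 1.
Proof.
rewrite sqr_sqrtr// subr_ge0 invf_ge1 ?exprn_gt0//.
by rewrite expr_le1 ?ltW// ltW.
Qed.

(** The cosine [<q, x> / |x|] is [s / |x|]. So [rad <= y] reads [a |x| <= s], and [rad > 0] reads
    [s < |x|], which for [s >= 0] means [v <> 0]. *)
Lemma cone_cap v s : cone (cap y B) 1 (U *m v + s *: q) <->
  [/\ 0 < enorm v, a * enorm (U *m v + s *: q) <= s, enorm (U *m v + s *: q) <= 1 & B (dir v)].
Proof.
set x := U *m v + s *: q; set X := enorm x.
have X2 : X ^+ 2 = enorm v ^+ 2 + s ^+ 2 by exact: enorm_frame.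
have v0 := enorm_ge0 v; have X0 : 0 <= X := enorm_ge0 x.
have key : 0 < X -> (0 < rad (dir x) <-> s < X) /\ (rad (dir x) <= y <-> a * X <= s) /\ ang (dir x) = dir v.
  move=> Xp; rewrite /rad /ang {1 2}/dir dotvZr dotv_q_frame; split; [|split].
  - rewrite sqrtr_gt0 subr_gt0 mulrC ltr_pdivrMr// mul1r. done.
  - rewrite -{1}(ger0_norm (ltW y0)) -sqrtr_sqr ler_sqrt ?sqr_ge0//.
    by rewrite lerBlDr -lerBlDl mulrC ler_pdivlMr.
  - by rewrite /dir -scalemxAr trU_frame; apply: dirZ; rewrite invr_gt0.
split.
  move=> [/= Xp [X1 [c1 [c2 Bx]]]]; have [[k1 _] [[k3 _] k4]] := key Xp.
  move: {c1}(k1 c1) {c2}(k3 c2) => c1 c2; rewrite k4 in Bx; split => //.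
  rewrite lt_def v0 andbT; apply/eqP => vv; move: X2; rewrite vv expr0n add0r => /eqP.
  rewrite eqrXn2// ?(le_trans _ c2)// ?mulr_ge0 ?ltW// => /eqP Xs.
  by move: c1; rewrite Xs ltxx.
move=> [vp c2 X1 Bv].
have Xp : 0 < X.
  by rewrite -(@ltr_pXn2r _ 2)// ?nnegrE// expr0n X2 ltr_pwDl ?exprn_gt0// sqr_ge0.
have [[_ k1] [[_ k3] k4]] := key Xp.
split => //; split => //; split; last by split; [exact: k3|rewrite k4].
apply: k1; have s0 : 0 <= s by rewrite (le_trans _ c2)// mulr_ge0// ltW.
by rewrite -(@ltr_pXn2r _ 2)// ?nnegrE// X2 ltrDr exprn_gt0.
Qed.

Lemma cone_cap_sub_wedge w : cone (cap y B) 1 (frame *m w) -> wedge B k 1 w.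
Proof.
rewrite -{1}(resK w) frame_ext cone_cap.
set v := res w; set s := w ord_max 0; set X := enorm (U *m v + s *: q) => -[vp c2 X1 Bv].
have X2 : X ^+ 2 = enorm v ^+ 2 + s ^+ 2 by exact: enorm_frame.
have X0 : 0 <= X by exact: enorm_ge0.
have s0 : 0 <= s by rewrite (le_trans _ c2)// mulr_ge0// ltW.
have sX : s <= X by rewrite -(@ler_pXn2r _ 2)// ?nnegrE// X2 lerDr sqr_ge0.
split => //; split; first exact: le_trans X1.
split => //; split => //.
rewrite -/v -/s -(@ler_pXn2r _ 2)// ?nnegrE ?enorm_ge0// ?mulr_ge0 ?sqrtr_ge0//.
rewrite exprMn k2 mulrBl mul1r lerBrDr -X2 mulrC ler_pdivlMr ?exprn_gt0//.
by rewrite -exprMn mulrC ler_pXn2r ?nnegrE// mulr_ge0// ltW.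
Qed.

(** Slope [k] gives [a |x| <= s], so a height [s <= a] forces [|x| <= 1]. *)
Lemma wedge_sub_cone_cap w : wedge B k a w -> cone (cap y B) 1 (frame *m w).
Proof.
rewrite -{2}(resK w) frame_ext cone_cap => -[].
set v := res w; set s := w ord_max 0; set X := enorm (U *m v + s *: q) => s0 [sa [vp [vk Bv]]].
have X2 : X ^+ 2 = enorm v ^+ 2 + s ^+ 2 by exact: enorm_frame.
have X0 : 0 <= X by exact: enorm_ge0.
have c2 : a * X <= s.
  rewrite -(@ler_pXn2r _ 2)// ?nnegrE// ?mulr_ge0// ?(ltW a0)//.
  have vk2 : enorm v ^+ 2 <= k ^+ 2 * s ^+ 2.
    by rewrite -exprMn ler_pXn2r ?nnegrE ?enorm_ge0// mulr_ge0// sqrtr_ge0.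
  have ka : a ^+ 2 * k ^+ 2 = 1 - a ^+ 2.
    by rewrite k2 mulrBr mulfV ?expf_neq0 ?gt_eqF// mulr1.
  have h : a ^+ 2 * enorm v ^+ 2 <= (1 - a ^+ 2) * s ^+ 2.
    by rewrite -ka -(mulrA (a ^+ 2) (k ^+ 2)) ler_wpM2l// sqr_ge0.
  by rewrite exprMn X2 mulrDr -lerBrDr (le_trans h)// mulrBl mul1r.
split => //.
by rewrite -(ler_pM2l a0) mulr1 (le_trans c2).
Qed.

Let k0 : 0 < k.
Proof. by rewrite sqrtr_gt0 subr_gt0 invf_gt1 ?exprn_gt0// expr_lt1 ?ltW. Qed.

(** The slope [k] is the tangent of the angle with cosine [a = 1 - y ^ 2], and [a k] is its sine.
    Hence [k] behaves like [sqrt 2 * y] for small [y], which the next two bounds make explicit. *)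
Let kE : a ^+ 2 * k ^+ 2 = y ^+ 2 * (2 - y ^+ 2).
Proof.
by rewrite k2 mulrBr mulfV ?expf_neq0 ?gt_eqF// mulr1 /a; ring.
Qed.

Let k_le : k <= Num.sqrt 2 * y / a.
Proof.
rewrite ler_pdivlMr// -(@ler_pXn2r _ 2)// ?nnegrE ?mulr_ge0 ?sqrtr_ge0 ?(ltW y0) ?(ltW a0) ?(ltW k0)//.
rewrite exprMn mulrC kE exprMn sqr_sqrtr// [leRHS]mulrC ler_wpM2l ?sqr_ge0//.
by rewrite gerBl sqr_ge0.
Qed.

Let k_ge : Num.sqrt 2 * y <= k.
Proof.
rewrite -(@ler_pXn2r _ 2)// ?nnegrE ?mulr_ge0 ?sqrtr_ge0 ?(ltW y0) ?(ltW a0) ?(ltW k0)//.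
rewrite -(ler_pM2l (exprn_gt0 2 a0)) kE exprMn sqr_sqrtr// mulrCA mulrA mulrC.
rewrite ler_wpM2l ?sqr_ge0//.
have := a0; have := a1; rewrite /a => h1 h2.
have h3 : 0 <= y ^+ 2 by exact: sqr_ge0.
nra.
Qed.

Let mcone : measurable (cone (cap y B) 1).
Proof. by apply: measurable_cone; exact: measurable_cap. Qed.

Let mcone' : measurable [set w : BV R m.+1 | cone (cap y B) 1 (frame *m w : BV R m.+1)].
Proof.
apply: (@measurable_preimageT _ _ _ _ (fun w : BV R m.+1 => frame *m w : BV R m.+1)) => //.
exact: measurable_mulmx.
Qed.

(** The factor [m + 1] of the cone formula cancels the [1 / (m + 1)] in the volume of the wedge,
    here and in [sph_cap_ge]; only powers of [k] and [a] remain. *)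
Lemma sph_cap_le : (sph_int (fun x => (\1_(cap y B) x)%:E) <=
  (((Num.sqrt 2 * y) / a) ^+ m)%:E * Leb (cone B 1))%E.
Proof.
rewrite sph_int_indic -(Leb_isometry frame_orthogonal mcone).
apply: (@le_trans _ _ (m.+1%:R%:E * Leb (wedge B k 1))%E).
  rewrite lee_wpmul2l// ?lee_fin//; apply: le_measure; rewrite ?inE//.
    exact: measurable_wedge.
  exact: cone_cap_sub_wedge.
rewrite Leb_wedge// muleA -EFinM lee_wpmul2r// lee_fin expr1n.
rewrite mulrCA mul1r divff// mulr1 ler_pXn2r// ?nnegrE ?(ltW y0) ?(ltW a0) ?(ltW k0)//.
by rewrite divr_ge0 ?mulr_ge0 ?sqrtr_ge0 ?(ltW y0) ?(ltW a0) ?(ltW k0).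
Qed.

Lemma sph_cap_ge : (((Num.sqrt 2 * y) ^+ m * a ^+ m.+1)%:E * Leb (cone B 1) <=
  sph_int (fun x => (\1_(cap y B) x)%:E))%E.
Proof.
rewrite sph_int_indic -(Leb_isometry frame_orthogonal mcone).
apply: (@le_trans _ _ (m.+1%:R%:E * Leb (wedge B k a))%E); last first.
  rewrite lee_wpmul2l// ?lee_fin//; apply: le_measure; rewrite ?inE//.
    exact: measurable_wedge.
  exact: wedge_sub_cone_cap.
rewrite Leb_wedge// muleA -EFinM lee_wpmul2r// lee_fin.
rewrite mulrCA [_%:R * _]mulrC divfK// ler_wpM2r ?exprn_ge0 ?(ltW y0) ?(ltW a0) ?(ltW k0)//.
by rewrite ler_pXn2r// ?nnegrE ?mulr_ge0 ?sqrtr_ge0 ?(ltW y0) ?(ltW a0) ?(ltW k0).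
Qed.

End Cap.

(** * The law of one sample point near [q] *)

Section Law.
Variables (R : realType) (m : nat) (q : 'cV[R]_m.+1) (U : 'M[R]_(m.+1, m)).
Hypotheses (UU : U^T *m U = 1%:M) (Uq : U^T *m q = 0) (q1 : enorm q = 1) (m0 : (0 < m)%N).
Variable rho : 'cV[R]_m.+1 -> R.
Hypotheses (rhoC2 : C2_on_sphere rho) (rhod : sphere_density rho) (rhoq : 0 < rho q).

Lemma rad_ge0 x : 0 <= rad q x. Proof. exact: sqrtr_ge0. Qed.

Lemma rad_sqr x : enorm x = 1 -> enorm (x - q) ^+ 2 = 2 * rad q x ^+ 2.
Proof.
move=> x1; have xx : dotv x x = 1 by rewrite -enorm_sqr x1 expr1n.
have E : enorm (x - q) ^+ 2 = 2 * (1 - dotv q x).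
  rewrite enorm_sqr -scaleN1r dotvDl !dotvDr !dotvZl !dotvZr xx (dotqq q1) (dotvC x q).
  ring.
rewrite E /rad sqr_sqrtr//.
have := sqr_ge0 (enorm (x - q)); rewrite E; lra.
Qed.

Lemma rad_eq0 x : enorm x = 1 -> ~~ (0 < rad q x) -> x = q.
Proof.
rewrite lt_def rad_ge0 andbT negbK => x1 /eqP r0.
have := rad_sqr x1; rewrite r0 expr0n mulr0 => /eqP.
by rewrite sqrf_eq0 enorm_eq0 subr_eq0 => /eqP.
Qed.

Lemma rho_near_q (e : R) : 0 < e -> exists2 del : R, 0 < del &
  forall x, enorm x = 1 -> rad q x <= del -> `|rho x - rho q| <= e.
Proof.
move=> e0; have [W [g [SW [[oW [cg _]] gr]]]] := rhoC2.
have Wq : W q by apply: SW.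
have cgq : {for q, continuous g}.
  by move: cg; rewrite continuous_open_subspace// => /(_ q); apply; rewrite inE.
have nq : nbhs q (fun x => `|g q - g x| <= e) by move/cvgrPdist_le : cgq; exact.
have [d d0 dP] : exists2 d : R, 0 < d & forall x, `|q - x| < d -> `|g q - g x| <= e.
  move: nq => /nbhs_ballP[d d0 dP]; exists d => // x xd; apply: dP.
  by rewrite -ball_normE.
have d20 : 0 < d / 2 by rewrite divr_gt0.
(* On the sphere the distance to [q] is [sqrt 2 * rad], and [sqrt 2 / 2 < 1]. *)
exists (d / 2) => // x x1 xd.
rewrite -(gr q)// -(gr x)// distrC; apply: dP.
rewrite distrC; apply: le_lt_trans (norm_le_enorm _) _.
rewrite -(@ltr_pXn2r _ 2)// ?nnegrE ?enorm_ge0// ?(ltW d0)// rad_sqr//.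
have : rad q x ^+ 2 <= (d / 2) ^+ 2 by rewrite ler_pXn2r ?nnegrE ?rad_ge0// ltW.
have := exprn_gt0 2 d0; rewrite expr_div_n; lra.
Qed.

Context {dO : measure_display} {Omega : measurableType dO} (P : probability Omega R).
Variable X : Omega -> 'cV[R]_m.+1.
Hypotheses (Xrv : random_vector X) (Xlaw : has_sphere_law P rho X).

Lemma measurable_rv : measurable_fun [set: Omega] (X : Omega -> BV R m.+1).
Proof. by move=> _ A mA; rewrite setTI; exact: Xrv. Qed.

Lemma law_le (A : set (BV R m.+1)) (c : R) : measurable A -> 0 <= c ->
  (forall x, enorm x = 1 -> A x -> rho x <= c) ->
  (P (X @^-1` A) <= c%:E * sph_int (fun x => (\1_A x)%:E))%E.
Proof.
move=> mA c0 h; rewrite Xlaw// sph_int_indic muleCA lee_wpmul2l ?lee_fin//.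
rewrite /Leb -iintZ//; last by apply: measurable_indic_EFin; exact: measurable_cone.
have rr : forall x : 'cV_m.+1, 0 < enorm x -> 0 <= rho ((enorm x)^-1 *: x).
  by move=> x x0; apply: rhod.1; exact: enorm_dir.
apply: ge0_leb_int_le => x.
  by case: ifPn => // /andP[x0 _]; rewrite -EFinM lee_fin mulr_ge0// rr.
case: ifPn => [/andP[x0 x1]|_]; last by rewrite -EFinM lee_fin mulr_ge0.
rewrite -EFinM -EFinM lee_fin mulrC.
have [Ax|Ax] := pselect (A ((enorm x)^-1 *: x)); last first.
  by rewrite [X in _ * X]indicE memNset// mulr0 mulr_ge0.
rewrite !indicE !mem_set// !mulr1; apply: h => //; exact: enorm_dir.
Qed.

Lemma law_ge (A : set (BV R m.+1)) (c : R) : measurable A -> 0 <= c ->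
  (forall x, enorm x = 1 -> A x -> c <= rho x) ->
  (c%:E * sph_int (fun x => (\1_A x)%:E) <= P (X @^-1` A))%E.
Proof.
move=> mA c0 h; rewrite Xlaw// sph_int_indic muleCA lee_wpmul2l ?lee_fin//.
rewrite /Leb -iintZ//; last by apply: measurable_indic_EFin; exact: measurable_cone.
apply: ge0_leb_int_le => x; first by rewrite -EFinM lee_fin mulr_ge0.
case: ifPn => [/andP[x0 x1]|x01]; last first.
  rewrite indicE memNset ?mule0// => -[x0 [x1 _]].
  by move: x01; rewrite x0 x1.
rewrite -EFinM -EFinM lee_fin mulrC.
have [Ax|Ax] := pselect (A ((enorm x)^-1 *: x)); last first.
  rewrite !indicE !memNset// ?mul0r// => -[_ [_]]; exact.
rewrite !indicE !mem_set// !mul1r; apply: h => //; exact: enorm_dir.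
Qed.

Lemma law_sphere : P (X @^-1` [set x | enorm x <> 1]) = 0%E.
Proof.
have mA : measurable ([set x | enorm x <> 1] : set (BV R m.+1)).
  rewrite (_ : [set x | _] = ~` [set x : BV R m.+1 | [set (1 : R)] (enorm x)]) //.
  apply: measurableC; apply: measurable_preimageT => //; exact: measurable_enorm.
apply/eqP; rewrite eq_le measure_ge0 andbT.
(* The bound [rho <= 0] holds vacuously, as no point of the sphere lies in this set. *)
by rewrite (le_trans (law_le mA (lexx 0) _))// ?mul0e.
Qed.

Lemma cube0 n : cube 0 = [set 0] :> set (BV R n).
Proof.
apply/seteqP; split => v /=; last by move=> -> i; rewrite mxE normr0.
by move=> h; apply: BVP => i; rewrite mxE; apply/eqP; rewrite -normr_le0; exact: h.
Qed.

Lemma Leb_apex : Leb ([set w : BV R m.+1 | res w = 0]) = 0%E.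
Proof.
rewrite Leb_slices; apply: integral0_eq => s _.
rewrite (_ : [set v | _] = cube 0); first by rewrite Leb_cube// mulr0 expr0n eqn0Ngt m0.
by rewrite cube0; apply/seteqP; split => v /=; rewrite extK.
Qed.

(** Caps leave out their centre [q], which has no direction. It is null because the cone over it
    lies on the axis spanned by [q], whose slices are single points. *)
Lemma law_pole : P (X @^-1` [set x | ~~ (0 < rad q x)]) = 0%E.
Proof.
set N := [set x : BV R m.+1 | ~~ (0 < rad q x)].
have mN : measurable N.
  rewrite (_ : N = ~` [set x | 0 < rad q x]).
    by apply: measurableC; apply: measurable_ltr => //; exact: measurable_rad.
  by apply/seteqP; split => x /= /negP.
apply/eqP; rewrite eq_le measure_ge0 andbT.
rewrite (le_trans (@law_le _ (rho q) mN (ltW rhoq) _))//.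
  by move=> x x1 Nx; rewrite (rad_eq0 x1 Nx).
rewrite sph_int_indic.
rewrite -(Leb_isometry (frame_orthogonal UU Uq q1) (measurable_cone 1 mN)).
rewrite [X in (_ * (_ * X))%E](_ : _ = 0%E) ?mule0//.
apply/eqP; rewrite eq_le measure_ge0 andbT -Leb_apex.
apply: le_measure; rewrite ?inE.
- apply: (@measurable_preimageT _ _ _ _ (fun w : BV R m.+1 => frame q U *m w : BV R m.+1)).
    exact: measurable_mulmx.
  exact: measurable_cone.
- apply: (@measurable_preimageT _ _ _ _ (@res R m) [set 0]); first exact: measurable_res.
  by rewrite -cube0; exact: measurable_cube.
- move=> w /=; rewrite -{1}(resK w) frame_ext => -[x0 [_ Nx]].
  have := rad_eq0 (enorm_dir x0) Nx; rewrite /dir => /(congr1 (fun z => U^T *m z)).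
  rewrite -scalemxAr (trU_frame UU Uq) Uq => /eqP; rewrite scaler_eq0.
  by rewrite invr_eq0 gt_eqF//= => /eqP.
Qed.

Lemma bernoulli_le (t : R) n : 0 <= t -> t <= 1 -> 1 - n%:R * t <= (1 - t) ^+ n.
Proof.
move=> t0 t1; elim: n => [|n ih]; first by rewrite mul0r subr0.
rewrite exprS; apply: le_trans (ler_wpM2l _ ih); last by rewrite subr_ge0.
have : 0 <= n%:R * (t * t) by rewrite mulr_ge0// mulr_ge0.
rewrite -[n.+1]addn1 natrD; lra.
Qed.

(** The radius [y0] is chosen before [B]: neither the oscillation of [rho] near [q] nor the wedge
    bounds see the direction. This uniformity later allows integration over directions. *)
Lemma law_cap (e : R) : 0 < e -> e < 1 -> exists2 y0 : R, 0 < y0 < 1 &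
  forall (y : R) (B : set (BV R m)), 0 < y -> y <= y0 -> measurable B ->
  (((1 - e) * (Num.sqrt 2 ^+ m * rho q) * y ^+ m)%:E * Leb (cone B 1) <= P (X @^-1` cap q U y B))%E /\
  (P (X @^-1` cap q U y B) <= ((1 + e) * (Num.sqrt 2 ^+ m * rho q) * y ^+ m)%:E * Leb (cone B 1))%E.
Proof.
move=> e0 e1.
have e40 : 0 < e / 4 * rho q by rewrite mulr_gt0// divr_gt0.
have [del del0 delP] := rho_near_q e40.
(* By Bernoulli, [y <= b] gives [(1 - y ^ 2) ^ (m + 1) >= 1 - e / 4]. The density costs another
   [e / 4], and both [(1 - e / 4) ^ 2 >= 1 - e] and [(1 + e / 4) / (1 - e / 4) <= 1 + e] hold for
   [e < 1]. *)
pose b := e / 4 / m.+1%:R.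
have b0 : 0 < b by rewrite !divr_gt0.
have b1 : b < 1.
  rewrite ltr_pdivrMr// mul1r; apply: (@lt_le_trans _ _ 1); first lra.
  by rewrite ler1n.
exists (Num.min del b); first by rewrite lt_min del0 b0 gt_min b1 orbT.
move=> y B y0; rewrite le_min => /andP[ydel yb] mB.
have y1 : y < 1 by exact: le_lt_trans b1.
have y20 : 0 <= y ^+ 2 by rewrite sqr_ge0.
have y2y : y ^+ 2 <= y by rewrite expr2 ger_pMl// ltW.
have a0 : 0 < 1 - y ^+ 2 by rewrite subr_gt0 (le_lt_trans y2y).
have a1 : 1 - y ^+ 2 <= 1 by rewrite gerBl.
have aS : 1 - e / 4 <= (1 - y ^+ 2) ^+ m.+1.
  apply: le_trans (bernoulli_le _ y20 (ltW (le_lt_trans y2y y1))).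
  rewrite lerD2l lerN2; apply: (@le_trans _ _ (m.+1%:R * b)).
    by rewrite ler_wpM2l// (le_trans y2y).
  by rewrite /b mulrCA divff ?mulr1.
have am : 1 - e / 4 <= (1 - y ^+ 2) ^+ m.
  by rewrite (le_trans aS)// exprS ger_pMl ?exprn_gt0.
have rr x : enorm x = 1 -> cap q U y B x -> (1 - e / 4) * rho q <= rho x <= (1 + e / 4) * rho q.
  move=> x1 [_ [xy _]]; have := delP x x1 (le_trans xy ydel).
  by rewrite ler_norml => /andP[h1 h2]; apply/andP; split; lra.
have mC := measurable_cap q U y mB.
have sy : 0 <= (Num.sqrt 2 * y) ^+ m.
  by rewrite exprn_ge0// mulr_ge0 ?sqrtr_ge0// ltW.
have c1 : 0 <= (1 - e / 4) * rho q by rewrite mulr_ge0 ?ltW//; lra.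
have c2 : 0 <= (1 + e / 4) * rho q by rewrite mulr_ge0 ?ltW//; lra.
split.
- apply: le_trans (law_ge mC c1 _); last by move=> x x1 /(rr x x1)/andP[].
  apply: le_trans (lee_wpmul2l _ (sph_cap_ge UU Uq q1 m0 y0 y1 mB)); last by rewrite lee_fin.
  rewrite muleA -EFinM lee_wpmul2r ?measure_ge0// lee_fin.
  rewrite (_ : (1 - e) * _ * _ = (1 - e) * (rho q * (Num.sqrt 2 * y) ^+ m)); last first.
    by rewrite exprMn; ring.
  rewrite (_ : (1 - e / 4) * _ * _ = ((1 - e / 4) * (1 - y ^+ 2) ^+ m.+1) * (rho q * (Num.sqrt 2 * y) ^+ m)); last by ring.
  rewrite ler_wpM2r ?mulr_ge0// ?(ltW rhoq)//.
  apply: (@le_trans _ _ ((1 - e / 4) * (1 - e / 4))); first nra.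
  by rewrite ler_wpM2l//; lra.
- apply: (le_trans (law_le mC c2 _)); first by move=> x x1 /(rr x x1)/andP[].
  apply: (le_trans (lee_wpmul2l _ (sph_cap_le UU Uq q1 m0 y0 y1 mB))); first by rewrite lee_fin.
  rewrite muleA -EFinM lee_wpmul2r ?measure_ge0// lee_fin.
  rewrite expr_div_n (_ : (1 + e) * _ * _ = (1 + e) * (rho q * (Num.sqrt 2 * y) ^+ m)); last first.
    by rewrite exprMn; ring.
  rewrite -!mulrA mulrCA mulrA [leRHS]mulrCA -mulrA ler_wpM2l ?(ltW rhoq)//.
  rewrite mulrCA [leRHS]mulrC ler_wpM2l//.
  rewrite ler_pdivrMr ?exprn_gt0//.
  apply: (@le_trans _ _ ((1 + e) * (1 - e / 4))); first nra.
  by rewrite ler_wpM2l//; lra.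
Qed.

End Law.

Section Integration.
Local Open Scope ereal_scope.

Lemma integral_push_restr d d' (T1 : measurableType d) (T2 : measurableType d') (R : realType)
    (mu : {measure set T1 -> \bar R}) (E : set T1) (mE : measurable E) (h : T1 -> T2)
    (mh : measurable_fun [set: T1] h) (g : T2 -> \bar R) :
  measurable_fun setT g -> (forall y, 0 <= g y) ->
  \int[push (mrestr mu mE) mh]_y g y = \int[mu]_(x in E) g (h x).
Proof.
move=> mg g0; rewrite ge0_integral_push//.
have mgh : measurable_fun [set: T1] (fun x => g (h x)) by exact: measurableT_comp.
rewrite (ge0_negligible_integral (measurableC mE))//=; last first.
  by rewrite /mrestr setICl measure0.
rewrite setDE setTI setCK; apply: eq_measure_integral => A mA AE.
by rewrite /= /mrestr; congr (mu _); exact/setIidl.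
Qed.

(** Bounds on the probabilities of direction events become bounds on integrals of functions of the
    direction, by comparing the images of the restricted measures on the common space [Y]. *)
Lemma integral_push_restr_le d1 d2 d3 (T1 : measurableType d1) (T2 : measurableType d2)
    (Y : measurableType d3) (R : realType)
    (mu : {measure set T1 -> \bar R}) (nu : {measure set T2 -> \bar R})
    (E : set T1) (F : set T2) (mE : measurable E) (mF : measurable F)
    (h : T1 -> Y) (k : T2 -> Y) (c : R) (g : Y -> \bar R) :
  measurable_fun [set: T1] h -> measurable_fun [set: T2] k -> (0 <= c)%R ->
  (forall B, measurable B -> c%:E * mu (h @^-1` B `&` E) <= nu (k @^-1` B `&` F)) ->
  measurable_fun setT g -> (forall y, 0 <= g y) ->
  c%:E * \int[mu]_(x in E) g (h x) <= \int[nu]_(x in F) g (k x).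
Proof.
move=> mh mk c0 H mg g0.
rewrite -(integral_push_restr mu mE mh mg g0) -(integral_push_restr nu mF mk mg g0).
have -> : c%:E = ((NngNum c0)%:num)%:E by [].
rewrite -ge0_integral_mscale//.
by apply: ge0_le_measure_integral => //.
Qed.

End Integration.

(** * Concentration of the attention weights *)

Section Uniform.
Variable R : realType.

(** Only [z1] is confined to the ball: it will be a discretised limit value, known to be bounded,
    whereas [z2] may be the random vector [c_n Y_n]. *)
Lemma unif_continuous_ball n (f : 'cV[R]_n -> R) (r e : R) : continuous f -> 0 < e ->
  exists2 del : R, 0 < del &
    forall z1 z2, `|z1| <= r -> `|z1 - z2| <= del -> `|f z1 - f z2| <= e.
Proof.
move=> cf e0.
(* Compactness is taken among row vectors, where [bounded_closed_compact] applies, and carried over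
   by transposition. *)
pose K : set 'rV[R]_n := [set v | `|v| <= r].
have nt (v : 'rV[R]_n) : `|v^T| = `|v|.
  rewrite /Num.Def.normr/= !mx_normrE; apply/le_anti/andP; split.
    apply: bigmax_le => [|[i j] _ /=]; first exact: bigmax_ge_id.
    by rewrite mxE; apply/bigmax_geP; right; exists (j, i).
  apply: bigmax_le => [|[i j] _ /=]; first exact: bigmax_ge_id.
  by apply/bigmax_geP; right; exists (j, i) => //=; rewrite mxE.
have cK : compact K.
  apply: bounded_closed_compact.
    exists r; split; first by rewrite num_real.
    by move=> M rM v /= vr; exact: le_trans vr (ltW rM).
  apply: (@closed_comp _ _ (fun v : 'rV[R]_n => `|v|) [set t : R | t <= r]).
    by move=> v _; exact: norm_continuous.
  exact: closed_le.
have /compact_near_coveringP := cK.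
move=> /(_ R (nbhs (0:R)^'+) (fun del v => forall z2, `|v^T - z2| <= del -> `|f v^T - f z2| <= e)).
move=> /(_ _) H.
have {H} : \forall del \near (0:R)^'+, K `<=`
    (fun v => forall z2, `|v^T - z2| <= del -> `|f v^T - f z2| <= e).
  apply: H => v _.
  have e20 : 0 < e / 2 by rewrite divr_gt0.
  have nv : nbhs v^T (fun x => `|f v^T - f x| <= e / 2).
    by have /cvgrPdist_le := cf v^T; exact.
  have [d d0 dP] : exists2 d : R, 0 < d & forall x, `|v^T - x| < d -> `|f v^T - f x| <= e / 2.
    move: nv => /nbhs_ballP[d d0 dP]; exists d => // x xd; apply: dP.
    by rewrite -ball_normE.
  have d20 : 0 < d / 2 by rewrite divr_gt0.
  exists ([set w | `|v - w| < d / 2], [set del | del < d / 2]) => /=.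
    split; first by apply/nbhs_ballP; exists (d / 2) => // w; rewrite -ball_normE.
    exact: nbhs_right_lt.
  move=> [w del] [/= vw deld] z2 wz.
  have h1 : `|f v^T - f w^T| <= e / 2.
    by apply: dP; rewrite -linearB/= nt (lt_trans vw)//; lra.
  have h2 : `|f v^T - f z2| <= e / 2.
    apply: dP; rewrite -(subrKA w^T) (le_lt_trans (ler_normD _ _))//.
    rewrite -linearB/= nt; lra.
  rewrite -(subrKA (f v^T)) (le_trans (ler_normD _ _))// distrC; lra.
move=> H; have [del [del0 delP]] : exists del : R, 0 < del /\ K `<=`
    (fun v => forall z2, `|v^T - z2| <= del -> `|f v^T - f z2| <= e).
  near (0:R)^'+ => del; exists del; split; first by near: del; exact: nbhs_right_gt.
  by near: del.
exists del => // z1 z2 z1r z12.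
rewrite -(trmxK z1); apply: delP; last by rewrite trmxK.
by rewrite /K/= -nt trmxK.
Unshelve. all: by end_near. Qed.

Lemma norm_mulmx_le n k (V : 'M[R]_(k, n)) :
  exists2 K : R, 0 < K & forall u : 'cV[R]_n, `|V *m u| <= K * `|u|.
Proof.
(* The added 1 keeps the constant positive when [V = 0]. *)
exists (1 + \sum_i \sum_j `|V i j|) => [|u].
  by rewrite ltr_pwDl// sumr_ge0// => i _; rewrite sumr_ge0.
have K0 : 0 <= \sum_i \sum_j `|V i j| by rewrite sumr_ge0// => i _; rewrite sumr_ge0.
rewrite [leLHS]/Num.Def.normr/= mx_normrE; apply: bigmax_le => [|[i j] _ /=].
  by rewrite mulr_ge0// addr_ge0.
rewrite (ord1 j) mxE (le_trans (ler_norm_sum _ _ _))//.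
apply: (@le_trans _ _ ((\sum_j `|V i j|) * `|u|)).
  by rewrite mulr_suml; apply: ler_sum => l _; rewrite normrM ler_wpM2l// coord_le_norm.
rewrite ler_wpM2r// (bigD1 i)//= addrCA lerDl addr_ge0//.
by rewrite sumr_ge0// => l _; rewrite sumr_ge0.
Qed.

End Uniform.

Section Concentration.
Variables (R : realType) (m : nat) (q : 'cV[R]_m.+1) (q1 : enorm q = 1) (T : Type)
  (x : nat -> T -> 'cV[R]_m.+1) (beta : nat -> R).

Lemma rad_Tsc i w : enorm (x i w) = 1 -> rad q (x i w) ^+ 2 = Tsc q x i w.
Proof.
move=> x1; rewrite /rad /Tsc sqr_sqrtr//.
have xx : dotv (x i w) (x i w) = 1 by rewrite -enorm_sqr x1 expr1n.
have := dotv_ge0 (x i w - q).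
rewrite -scaleN1r dotvDl !dotvDr !dotvZl !dotvZr xx (dotqq q1) (dotvC (x i w) q); lra.
Qed.

Lemma Zsum_gt0 n w : (0 < n)%N -> 0 < Zsum q x beta n w.
Proof.
case: n => // n _; rewrite /Zsum big_ord_recr/= ltr_wpDl ?expR_gt0//.
by apply: sumr_ge0 => i _; exact: expR_ge0.
Qed.

Lemma sum_Aw n w : (0 < n)%N -> \sum_(i < n) Aw q x beta n i w = 1.
Proof. by move=> n0; rewrite -mulr_suml divff// gt_eqF// Zsum_gt0. Qed.

Lemma Aw_ge0 n i w : 0 <= Aw q x beta n i w.
Proof. by rewrite divr_ge0 ?expR_ge0// sumr_ge0// => j _; exact: expR_ge0. Qed.

(** The denominator is at least its [i]-th term. *)
Lemma Aw_le n i j w : (i < n)%N ->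
  Aw q x beta n j w <= expR (- beta n * (Tsc q x j w - Tsc q x i w)).
Proof.
move=> i_n.
rewrite /Aw [in leRHS]mulrBr expRD expRN ler_wpM2l ?expR_ge0//.
rewrite lef_pV2 ?posrE ?expR_gt0//; last by apply: Zsum_gt0; exact: leq_ltn_trans i_n.
rewrite /Zsum (bigD1 (Ordinal i_n))//= lerDl.
by apply: sumr_ge0 => k _; exact: expR_ge0.
Qed.

Lemma norm_sub_rad i w : enorm (x i w) = 1 -> `|x i w - q| <= Num.sqrt 2 * rad q (x i w).
Proof.
move=> x1; apply: le_trans (norm_le_enorm _) _.
rewrite -(@ler_pXn2r _ 2)// ?nnegrE ?enorm_ge0 ?mulr_ge0 ?sqrtr_ge0//.
by rewrite (rad_sqr q1)// exprMn (@sqr_sqrtr _ 2).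
Qed.

(** Write [R_j = c * rad (x j)] and [b = beta n / c ^ 2]. The gap gives
    [R_j ^ 2 - R_i ^ 2 >= eta R_j], so the weight of [j] is at most [exp (- b eta R_j)], while the
    scaled distance from [x j] to [x i] is at most [2 sqrt 2 R_j]. One unit of the exponent [b eta]
    absorbs the factor [R_j <= exp R_j], one is kept to make the sum over [j] integrable, and the
    rest is evaluated at [R_j >= eta]. *)
Lemma nearest_dominates n i w (c A eta : R) :
  (i < n)%N -> 0 < c -> 0 < eta -> 2 <= beta n / c ^+ 2 * eta ->
  (forall j, (j < n)%N -> enorm (x j w) = 1) ->
  c * rad q (x i w) <= A ->
  (forall j, (j < n)%N -> j != i -> A + eta < c * rad q (x j w)) ->
  `|c *: (\sum_(j < n) Aw q x beta n j w *: (x j w - q)) - c *: (x i w - q)| <=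
   2 * Num.sqrt 2 * expR (- (beta n / c ^+ 2 * eta - 2) * eta) *
     \sum_(j < n) expR (- (c * rad q (x j w))).
Proof.
move=> i_n c0 eta0 b2 xS Ri Rj.
set b := beta n / c ^+ 2 in b2 *.
have n0 : (0 < n)%N by exact: leq_ltn_trans i_n.
have c20 : 0 < c ^+ 2 by exact: exprn_gt0.
have b0 : 0 < b by rewrite -(pmulr_lgt0 _ eta0); apply: lt_le_trans b2.
have -> : c *: (x i w - q) = c *: \sum_(j < n) Aw q x beta n j w *: (x i w - q).
  by rewrite -scaler_suml sum_Aw// scale1r.
rewrite -scalerBr -sumrB scaler_sumr.
apply: (le_trans (ler_norm_sum _ _ _)); rewrite mulr_sumr; apply: ler_sum => j _.
rewrite -scalerBr scalerA normrZ normrM (gtr0_norm c0) (ger0_norm (Aw_ge0 _ _ _)).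
set Rr := fun j => c * rad q (x j w).
have [ji|ji] := eqVneq (j : nat) i.
  by rewrite ji subrr normr0 mulr0 !mulr_ge0 ?sqrtr_ge0 ?expR_ge0.
have jn := ltn_ord j.
have Rj' := Rj j jn ji.
have R0 k : 0 <= Rr k by rewrite mulr_ge0 ?rad_ge0// ltW.
have h1 : c * `|x j w - q - (x i w - q)| <= 2 * Num.sqrt 2 * Rr j.
  have h := le_trans (ler_normB (x j w - q) (x i w - q))
    (lerD (norm_sub_rad (xS j jn)) (norm_sub_rad (xS i i_n))).
  apply: (le_trans (ler_wpM2l (ltW c0) h)).
  rewrite -mulrDr mulrCA (mulrC 2) -mulrA ler_wpM2l ?sqrtr_ge0//.
  rewrite mulrDr -/(Rr j) -/(Rr i).
  have : Rr i <= Rr j by rewrite (le_trans Ri)// ltW// (le_lt_trans _ Rj')// lerDl ltW.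
  lra.
have h2 : Aw q x beta n j w <= expR (- (b * eta) * Rr j).
  apply: (le_trans (Aw_le j w i_n)); rewrite ler_expR.
  rewrite -(rad_Tsc (xS j jn)) -(rad_Tsc (xS i i_n)).
  have -> : - beta n * (rad q (x j w) ^+ 2 - rad q (x i w) ^+ 2) = - (b * (Rr j ^+ 2 - Rr i ^+ 2)).
    by rewrite /b /Rr; field; exact: lt0r_neq0.
  rewrite mulNr lerN2 -mulrA ler_wpM2l ?(ltW b0)//.
  rewrite subr_sqr ler_pM ?(ltW eta0)//; last by rewrite lerDl.
  by rewrite lerBrDr addrC (le_trans (lerD Ri (lexx eta)))// ltW.
have h3 : eta <= Rr j.
  by apply: le_trans (ltW Rj'); rewrite lerDr (le_trans _ Ri)// R0.
rewrite mulrAC [X in X <= _]mulrC.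
apply: (le_trans (ler_pM (Aw_ge0 _ _ _) _ h2 h1)); first by rewrite mulr_ge0 ?(ltW c0).
rewrite mulrCA -[leRHS]mulrA ler_wpM2l ?mulr_ge0 ?sqrtr_ge0//.
rewrite -/(Rr j) -expRD.
apply: (@le_trans _ _ (expR (- (b * eta) * Rr j) * expR (Rr j))).
  rewrite ler_wpM2l ?expR_ge0//.
  by have := expR_ge1Dx (Rr j); lra.
rewrite -expRD ler_expR.
have : 0 <= (b * eta - 2) * (Rr j - eta) by rewrite mulr_ge0// subr_ge0.
lra.
Qed.

Variable U : 'M[R]_(m.+1, m).
Hypotheses (UU : U^T *m U = 1%:M) (Uq : U^T *m q = 0).

Lemma sphere_decomp (z : 'cV[R]_m.+1) : z = U *m (U^T *m z) + dotv q z *: q.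
Proof.
have FF := frame_orthogonal UU Uq q1.
have E : z = frame q U *m ((frame q U)^T *m z).
  by rewrite mulmxA (mulmx1C FF) mul1mx.
set w := (frame q U)^T *m z in E.
rewrite -(resK w) frame_ext in E.
by rewrite {2 3}E (trU_frame UU Uq) (dotv_q_frame Uq q1) -E.
Qed.

(** With [r = rad z], [z - q = r sqrt (2 - r ^ 2) theta - r ^ 2 q] where [theta = U (ang U z)].
    After scaling by [c], the three errors come from the curvature in [sqrt (2 - r ^ 2)], the width
    of the grid cell, and the component along [q]. *)
Lemma tangent_approx (z : 'cV[R]_m.+1) (c A eta L : R) :
  enorm z = 1 -> 0 < c -> A - eta <= c * rad q z -> c * rad q z <= A -> A <= L -> L <= c ->
  `|c *: (z - q) - (Num.sqrt 2 * A) *: (U *m ang U z)| <=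
    L ^+ 3 / c ^+ 2 + Num.sqrt 2 * eta + L ^+ 2 / c.
Proof.
move=> z1 c0 Al Au AL Lc.
set r := rad q z in Al Au *.
set v := U^T *m z : 'cV[R]_m.
have r0 : 0 <= r by exact: rad_ge0.
have zz : dotv z z = 1 by rewrite -enorm_sqr z1 expr1n.
have r2 : r ^+ 2 = 1 - dotv q z.
  rewrite sqr_sqrtr//; have := dotv_ge0 (z - q).
  rewrite -scaleN1r dotvDl !dotvDr !dotvZl !dotvZr zz (dotqq q1) (dotvC z q); lra.
have v2 : enorm v ^+ 2 = r ^+ 2 * (2 - r ^+ 2).
  have := enorm_frame UU Uq q1 v (dotv q z); rewrite -sphere_decomp z1 r2 expr1n => h.
  have -> : enorm v ^+ 2 = 1 - dotv q z ^+ 2 by rewrite h addrK.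
  by ring.
have v0 := enorm_ge0 v.
have vang : v = enorm v *: ang U z.
  rewrite /ang /dir -/v; have [vv|vn] := eqVneq (enorm v) 0.
    by apply/eqP; rewrite vv scale0r -enorm_eq0 vv.
  by rewrite scalerA divff// scale1r.
have ang1 : `|U *m ang U z| <= 1.
  apply: le_trans (norm_le_enorm _) _; rewrite enorm_isometry//.
  rewrite /ang; have [vp|vn] := ltP 0 (enorm v); first by rewrite enorm_dir.
  by rewrite enormZ normfV (ger0_norm v0) [enorm _](_ : _ = 0) ?mulr0//; apply/le_anti/andP.
have zq : z - q = enorm v *: (U *m ang U z) - r ^+ 2 *: q.
  rewrite {1}(sphere_decomp z) -/v {1}vang -scalemxAr r2 scalerBl scale1r opprB.
  by rewrite addrA.
have rL : c * r <= L by exact: le_trans AL.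
have L0 : 0 <= L by apply: le_trans rL; rewrite mulr_ge0 ?(ltW c0).
have cr0 : 0 <= c * r by rewrite mulr_ge0 ?(ltW c0).
have r1 : r <= 1 by rewrite -(ler_pM2l c0) mulr1 (le_trans rL).
have r21 : r ^+ 2 <= 1 by rewrite expr_le1.
have s20 : (0:R) <= Num.sqrt 2 by exact: sqrtr_ge0.
have s22 : Num.sqrt 2 ^+ 2 = 2 :> R by rewrite sqr_sqrtr.
have s21 : (1:R) <= Num.sqrt 2.
  by rewrite -(@ler_pXn2r _ 2)// ?nnegrE// s22 expr1n; lra.
have vu : enorm v <= Num.sqrt 2 * r.
  rewrite -(@ler_pXn2r _ 2)// ?nnegrE ?mulr_ge0// v2 exprMn s22 mulrC ler_wpM2r ?sqr_ge0//.
  by rewrite gerBl sqr_ge0.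
have vl : Num.sqrt 2 * r - r ^+ 3 <= enorm v.
  have E : Num.sqrt 2 * r - r ^+ 3 = r * (Num.sqrt 2 - r ^+ 2) by ring.
  have h0 : 0 <= Num.sqrt 2 - r ^+ 2 by rewrite subr_ge0 (le_trans r21).
  rewrite E -(@ler_pXn2r _ 2)// ?nnegrE ?mulr_ge0// v2 exprMn ler_wpM2l ?sqr_ge0//.
  rewrite sqrrB s22.
  have : 0 <= r ^+ 2 * (2 * Num.sqrt 2 - 1 - r ^+ 2).
    by rewrite mulr_ge0 ?sqr_ge0//; lra.
  have -> : (r ^+ 2) ^+ 2 = r ^+ 2 * r ^+ 2 by rewrite expr2.
  lra.
have cr3 : c * r ^+ 3 <= L ^+ 3 / c ^+ 2.
  rewrite ler_pdivlMr ?exprn_gt0// (_ : c * r ^+ 3 * c ^+ 2 = (c * r) ^+ 3); last by rewrite exprMn; ring.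
  by rewrite ler_pXn2r ?nnegrE.
have cr2 : c * r ^+ 2 <= L ^+ 2 / c.
  rewrite ler_pdivlMr// (_ : c * r ^+ 2 * c = (c * r) ^+ 2); last by rewrite exprMn; ring.
  by rewrite ler_pXn2r ?nnegrE.
have q1' : `|q| <= 1 by rewrite -q1 norm_le_enorm.
rewrite zq scalerBr !scalerA addrAC -scalerBl.
apply: (le_trans (ler_normB _ _)); rewrite normrZ [`|_ *: q|]normrZ.
apply: lerD; last first.
  apply: le_trans cr2; rewrite ger0_norm ?mulr_ge0 ?sqr_ge0 ?(ltW c0)//.
  by rewrite ler_piMr// mulr_ge0 ?sqr_ge0// ltW.
apply: (@le_trans _ _ `|c * enorm v - Num.sqrt 2 * A|); first by rewrite ler_piMr.
have h1 : c * enorm v <= Num.sqrt 2 * (c * r) by rewrite mulrCA ler_wpM2l// ltW.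
have h2 : Num.sqrt 2 * (c * r) - c * r ^+ 3 <= c * enorm v.
  by have := ler_wpM2l (ltW c0) vl; rewrite mulrBr mulrCA.
have h3 : Num.sqrt 2 * (A - eta) <= Num.sqrt 2 * (c * r) by rewrite ler_wpM2l.
have h4 : Num.sqrt 2 * (c * r) <= Num.sqrt 2 * A by rewrite ler_wpM2l.
have h5 : 0 <= c * r ^+ 3 by rewrite mulr_ge0 ?exprn_ge0 ?(ltW c0).
move: h3; rewrite mulrBr => h3.
by rewrite ler_norml; apply/andP; split; lra.
Qed.

End Concentration.

(** * Isolated nearest points *)

Section Real_estimates.
Variable R : realType.

Lemma subX_le (x y X : R) n : 0 <= y -> y <= x -> x <= X -> 1 <= X ->
  x ^+ n - y ^+ n <= n%:R * (x - y) * X ^+ n.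
Proof.
move=> y0 yx xX X1; have x0 : 0 <= x := le_trans y0 yx.
have X0 : 0 <= X := le_trans x0 xX.
rewrite subrXX [n%:R * _]mulrC -mulrA ler_wpM2l ?subr_ge0//.
apply: (@le_trans _ _ (\sum_(i < n) X ^+ n)); last first.
  by rewrite sumr_const card_ord -[leLHS]mulr_natl.
apply: ler_sum => i _.
apply: (@le_trans _ _ (X ^+ (n.-1 - i) * X ^+ i)).
  by apply: ler_pM; rewrite ?exprn_ge0//; apply: lerXn2r; rewrite ?nnegrE// (le_trans yx).
rewrite -exprD subnK; last by rewrite -ltnS (ltn_predK (ltn_ord i)).
by rewrite ler_weXn2l// leq_pred.
Qed.

(** The inverse of [1 - u] is [1 + u / (1 - u) <= exp (u / (1 - u))]. *)
Lemma expR_ge_onemX (u : R) n : 0 <= u -> u < 1 ->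
  expR (- (n%:R * (u / (1 - u)))) <= (1 - u) ^+ n.
Proof.
move=> u0 u1; have u10 : 0 < 1 - u by rewrite subr_gt0.
rewrite expRN expRM_natl -exprVn lerXn2r ?nnegrE ?invr_ge0 ?expR_ge0 ?(ltW u10)//.
rewrite -[leRHS]invrK lef_pV2 ?posrE ?invr_gt0 ?expR_gt0//.
apply: le_trans (expR_ge1Dx _).
have -> // : 1 + u / (1 - u) = (1 - u)^-1 by field; exact: lt0r_neq0.
Qed.

(* The left side is the mass of [ ]A - eta, A] ] under the law of [sqrt R1], and the right side is
   what the cap asymptotics give for [n] times the probability of an isolated point. *)
Lemma mesh_exists (m L : nat) (e : R) : (0 < m)%N -> (0 < L)%N -> 0 < e -> e < 1 ->
  exists2 eta0 : R, 0 < eta0 & forall eta : R, 0 < eta -> eta <= eta0 ->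
  exists2 e0 : R, 0 < e0 < 1 & forall A : R, eta <= A -> A <= L%:R ->
  (1 - e) * (expR (- (A - eta) ^+ m) - expR (- A ^+ m)) <=
  ((1 - e0) * A ^+ m - (1 + e0) * (A - eta) ^+ m) * expR (- ((1 + e0) ^+ 2 * (A + eta) ^+ m)).
Proof.
move=> m0 L0 ep e1.
pose X : R := (L%:R + 1) ^+ m.
have L1 : 1 <= L%:R :> R by rewrite ler1n.
have X1 : 1 <= X by rewrite exprn_ege1// lerDr.
have X0 : 0 < X by exact: lt_le_trans X1.
have mR : 0 < m%:R :> R by rewrite ltr0n.
(* By [subX_le] over an interval of length [2 eta], this yields
   [(A + eta) ^ m - (A - eta) ^ m <= e / 3]. *)
pose eta0 : R := Num.min 1 (e / (6 * m%:R * X)).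
have eta00 : 0 < eta0 by rewrite lt_min ltr01/= divr_gt0// !mulr_gt0.
exists eta0 => // eta etap; rewrite le_min => /andP[eta1 etae].
have etam : 0 < eta ^+ m by exact: exprn_gt0.
have etam1 : eta ^+ m <= 1 by rewrite exprn_ile1// ltW.
(* The relative error [e0] of the cap asymptotics acts on [a + b], but must be small compared with
   [b - a], which may be as small as [eta ^ m]; hence it is chosen after [eta]. *)
pose e0 : R := e / 9 * eta ^+ m / X.
have e00 : 0 < e0 by rewrite /e0 !mulr_gt0// ?invr_gt0//; lra.
have e0X : e0 * X = e / 9 * eta ^+ m by rewrite /e0 divfK// gt_eqF.
have e0X' : e0 * X <= e / 9.
  by rewrite e0X ler_piMr//; lra.
have e0e : e0 <= e / 9 by apply: le_trans e0X'; rewrite ler_pMr.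
exists e0; first by rewrite e00/=; lra.
move=> A etaA AL.
set a := (A - eta) ^+ m; set b := A ^+ m; set c := (A + eta) ^+ m.
have A0 : 0 <= A by rewrite (le_trans (ltW etap)).
have Am0 : 0 <= A - eta by rewrite subr_ge0.
have aX : a <= X by apply: lerXn2r; rewrite ?nnegrE; lra.
have bX : b <= X by apply: lerXn2r; rewrite ?nnegrE; lra.
have cX : c <= X by apply: lerXn2r; rewrite ?nnegrE; lra.
have a0 : 0 <= a by exact: exprn_ge0.
have c0 : 0 <= c by rewrite exprn_ge0// addr_ge0// ltW.
(* This is [u ^ m + v ^ m <= (u + v) ^ m] at [u = eta] and [v = A - eta], by induction on
   [m >= 1]. *)
have ba : eta ^+ m <= b - a.
  rewrite lerBrDr /a /b -[X in _ <= X ^+ m](subrK eta).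
  case: (m) m0 => // k _; elim: k => [|k ih]; first by rewrite !expr1 addrC.
  rewrite exprS [X in _ <= X]exprS [X in _ + X]exprS.
  apply: (@le_trans _ _ ((A - eta + eta) * (eta ^+ k.+1 + (A - eta) ^+ k.+1))); last first.
    by rewrite ler_wpM2l// subrK.
  rewrite mulrDl !mulrDr.
  have : 0 <= (A - eta) * eta ^+ k.+1 by rewrite mulr_ge0// exprn_ge0// ltW.
  have : 0 <= eta * (A - eta) ^+ k.+1 by rewrite mulr_ge0 ?exprn_ge0// ltW.
  lra.
have ca : c - a <= e / 3.
  have := @subX_le (A + eta) (A - eta) (L%:R + 1) m Am0 _ _ _.
  have -> : A + eta - (A - eta) = 2 * eta by ring.
  move=> /(_ _ _ _)/le_trans; apply; [lra|lra|lra|].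
  rewrite -/X; move: etae; rewrite ler_pdivlMr ?mulr_gt0//; lra.
have h1 : (1 - e / 3) * (b - a) <= (1 - e0) * b - (1 + e0) * a.
  have : e0 * (a + b) <= e / 3 * (b - a).
    apply: (@le_trans _ _ (2 * (e0 * X))); first by rewrite mulrCA ler_wpM2l ?(ltW e00)//; lra.
    rewrite e0X; apply: (@le_trans _ _ (e / 3 * eta ^+ m)); last by rewrite ler_wpM2l//; lra.
    by rewrite !mulrA ler_wpM2r ?(ltW etam)//; lra.
  lra.
have h2 : expR (- a) * (1 - 2 * e / 3) <= expR (- ((1 + e0) ^+ 2 * c)).
  have -> : - ((1 + e0) ^+ 2 * c) = - a + (- ((c - a) + (2 * e0 + e0 ^+ 2) * c)) by ring.
  rewrite expRD ler_wpM2l ?expR_ge0//; apply: le_trans (expR_ge1Dx _).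
  have : (2 * e0 + e0 ^+ 2) * c <= e / 3.
    apply: (@le_trans _ _ (3 * (e0 * X))); last by move: e0X'; lra.
    rewrite mulrA ler_pM//; first by rewrite addr_ge0 ?sqr_ge0// mulr_ge0// ltW.
    have : e0 ^+ 2 <= e0 by rewrite expr2 ger_pMl//; lra.
    lra.
  by move: ca; lra.
have h3 : expR (- a) - expR (- b) <= expR (- a) * (b - a).
  have -> : expR (- b) = expR (- a) * expR (- (b - a)) by rewrite -expRD; congr expR; ring.
  rewrite -[X in X - _]mulr1 -mulrBr ler_wpM2l ?expR_ge0//.
  by have := expR_ge1Dx (- (b - a)); lra.
have ba0 : 0 <= b - a by rewrite (le_trans (ltW etam)).
apply: (@le_trans _ _ ((1 - e) * (expR (- a) * (b - a)))); first by rewrite ler_wpM2l//; lra.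
apply: (@le_trans _ _ ((1 - e / 3) * (b - a) * (expR (- a) * (1 - 2 * e / 3)))).
  have -> : (1 - e / 3) * (b - a) * (expR (- a) * (1 - 2 * e / 3)) =
     ((1 - e / 3) * (1 - 2 * e / 3)) * (expR (- a) * (b - a)) by ring.
  by rewrite ler_wpM2r ?mulr_ge0 ?expR_ge0//; nra.
rewrite ler_pM//; first by rewrite mulr_ge0//; lra.
by rewrite mulr_ge0 ?expR_ge0//; lra.
Qed.

Lemma sum_expR_poly_bound (m : nat) : exists2 B : R, 0 < B &
  forall N, \sum_(k < N) expR (- k%:R) * k.+1%:R ^+ m <= B.
Proof.
pose r : R := expR (- (1 / 2)).
have r0 : 0 < r by exact: expR_gt0.
have r1 : r < 1 by rewrite -expR0 ltr_expR; lra.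
(* From [z <= exp z] at [z = (k + 1) / (2 (m + 1))], raised to the power [m + 1]. Using [m + 1]
   instead of [m] spares the case [m = 0]; the remaining decay [exp (- k / 2)] is geometric. *)
pose K : R := (2 * m.+1%:R) ^+ m.+1 * expR (1 / 2).
have K0 : 0 < K by rewrite mulr_gt0 ?expR_gt0// exprn_gt0// mulr_gt0.
have sr0 : 0 < 1 - r by rewrite subr_gt0.
exists (K / (1 - r)) => [|N]; first by rewrite divr_gt0.
apply: (@le_trans _ _ (K * \sum_(k < N) r ^+ k)); last first.
  rewrite ler_wpM2l ?(ltW K0)// -[leRHS]mul1r ler_pdivlMr//.
  have := subrX1 r N; rewrite -[r - 1]opprB mulNr => h.
  have h' : (1 - r) * (\sum_(i < N) r ^+ i) = 1 - r ^+ N by lra.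
  by rewrite mulrC h' lerBlDr lerDl exprn_ge0// ltW.
rewrite mulr_sumr; apply: ler_sum => k _.
have k1 : 1 <= k.+1%:R :> R by rewrite ler1n.
apply: (@le_trans _ _ (expR (- k%:R) * k.+1%:R ^+ m.+1)).
  by rewrite ler_wpM2l ?expR_ge0// exprS ler_peMl// exprn_ge0.
have h : k.+1%:R ^+ m.+1 <= (2 * m.+1%:R) ^+ m.+1 * expR (k.+1%:R / 2) :> R.
  have -> : k.+1%:R / 2 = m.+1%:R * (k.+1%:R / (2 * m.+1%:R)) :> R.
    by field; rewrite ?pnatr_eq0//; apply/andP.
  rewrite expRM_natl -exprMn lerXn2r ?nnegrE ?mulr_ge0 ?expR_ge0//.
  rewrite mulrC -ler_pdivrMr ?mulr_gt0//.
  by apply: le_trans (expR_ge1Dx _); rewrite lerDr.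
apply: (le_trans (ler_wpM2l (expR_ge0 _) h)).
rewrite mulrCA /K -mulrA ler_wpM2l ?exprn_ge0 ?mulr_ge0//.
rewrite /r -expRM_natl -!expRD ler_expR -natr1; lra.
Qed.

End Real_estimates.

Section Nearest_point.
Variables (R : realType) (m : nat) (q : 'cV[R]_m.+1) (U : 'M[R]_(m.+1, m)).
Hypothesis m0 : (0 < m)%N.
Context {dO : measure_display} {Omega : measurableType dO} (P : probability Omega R).
Variable x : nat -> Omega -> 'cV[R]_m.+1.
Hypotheses (x_rv : forall i, random_vector (x i)) (x_indep : mutually_independent P x).
Hypothesis x_id : forall i (A : set 'cV[R]_m.+1), borel A -> P (x i @^-1` A) = P (x 0 @^-1` A).
Hypothesis x_sphere : P (x 0 @^-1` [set z | enorm z <> 1]) = 0%E.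
Hypothesis x_pole : P (x 0 @^-1` [set z | ~~ (0 < rad q z)]) = 0%E.

Definition pr (A : set (BV R m.+1)) : R := fine (P (x 0 @^-1` A)).

Lemma prE i (A : set (BV R m.+1)) : measurable A -> P (x i @^-1` A) = (pr A)%:E.
Proof.
move=> mA; rewrite x_id// /pr fineK// fin_num_measure//.
exact: x_rv.
Qed.

Lemma pr_ge0 A : 0 <= pr A.
Proof. exact: fine_ge0. Qed.

Lemma pr_le A B : measurable A -> measurable B -> A `<=` B -> pr A <= pr B.
Proof.
move=> mA mB AB; rewrite -lee_fin -!(prE 0)//.
by apply: le_measure; rewrite ?inE; [exact: x_rv|exact: x_rv|move=> w; exact: AB].
Qed.

Lemma prU_le A B : measurable A -> measurable B -> pr (A `|` B) <= pr A + pr B.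
Proof.
move=> mA mB; rewrite -lee_fin EFinD -!(prE 0)//; last exact: measurableU.
by apply: measureU2; exact: x_rv.
Qed.

Lemma prT : pr setT = 1.
Proof. by rewrite /pr preimage_setT probability_setT. Qed.

Lemma pr_le1 A : measurable A -> pr A <= 1.
Proof. by move=> mA; rewrite -prT; apply: pr_le => //. Qed.

Let offsphere : set (BV R m.+1) := [set z | enorm z <> 1].
Let pole : set (BV R m.+1) := [set z | ~~ (0 < rad q z)].

Lemma measurable_sphere : measurable ([set z | enorm z = 1] : set (BV R m.+1)).
Proof.
rewrite (_ : [set z | _] = [set z : BV R m.+1 | [set (1 : R)] (enorm z)]) //.
by apply: measurable_preimageT => //; exact: measurable_enorm.
Qed.

Let measurable_offsphere : measurable offsphere.
Proof. exact: measurableC measurable_sphere. Qed.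

Let measurable_pole : measurable pole.
Proof.
rewrite (_ : pole = ~` [set z | 0 < rad q z]).
  by apply: measurableC; apply: measurable_ltr => //; exact: measurable_rad.
by apply/seteqP; split => z /= /negP.
Qed.

Let pr_offsphere : pr offsphere = 0. Proof. by rewrite /pr x_sphere. Qed.
Let pr_pole : pr pole = 0. Proof. by rewrite /pr x_pole. Qed.

Variable S : probability (BV R m) R.
Variable C : R.
Hypothesis C0 : 0 < C.
Hypothesis x_cap : forall e : R, 0 < e -> e < 1 -> exists2 y0 : R, 0 < y0 &
  forall (y : R) (B : set (BV R m)), 0 < y -> y <= y0 -> measurable B ->
  (((1 - e) * C * y ^+ m)%:E * S B <= P (x 0 @^-1` cap q U y B))%E /\
  (P (x 0 @^-1` cap q U y B) <= ((1 + e) * C * y ^+ m)%:E * S B)%E.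

Variable c : nat -> R.
Hypothesis c_gt0 : forall n, (0 < n)%N -> 0 < c n.
Hypothesis cX : forall n, c n ^+ m = C * n%:R.
Hypothesis c_oo : c n @[n --> \oo] --> +oo.

Definition s (B : set (BV R m)) : R := fine (S B).

Lemma sE B : measurable B -> S B = (s B)%:E.
Proof. by move=> mB; rewrite /s fineK// fin_num_measure. Qed.

Lemma s_ge0 B : 0 <= s B. Proof. exact: fine_ge0. Qed.

Lemma sT : s setT = 1. Proof. by rewrite /s probability_setT. Qed.

(** The normalisation [c n ^ m = C * n] turns the cap mass [C (A / c n) ^ m] into [A ^ m / n]. *)
Lemma cap_asymptotics (e L : R) : 0 < e -> e < 1 -> \forall n \near \oo,
  forall (A : R) (B : set (BV R m)), 0 <= A -> A <= L -> measurable B ->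
  (1 - e) * A ^+ m * s B <= n%:R * pr (cap q U (A / c n) B) <= (1 + e) * A ^+ m * s B.
Proof.
move=> e0 e1; have [y0 y00 H] := x_cap e0 e1.
have [N0 _ HN] : \forall n \near \oo, L / y0 <= c n by move/cvgryPge : c_oo; exact.
exists N0.+1 => // n /= Nn A B A0 AL mB.
have n0 : (0 < n)%N by exact: leq_ltn_trans Nn.
have nR : 0 < n%:R :> R by rewrite ltr0n.
have cn0 := c_gt0 n0.
have mC := measurable_cap q U (A / c n) mB.
(* [x_cap] speaks of positive radii; radius 0, which occurs at the inner end of the first grid cell,
   gives the empty cap. *)
have [A00|An0] := eqVneq A 0.
  rewrite A00 mul0r expr0n eqn0Ngt m0 !mulr0 !mul0r.
  rewrite (_ : cap q U 0 B = set0) ?/pr ?preimage_set0 ?measure0 ?mulr0 ?lexx//.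
  apply/seteqP; split => z //= -[z0 [z1 _]].
  by move: z0; rewrite ltNge z1.
have Ap : 0 < A by rewrite lt_def An0.
have := H (A / c n) B; rewrite divr_gt0// => /(_ isT).
have -> : A / c n <= y0.
  rewrite ler_pdivrMr// mulrC -ler_pdivrMr//.
  by apply: le_trans (HN n (ltnW Nn)); rewrite ler_pM2r ?invr_gt0.
move=> /(_ isT mB); rewrite (prE 0)// sE// -!EFinM !lee_fin.
have E e' : e' * C * (A / c n) ^+ m = e' * A ^+ m / n%:R.
  by rewrite expr_div_n cX; field; rewrite ?gt_eqF.
rewrite !E => -[h1 h2]; apply/andP; split.
  by rewrite [leRHS]mulrC -ler_pdivrMr// mulrAC.
by rewrite mulrC -ler_pdivlMr// mulrAC.
Qed.

Definition shell n (A1 A2 : R) : set (BV R m.+1) :=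
  [set z | enorm z = 1 /\ A1 < c n * rad q z /\ c n * rad q z <= A2].

Definition beyond n (A : R) : set (BV R m.+1) :=
  [set z | enorm z = 1 /\ A < c n * rad q z].

Definition inS (B : set (BV R m)) : set (BV R m.+1) := [set z | B (ang U z)].

Lemma measurable_crad n : measurable_fun [set: BV R m.+1] (fun z => c n * rad q z).
Proof. by apply: measurable_funM => //; exact: measurable_rad. Qed.

Lemma measurable_shell n A1 A2 : measurable (shell n A1 A2).
Proof.
have h := measurable_crad n.
apply: measurableI; first exact: measurable_sphere.
by apply: measurableI; [exact: measurable_ltr|exact: measurable_ler].
Qed.

Lemma measurable_beyond n A : measurable (beyond n A).
Proof.
have h := measurable_crad n.
by apply: measurableI; [exact: measurable_sphere|exact: measurable_ltr].
Qed.

Lemma measurable_inS B : measurable B -> measurable (inS B).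
Proof. by move=> mB; apply: measurable_preimageT => //; exact: measurable_ang. Qed.

Lemma shell_ge n A1 A2 B : (0 < n)%N -> measurable B -> 0 <= A1 ->
  pr (cap q U (A2 / c n) B) - pr (cap q U (A1 / c n) B) <= pr (inS B `&` shell n A1 A2).
Proof.
move=> n0 mB A10; have cn0 := c_gt0 n0.
have m1 := measurable_cap q U (A1 / c n) mB.
have m2 := measurable_cap q U (A2 / c n) mB.
have m3 : measurable (inS B `&` shell n A1 A2).
  by apply: measurableI; [exact: measurable_inS|exact: measurable_shell].
rewrite lerBlDr.
apply: (@le_trans _ _ (pr ((inS B `&` shell n A1 A2 `|` cap q U (A1 / c n) B) `|` offsphere))).
  apply: pr_le => //; first by apply: measurableU => //; exact: measurableU.
  move=> z [z0 [z1 z2]]; have [zS|zS] := pselect (enorm z = 1); last by right.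
  left; have [zA|zA] := leP (rad q z) (A1 / c n); first by right.
  left; split => //; split => //; split.
    by rewrite mulrC -ltr_pdivrMr.
  by rewrite mulrC -ler_pdivlMr.
apply: (le_trans (prU_le _ _)) => //; first exact: measurableU.
by rewrite pr_offsphere addr0; exact: prU_le.
Qed.

Lemma beyond_ge n A : (0 < n)%N -> 1 - pr (cap q U (A / c n) setT) <= pr (beyond n A).
Proof.
move=> n0; have cn0 := c_gt0 n0.
have m1 : measurable (cap q U (A / c n) setT) by exact: measurable_cap.
have m2 := measurable_beyond n A.
rewrite lerBlDr -prT.
apply: (@le_trans _ _ (pr (((beyond n A `|` cap q U (A / c n) setT) `|` offsphere) `|` pole))).
  apply: pr_le => //; first by do 2! [apply: measurableU => //]; exact: measurableU.
  move=> z _; have [zS|zS] := pselect (enorm z = 1); last by left; right.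
  have [z0|z0] := boolP (0 < rad q z); last by right.
  left; left; have [zA|zA] := leP (rad q z) (A / c n); first by right.
  by left; split => //; rewrite mulrC -ltr_pdivrMr.
apply: (le_trans (prU_le _ _)) => //; first by apply: measurableU => //; exact: measurableU.
rewrite pr_pole addr0.
apply: (le_trans (prU_le _ _)) => //; first exact: measurableU.
by rewrite pr_offsphere addr0; exact: prU_le.
Qed.

(* For [A1 < A2 < A3] spaced along a grid these events are disjoint in [i] and in the grid index,
   so they replace a measurable selection of the nearest point. *)
Definition isolated n i (A1 A2 A3 : R) : set Omega :=
  [set w | shell n A1 A2 (x i w) /\
    forall j, (j < n)%N -> j != i -> beyond n A3 (x j w)].

(** One set per sample index is the form that [mutually_independent] takes; the direction constraint
    goes into slot [i]. *)
Lemma isolatedE n i A1 A2 A3 B : (i < n)%N ->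
  (ang U \o x i) @^-1` B `&` isolated n i A1 A2 A3 =
  \bigcap_(j in `I_n) (x j @^-1` (if j == i then inS B `&` shell n A1 A2 else beyond n A3)).
Proof.
move=> i_n; apply/seteqP; split => w /=.
  by move=> [wB [wi wj]] j /= jn; case: eqVneq => [->|ji] //=; exact: wj.
move=> h; have := h i i_n; rewrite /= eqxx => -[h1 h2]; split => //; split => //.
by move=> j jn ji; have := h j jn; rewrite /= (negbTE ji).
Qed.

Lemma measurable_isolated n i A1 A2 A3 : (i < n)%N -> measurable (isolated n i A1 A2 A3).
Proof.
move=> i_n; rewrite -[isolated _ _ _ _ _]setTI -(preimage_setT (ang U \o x i)) isolatedE//.
apply: fin_bigcap_measurable => [|j _]; first exact: finite_II.
have m1 : measurable (inS setT `&` shell n A1 A2).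
  by apply: measurableI; [exact: measurable_inS|exact: measurable_shell].
apply: x_rv; case: ifP => _; [exact: m1|exact: measurable_beyond].
Qed.

Lemma isolated_prob n i A1 A2 A3 B : (i < n)%N -> measurable B ->
  P ((ang U \o x i) @^-1` B `&` isolated n i A1 A2 A3) =
  (pr (inS B `&` shell n A1 A2) * pr (beyond n A3) ^+ n.-1)%:E.
Proof.
move=> i_n mB; rewrite isolatedE//.
have m1 : measurable (inS B `&` shell n A1 A2).
  by apply: measurableI; [exact: measurable_inS|exact: measurable_shell].
have m2 := measurable_beyond n A3.
rewrite (x_indep n (A := fun j => if j == i then inS B `&` shell n A1 A2 else beyond n A3)); last first.
  by move=> j; case: ifP.
rewrite (bigD1 (Ordinal i_n))//= eqxx prE// EFinM; congr (_ * _)%E.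
rewrite (eq_bigr (fun=> (pr (beyond n A3))%:E)); last first.
  move=> j ji; rewrite ifF ?prE//; apply: contraNF ji => /eqP ji.
  by apply/eqP/val_inj.
rewrite prodEFin prodr_const; congr (_ ^+ _)%:E.
by rewrite cardC1 card_ord.
Qed.

(** By independence, [n] times the probability is [n] times a difference of two cap masses,
    multiplied by the power [n - 1] of the mass beyond [A + eta]. The cap asymptotics reduce this to
    the right side of [mesh_exists], uniformly in [A], [i] and [B]. *)
Lemma isolated_lower (e : R) (L : nat) : 0 < e -> e < 1 -> (0 < L)%N ->
  exists2 eta0 : R, 0 < eta0 & forall eta : R, 0 < eta -> eta <= eta0 ->
  \forall n \near \oo, forall (A : R) i B, eta <= A -> A <= L%:R -> (i < n)%N -> measurable B ->
  (((1 - e) / n%:R * ((expR (- (A - eta) ^+ m) - expR (- A ^+ m)) * s B))%:E <=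
    P ((ang U \o x i) @^-1` B `&` isolated n i (A - eta) A (A + eta)))%E.
Proof.
move=> e0 e1 L0; have [eta0 eta00 H] := mesh_exists m0 L0 e0 e1.
exists (Num.min eta0 1); first by rewrite lt_min eta00/=.
move=> eta etap; rewrite le_min => /andP[eta_eta0 eta1].
have [e2 /andP[e20 e21] He] := H eta etap eta_eta0.
have n1 := cap_asymptotics (L%:R + 1) e20 e21.
(* For such [n], [(1 + e2) u <= e2], so [1 / (1 - u) <= 1 + e2]. This is one of the two factors
   [1 + e2] in the exponent of [mesh_exists]; the other comes from the cap asymptotics. *)
have n2 : \forall n \near \oo, (1 + e2) / e2 * ((1 + e2) * (L%:R + 1) ^+ m) + 1 <= n%:R.
  exact: nbhs_infty_ger.
near=> n => A i B etaA AL i_n mB.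
have n0 : (0 < n)%N by exact: leq_ltn_trans i_n.
have nR : 0 < n%:R :> R by rewrite ltr0n.
have N1 : forall (A : R) (B : set (BV R m)), 0 <= A -> A <= L%:R + 1 -> measurable B ->
  (1 - e2) * A ^+ m * s B <= n%:R * pr (cap q U (A / c n) B) <= (1 + e2) * A ^+ m * s B by near: n.
have N2 : (1 + e2) / e2 * ((1 + e2) * (L%:R + 1) ^+ m) + 1 <= n%:R by near: n.
rewrite isolated_prob// lee_fin.
have A0 : 0 <= A by rewrite (le_trans (ltW etap)).
have Am0 : 0 <= A - eta by rewrite subr_ge0.
have sB0 := s_ge0 B.
have AL1 : A <= L%:R + 1 by lra.
have /andP[h1 _] := N1 A B A0 AL1 mB.
have /andP[_ h2] : (1 - e2) * (A - eta) ^+ m * s B <= n%:R * pr (cap q U ((A - eta) / c n) B)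
    <= (1 + e2) * (A - eta) ^+ m * s B by apply: N1 => //; lra.
have /andP[_ h3] : (1 - e2) * (A + eta) ^+ m * s setT <= n%:R * pr (cap q U ((A + eta) / c n) setT)
    <= (1 + e2) * (A + eta) ^+ m * s setT by apply: N1 => //; lra.
rewrite sT mulr1 in h3.
have h4 := shell_ge A n0 mB Am0.
have h5 := beyond_ge (A + eta) n0.
set u := pr (cap q U ((A + eta) / c n) setT) in h3 h5.
have u0 : 0 <= u by exact: pr_ge0.
set t := (1 + e2) * (A + eta) ^+ m in h3.
have t0 : 0 <= t by rewrite mulr_ge0 ?exprn_ge0//; lra.
have tL : t <= (1 + e2) * (L%:R + 1) ^+ m.
  by rewrite ler_wpM2l//; [lra|apply: lerXn2r; rewrite ?nnegrE; lra].
have nt : (1 + e2) / e2 * t < n%:R.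
  apply: lt_le_trans N2; rewrite ltr_pwDr// ler_wpM2l//.
  by rewrite divr_ge0//; lra.
have ut : u <= t / n%:R by rewrite ler_pdivlMr// mulrC.
have u_small : (1 + e2) * u <= e2.
  apply: (@le_trans _ _ ((1 + e2) * (t / n%:R))); first by rewrite ler_wpM2l//; lra.
  rewrite mulrA ler_pdivrMr//; move: nt; rewrite mulrAC ltr_pdivrMr// => nt.
  by rewrite mulrC [leRHS]mulrC ltW// mulrC.
have u1 : u < 1.
  rewrite -(ltr_pM2l (_ : 0 < 1 + e2)); lra.
have h6 : expR (- ((1 + e2) ^+ 2 * (A + eta) ^+ m)) <= pr (beyond n (A + eta)) ^+ n.-1.
  apply: (@le_trans _ _ ((1 - u) ^+ n)); last first.
    apply: (@le_trans _ _ (pr (beyond n (A + eta)) ^+ n)).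
      by apply: lerXn2r => //; rewrite nnegrE ?pr_ge0//; lra.
    apply: ler_wiXn2l; [exact: pr_ge0| |exact: leq_pred].
    by apply: pr_le1; exact: measurable_beyond.
  apply: le_trans (expR_ge_onemX n u0 u1); rewrite ler_expR lerN2.
  rewrite mulrA ler_pdivrMr ?subr_gt0//.
  apply: (le_trans h3).
  have -> : (1 + e2) ^+ 2 * (A + eta) ^+ m = (1 + e2) * t by rewrite /t; ring.
  rewrite mulrAC ler_peMl//.
  by rewrite mulrBr mulr1; lra.
have h7 : 0 <= (1 - e) * (expR (- (A - eta) ^+ m) - expR (- A ^+ m)).
  rewrite mulr_ge0//; first lra.
  by rewrite subr_ge0 ler_expR lerN2; apply: lerXn2r; rewrite ?nnegrE//; lra.
rewrite mulrAC mulrA ler_pdivrMr//.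
apply: (@le_trans _ _ (((1 - e2) * A ^+ m - (1 + e2) * (A - eta) ^+ m) *
   expR (- ((1 + e2) ^+ 2 * (A + eta) ^+ m)) * s B)).
  by rewrite ler_wpM2r// He.
have d0 : 0 <= (1 - e2) * A ^+ m - (1 + e2) * (A - eta) ^+ m.
  rewrite -(pmulr_lge0 _ (expR_gt0 (- ((1 + e2) ^+ 2 * (A + eta) ^+ m)))).
  by apply: le_trans (He A etaA AL).
rewrite mulrAC [leRHS]mulrAC ler_pM ?mulr_ge0 ?expR_ge0//.
apply: (@le_trans _ _ (n%:R * (pr (cap q U (A / c n) B) - pr (cap q U ((A - eta) / c n) B)))).
  by rewrite mulrBr mulrBl; lra.
by rewrite mulrC ler_wpM2r.
Unshelve. all: by end_near. Qed.

End Nearest_point.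

(** * Expectation of the total exponential weight *)

Section Weights.
Variables (R : realType) (m : nat) (q : 'cV[R]_m.+1) (U : 'M[R]_(m.+1, m)).
Hypothesis m0 : (0 < m)%N.
Context {dO : measure_display} {Omega : measurableType dO} (P : probability Omega R).
Variable x : nat -> Omega -> 'cV[R]_m.+1.
Hypotheses (x_rv : forall i, random_vector (x i)).
Hypothesis x_id : forall i (A : set 'cV[R]_m.+1), borel A -> P (x i @^-1` A) = P (x 0 @^-1` A).
Hypothesis x_pole : P (x 0 @^-1` [set z | ~~ (0 < rad q z)]) = 0%E.
Variable S : probability (BV R m) R.
Variable C : R.
Hypothesis C0 : 0 < C.
Hypothesis x_cap : forall e : R, 0 < e -> e < 1 -> exists2 y0 : R, 0 < y0 &
  forall (y : R) (B : set (BV R m)), 0 < y -> y <= y0 -> measurable B ->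
  (((1 - e) * C * y ^+ m)%:E * S B <= P (x 0 @^-1` cap q U y B))%E /\
  (P (x 0 @^-1` cap q U y B) <= ((1 + e) * C * y ^+ m)%:E * S B)%E.
Variable c : nat -> R.
Hypothesis c_gt0 : forall n, (0 < n)%N -> 0 < c n.
Hypothesis cX : forall n, c n ^+ m = C * n%:R.

Local Notation prx := (pr P x).

Let near_set (y : R) : set (BV R m.+1) := [set z | rad q z <= y].

Let measurable_near_set y : measurable (near_set y).
Proof. by apply: measurable_ler => //; exact: measurable_rad. Qed.

(** For [y <= y0] this is the cap bound with [e = 1 / 2]; for larger [y] the probability is at most
    [1 <= (y / y0) ^ m]. A bound at every scale is needed because the layers below are not confined
    to a neighbourhood of [q]. *)
Lemma near_set_le : exists2 K : R, 0 < K & forall y, 0 < y -> prx (near_set y) <= K * y ^+ m.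
Proof.
have h12 : 0 < 1 / 2 :> R by [].
have h121 : 1 / 2 < 1 :> R by lra.
have [y0 y00 H] := x_cap h12 h121.
have y0m : 0 < y0 ^- m by rewrite invr_gt0 exprn_gt0.
exists ((1 + 1 / 2) * C + y0 ^- m) => [|y yp]; first by rewrite addr_gt0// mulr_gt0//; lra.
have ym : 0 < y ^+ m by exact: exprn_gt0.
have [yy0|yy0] := leP y y0; last first.
  apply: (le_trans (pr_le1 x_rv x_id (measurable_near_set y))).
  rewrite mulrDl ler_wpDl//; first by rewrite !mulr_ge0// ?ltW//; lra.
  rewrite mulrC ler_pdivlMr ?exprn_gt0// mul1r.
  by apply: lerXn2r; rewrite ?nnegrE ltW.
have mC : measurable (cap q U y setT) by exact: measurable_cap.
have mp : measurable ([set z | ~~ (0 < rad q z)] : set (BV R m.+1)).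
  rewrite (_ : [set z | _] = ~` [set z | 0 < rad q z]).
    by apply: measurableC; apply: measurable_ltr => //; exact: measurable_rad.
  by apply/seteqP; split => z /= /negP.
apply: (@le_trans _ _ (prx (cap q U y setT `|` [set z | ~~ (0 < rad q z)]))).
  apply: (pr_le x_rv x_id) => //; first exact: measurableU.
  by move=> z zy; have [z0|z0] := boolP (0 < rad q z); [left|right].
apply: (le_trans (prU_le x_rv x_id mC mp)).
rewrite [X in _ + X](_ : _ = 0) ?addr0; last by rewrite /pr x_pole.
have [_] := H y setT yp yy0 (@measurableT _ _); rewrite probability_setT mule1 (prE x_rv x_id 0)// lee_fin.
move/le_trans; apply; rewrite ler_wpM2r ?(ltW ym)//.
by rewrite lerDl ltW.
Qed.

(** A layer decomposition by the integer part of [r], truncated at [N]; beyond the truncation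
    [exp (- r)] is at most [exp (- N)]. *)
Lemma expR_le_layers (r : R) N : 0 <= r ->
  expR (- r) <= \sum_(k < N) expR (- k%:R) * (r <= k.+1%:R)%R%:R + expR (- N%:R).
Proof.
move=> r0; have [rN|rN] := leP N%:R r.
  apply: ler_wpDl; last by rewrite ler_expR lerN2.
  by apply: sumr_ge0 => k _; apply: mulr_ge0; rewrite ?expR_ge0.
have kN : (Num.truncn r < N)%N.
  by rewrite -(ltr_nat R) (le_lt_trans _ rN)// truncn_le.
rewrite (bigD1 (Ordinal kN))//= (ltW (truncnS_gt _))/= mulr1 -addrA ler_wpDr//; last first.
  by rewrite ler_expR lerN2 truncn_le.
apply: addr_ge0; rewrite ?expR_ge0//.
by apply: sumr_ge0 => k _; apply: mulr_ge0; rewrite ?expR_ge0.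
Qed.

(** Each point contributes [O (1 / n)], since the layer at [k] has probability at most [K ((k + 1) /
    c n) ^ m = (K / C) (k + 1) ^ m / n]. Truncating at [n] layers costs [n exp (- n) <= 1] in total,
    whence the [+ 1]. *)
Lemma weight_integral_bound : exists2 B : R, 0 < B & forall n, (0 < n)%N ->
  (\int[P]_w (\sum_(j < n) expR (- (c n * rad q (x j w))))%:E <= B%:E)%E.
Proof.
have [K K0 HK] := near_set_le.
have [B B0 HB] := sum_expR_poly_bound R m.
exists (K / C * B + 1) => [|n n0]; first by rewrite addr_gt0// mulr_gt0// divr_gt0.
have cn0 := c_gt0 n0.
have nR : 0 < n%:R :> R by rewrite ltr0n.
have mrad j : measurable_fun [set: Omega] (fun w => rad q (x j w)).
  exact: (measurableT_comp (@measurable_rad R m q) (measurable_rv (x_rv j))).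
have mexp j : measurable_fun [set: Omega] (fun w => expR (- (c n * rad q (x j w)))).
  apply: measurableT_comp => //; apply: measurableT_comp => //.
  exact: measurable_funM.
have one j : (\int[P]_w (expR (- (c n * rad q (x j w))))%:E <= (K / C * B / n%:R + expR (- n%:R))%:E)%E.
  have mset k : measurable (x j @^-1` near_set (k.+1%:R / c n)).
    exact: (x_rv j (measurable_near_set _)).
  apply: (@le_trans _ _ (\int[P]_w ((\sum_(k < n)
      (expR (- k%:R))%:E * (\1_(x j @^-1` near_set (k.+1%:R / c n)) w)%:E) + (expR (- n%:R))%:E))%E).
    apply: ge0_integral_le => w; first by rewrite lee_fin expR_ge0.
    have r0 : 0 <= c n * rad q (x j w) by rewrite mulr_ge0 ?rad_ge0// ltW.
    under eq_bigr do rewrite -EFinM.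
    rewrite sumEFin -EFinD lee_fin (le_trans (expR_le_layers n r0))// lerD2r.
    apply: ler_sum => k _; rewrite ler_wpM2l ?expR_ge0// indicE ler_nat.
    case: leP => // rk; rewrite mem_set//= /near_set/=.
    by rewrite ler_pdivlMr// mulrC.
  rewrite ge0_integralD//=; last 2 first.
  - move=> w _; apply: sume_ge0 => k _.
    by rewrite -EFinM lee_fin mulr_ge0 ?expR_ge0.
  - apply: emeasurable_sum => k; apply: emeasurable_funM => //.
    exact: measurable_indic_EFin.
  rewrite integral_cst//= probability_setT mule1 EFinD leeD2r//.
  rewrite ge0_integral_sum//; last first.
    by move=> k; apply: emeasurable_funM => //; exact: measurable_indic_EFin.
  rewrite (eq_bigr (fun k : 'I_n => (expR (- k%:R) * prx (near_set (k.+1%:R / c n)))%:E)); last first.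
    move=> k _; rewrite ge0_integralZl//; last exact: measurable_indic_EFin.
    by rewrite integral_indic// setIT EFinM; congr (_ * _)%E; exact: (prE x_rv x_id j (measurable_near_set _)).
  rewrite sumEFin lee_fin.
  apply: (@le_trans _ _ (\sum_(k < n) (K / C / n%:R) * (expR (- k%:R) * k.+1%:R ^+ m))).
    apply: ler_sum => k _; rewrite mulrCA ler_wpM2l ?expR_ge0//.
    apply: (le_trans (HK _ _)); first by rewrite divr_gt0.
    rewrite expr_div_n cX le_eqVlt; apply/orP; left; apply/eqP.
    by field; rewrite ?gt_eqF.
  rewrite -mulr_sumr mulrAC ler_wpM2r ?invr_ge0 ?(ltW nR)//.
  by rewrite ler_wpM2l// divr_ge0// ltW.
under eq_integral do rewrite -sumEFin.
rewrite ge0_integral_sum//; last by move=> j; exact/measurable_EFinP.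
apply: (@le_trans _ _ (\sum_(j < n) (K / C * B / n%:R + expR (- n%:R))%:E)%E).
  by apply: lee_sum => j _; exact: one.
rewrite sumEFin lee_fin sumr_const card_ord -[leLHS]mulr_natl mulrDr.
apply: lerD; first by rewrite mulrC divfK// gt_eqF.
rewrite expRN ler_pdivrMr ?expR_gt0// mul1r.
by apply: le_trans (expR_ge1Dx _); rewrite lerDr.
Qed.

End Weights.

Section Integral_helpers.
Local Open Scope ereal_scope.
Context d (T : measurableType d) (R : realType) (mu : probability T R).

Lemma integral_add_error (g : T -> \bar R) (h : T -> R) (a k : R) :
  (0 <= a)%R -> (0 <= k)%R -> (forall x, 0 <= g x) -> measurable_fun setT g ->
  (forall x, (0 <= h x)%R) -> measurable_fun setT h ->
  \int[mu]_x (g x + (a + k * h x)%:E) = \int[mu]_x g x + (a%:E + k%:E * \int[mu]_x (h x)%:E).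
Proof.
move=> a0 k0 g0 mg h0 mh.
have mh' : measurable_fun setT (fun x => (h x)%:E) by exact/measurable_EFinP.
have mkh : measurable_fun setT (fun x => (a + k * h x)%:E).
  apply/measurable_EFinP; apply: measurable_funD => //; exact: measurable_funM.
rewrite ge0_integralD//; last by move=> x _; rewrite lee_fin addr_ge0// mulr_ge0.
congr (_ + _); under eq_integral do rewrite EFinD EFinM.
rewrite ge0_integralD//; last 2 first.
- by move=> x _; rewrite mule_ge0// lee_fin.
- exact: measurable_funeM.
by rewrite integral_cst//= probability_setT mule1 ge0_integralZl// => x _; rewrite lee_fin.
Qed.

Lemma integral_sum_patch (I : finType) (E : I -> set T) (g : I -> T -> \bar R) :
  (forall i, measurable (E i)) -> (forall i, measurable_fun setT (g i)) ->
  (forall i x, 0 <= g i x) ->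
  \int[mu]_x (\sum_i ((g i) \_ (E i)) x) = \sum_i \int[mu]_(x in E i) g i x.
Proof.
move=> mE mg g0; rewrite ge0_integral_sum//.
- by apply: eq_bigr => i _; rewrite -integral_mkcond.
- by move=> i; apply/(measurable_restrictT _ (mE i)).1; exact: measurable_funTS.
- by move=> i x _; apply: erestrict_ge0.
Qed.

End Integral_helpers.

Section Attention_measurable.
Variables (R : realType) (m : nat) (q : 'cV[R]_m.+1) (V : 'M[R]_m.+1).
Context {dO : measure_display} {Omega : measurableType dO}.
Variables (x : nat -> Omega -> 'cV[R]_m.+1) (beta : nat -> R).
Hypothesis x_rv : forall i, random_vector (x i).

Lemma measurable_Yn n : measurable_fun [set: Omega] (Yn q V x beta n : Omega -> BV R m.+1).
Proof.
have mx j := measurable_rv (x_rv j).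
have mT j : measurable_fun [set: Omega] (fun w => expR (- beta n * Tsc q x j w)).
  apply: measurableT_comp => //; apply: measurable_funM => //; apply: measurable_funB => //.
  by apply: (@measurable_dotv R _ _ m.+1 (fun=> q) (x j)).
have mZ : measurable_fun [set: Omega] (Zsum q x beta n) by apply: measurable_sum => j; exact: mT.
have mA j : measurable_fun [set: Omega] (Aw q x beta n j).
  apply: measurable_funM; first exact: mT.
  rewrite (_ : (fun w => _) = (fun w => Zsum q x beta n w `^ (-1))).
    exact: (measurableT_comp (measurable_powR _) mZ).
  apply/funext => w; rewrite powR_inv1//; by apply: sumr_ge0 => k _; exact: expR_ge0.
apply: (measurableT_comp (measurable_mulmx V)).
apply: measurable_to_BV => i; under eq_fun do rewrite summxE.
apply: measurable_sum => j; under eq_fun do rewrite !mxE.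
apply: measurable_funM; first exact: mA.
apply: measurable_funB => //; exact: (measurableT_comp (measurable_coord i) (mx j)).
Qed.

End Attention_measurable.

(** The equation [U U^T z = z] says that [z] lies in the image of [U], so that [z] can be recovered
    from its coordinates [U^T z]. *)
Lemma measurable_tangent_sphere (R : realType) m (U : 'M[R]_(m.+1, m)) :
  measurable ([set z | U *m (U^T *m z) = z /\ enorm z = 1] : set (BV R m.+1)).
Proof.
have h : measurable ([set z | U *m (U^T *m z) = z] : set (BV R m.+1)).
  rewrite (_ : [set z | _] = [set z | enorm (U *m (U^T *m z) - z) <= 0]).
    apply: measurable_ler => //; apply: (measurableT_comp (@measurable_enorm R m.+1)).
    apply: measurable_to_BV => i; under eq_fun do rewrite !mxE.
    apply: measurable_funB; last exact: measurable_coord.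
    apply: measurable_sum => j; apply: measurable_funM => //.
    exact: (measurableT_comp (measurable_coord j) (measurable_mulmx U^T)).
  apply/seteqP; split => z /=; first by move=> ->; rewrite subrr -(scale0r 0) enormZ normr0 mul0r.
  move=> h; apply/eqP; rewrite -subr_eq0 -enorm_eq0 eq_le h; exact: enorm_ge0.
exact: (measurableI _ _ h (@measurable_sphere R m)).
Qed.

(** * The lower bound for nonnegative test functions *)

Section Lower_bound.
Variables (R : realType) (m : nat) (q : 'cV[R]_m.+1) (U : 'M[R]_(m.+1, m)).
Hypotheses (UU : U^T *m U = 1%:M) (Uq : U^T *m q = 0) (q1 : enorm q = 1) (m0 : (0 < m)%N).
Context {dO : measure_display} {Omega : measurableType dO} (P : probability Omega R).
Variable x : nat -> Omega -> 'cV[R]_m.+1.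
Hypotheses (x_rv : forall i, random_vector (x i)) (x_indep : mutually_independent P x).
Hypothesis x_id : forall i (A : set 'cV[R]_m.+1), borel A -> P (x i @^-1` A) = P (x 0 @^-1` A).
Hypothesis x_sphere : P (x 0 @^-1` [set z | enorm z <> 1]) = 0%E.
Hypothesis x_pole : P (x 0 @^-1` [set z | ~~ (0 < rad q z)]) = 0%E.
Variable S : probability (BV R m) R.
Variable C : R.
Hypothesis C0 : 0 < C.
Hypothesis x_cap : forall e : R, 0 < e -> e < 1 -> exists2 y0 : R, 0 < y0 &
  forall (y : R) (B : set (BV R m)), 0 < y -> y <= y0 -> measurable B ->
  (((1 - e) * C * y ^+ m)%:E * S B <= P (x 0 @^-1` cap q U y B))%E /\
  (P (x 0 @^-1` cap q U y B) <= ((1 + e) * C * y ^+ m)%:E * S B)%E.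
Variable c : nat -> R.
Hypothesis c_gt0 : forall n, (0 < n)%N -> 0 < c n.
Hypothesis cX : forall n, c n ^+ m = C * n%:R.
Hypothesis c_oo : c n @[n --> \oo] --> +oo.
Variables (beta : nat -> R) (V : 'M[R]_m.+1).
Hypothesis beta_oo : beta n / c n ^+ 2 @[n --> \oo] --> +oo.

Context {dW : measure_display} {W : measurableType dW} (Q : probability W R).
Variables (R1 : W -> R) (Th : W -> 'cV[R]_m.+1).
Hypothesis R1_meas : measurable_fun setT R1.
Hypothesis R1_law : forall A : R, 0 <= A -> Q [set w | A ^+ 2 < R1 w] = (expR (- A ^+ m))%:E.
Hypothesis Th_rv : random_vector Th.
Hypothesis Th_good : Q (Th @^-1` ~` [set z | U *m (U^T *m z) = z /\ enorm z = 1]) = 0%E.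
Hypothesis Th_law : forall B, measurable B -> S B = Q ((fun w => U^T *m Th w : BV R m) @^-1` B).
Hypothesis R1Th_indep : independent2 Q R1 Th.

Let Thu (w : W) : BV R m := U^T *m Th w.

Let mThu : measurable_fun [set: W] Thu.
Proof. exact: (measurableT_comp (measurable_mulmx U^T) (measurable_rv Th_rv)). Qed.

(** For [0 <= A1 <= A2], the event that [sqrt R1] lies in []A1, A2]]; [sqrt R1] plays the role of
    the smallest [c_n rad x_j]. *)
Let shellQ (A1 A2 : R) : set W := [set w | A1 ^+ 2 < R1 w /\ R1 w <= A2 ^+ 2].

Let mR1gt (a : R) : measurable [set w | a < R1 w].
Proof. exact: measurable_ltr. Qed.

Let mshellQ A1 A2 : measurable (shellQ A1 A2).
Proof.
by apply: measurableI; [exact: mR1gt|exact: (measurable_ler R1_meas (measurable_cst _))].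
Qed.

Let shellQ_prob A1 A2 : 0 <= A1 -> A1 <= A2 ->
  Q (shellQ A1 A2) = (expR (- A1 ^+ m) - expR (- A2 ^+ m))%:E.
Proof.
move=> A10 A12; have A20 : 0 <= A2 := le_trans A10 A12.
have -> : shellQ A1 A2 = [set w | A1 ^+ 2 < R1 w] `\` [set w | A2 ^+ 2 < R1 w].
  apply/seteqP; split => w /= [h1 h2]; split => //; first by rewrite ltNge h2.
  by rewrite leNgt; exact/negP.
have oo : (Q [set w | (A1 ^+ 2 < R1 w)%R] < +oo)%E by rewrite R1_law// ltry.
apply: (etrans (measureD (mR1gt _) (mR1gt _) oo)).
rewrite setIidr; last by move=> w /=; apply: le_lt_trans; apply: lerXn2r.
by rewrite EFinB; congr (_ - _)%E; exact: R1_law.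
Qed.

Let shellQ_indep A1 A2 B : measurable B ->
  Q (Thu @^-1` B `&` shellQ A1 A2) = (Q (shellQ A1 A2) * S B)%E.
Proof.
move=> mB; rewrite Th_law//.
have -> : shellQ A1 A2 = R1 @^-1` `]A1 ^+ 2, A2 ^+ 2]%classic.
  apply/seteqP; split => w /=; rewrite in_itv/=; first by move=> [-> ->].
  by move=> /andP[].
rewrite setIC; apply: (@R1Th_indep _ [set z | B (U^T *m z : BV R m)]).
  exact: measurable_itv.
have h : measurable ([set z | B (U^T *m z : BV R m)] : set (BV R m.+1)).
  apply: (@measurable_preimageT _ _ _ _ (fun z : BV R m.+1 => U^T *m z : BV R m)) => //.
  exact: measurable_mulmx.
exact: h.
Qed.

Let norm_ang_le1 z : `|U *m ang U z| <= 1.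
Proof.
apply: le_trans (norm_le_enorm _) _; rewrite enorm_isometry//.
rewrite /ang; set v : BV R m := U^T *m z.
have [vp|vn] := ltP 0 (enorm v); first by rewrite enorm_dir.
by rewrite enormZ [enorm v](_ : _ = 0) ?mulr0//; apply/le_anti; rewrite vn enorm_ge0.
Qed.

Variables (f : 'cV[R]_m.+1 -> R) (M : R).
Hypotheses (fc : continuous f) (f0 : forall z, 0 <= f z) (fM : forall z, f z <= M).

Let mf : measurable_fun [set: BV R m.+1] (f : BV R m.+1 -> R).
Proof. exact: continuous_measurable_BV_real. Qed.

Let G (A : R) (th : BV R m) : R := f (V *m ((Num.sqrt 2 * A) *: (U *m th))).

Let mG A : measurable_fun [set: BV R m] (G A).
Proof.
apply: (measurableT_comp mf); apply: (measurableT_comp (measurable_mulmx V)).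
exact: (measurableT_comp (@measurable_scale_BV R m.+1 _) (measurable_mulmx U)).
Qed.

Let mGE A : measurable_fun [set: BV R m] (fun th => (G A th)%:E).
Proof. exact/measurable_EFinP. Qed.

Let M0 : 0 <= M. Proof. exact: le_trans (f0 0) (fM 0). Qed.

Let Phi (w : W) : 'cV[R]_m.+1 := Num.sqrt (2 * R1 w) *: Th w.

(** With [eta = 1 / (N + 1)] the nodes for [k < L (N + 1)] are [eta, 2 eta, ..., L]; cell [k] ends
    at its node, and the first one starts at 0. *)
Let grid (N k : nat) : R := k.+1%:R / N.+1%:R.

(* Discretising [sqrt R1] on the grid costs [e] by uniform continuity, and another [e] for the
   tail [sqrt R1 > L]. *)
Let limit_side (e del K : R) (L N : nat) :
  0 < e -> (0 < L)%N -> 0 < K -> (forall u : 'cV[R]_m.+1, `|V *m u| <= K * `|u|) ->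
  (forall z1 z2, `|z1| <= K * (Num.sqrt 2 * L%:R) -> `|z1 - z2| <= del -> `|f z1 - f z2| <= e) ->
  K * (Num.sqrt 2 * N.+1%:R^-1) <= del -> M / L%:R <= e ->
  (\int[Q]_w (f (V *m Phi w))%:E <=
   \sum_(k < L * N.+1) \int[Q]_(w in shellQ (grid N k - N.+1%:R^-1) (grid N k)) (G (grid N k) (Thu w))%:E +
   (2 * e)%:E)%E.
Proof.
move=> e0 L0 K0 HV Hf Hdel ML; set A := grid N.
set eta : R := N.+1%:R^-1 in Hdel *.
have etap : 0 < eta by rewrite invr_gt0.
have LR : 1 <= L%:R :> R by rewrite ler1n.
pose b1 := [set w | L%:R ^+ 2 < R1 w].
pose b2 := ~` [set w | (0:R) ^+ 2 < R1 w].
pose b3 := Th @^-1` ~` [set z | U *m (U^T *m z) = z /\ enorm z = 1].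
(* The tail [b1] has probability [exp (- L ^ m)]; [b2] and [b3] are null. Off [bad], [sqrt R1] falls
   in a cell of the grid and [U U^T Th = Th]. *)
pose bad := b1 `|` (b2 `|` b3).
have mb1 : measurable b1 by exact: mR1gt.
have mb2 : measurable b2 by apply: measurableC; exact: mR1gt.
have mb3 : measurable b3 by exact: (Th_rv (measurableC (measurable_tangent_sphere U))).
have mbad : measurable bad by apply: measurableU => //; exact: measurableU.
have Qbad : (Q bad <= (expR (- L%:R ^+ m))%:E)%E.
  have Q0 : Q b2 = 0%E.
    by rewrite probability_setC// R1_law// expr0n eqn0Ngt m0 oppr0 expR0 subee.
  apply: (@le_trans _ _ (Q b1 + Q (b2 `|` b3))%E).
    by apply: measureU2 => //; exact: measurableU.
  rewrite R1_law// -[leRHS]adde0 leeD2l//.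
  apply: (@le_trans _ _ (Q b2 + Q b3)%E); first exact: measureU2.
  by rewrite Q0 add0e /b3 Th_good.
pose g (k : 'I_(L * N.+1)) w := (G (A k) (Thu w))%:E.
have mg k : measurable_fun setT (g k) by exact: (measurableT_comp (mGE _) mThu).
have g0 k w : (0 <= g k w)%E by rewrite lee_fin; exact: f0.
have step : (\int[Q]_w (f (V *m Phi w))%:E <= \int[Q]_w
    ((\sum_(k < L * N.+1) (g k \_ (shellQ (A k - eta) (A k))) w) + (e + M * \1_bad w)%:E))%E.
  apply: ge0_integral_le => w; first by rewrite lee_fin.
  have [wb|wb] := pselect (bad w).
    rewrite indicE mem_set// mulr1 -[leLHS]add0e leeD//.
      by apply: sume_ge0 => k _; apply: erestrict_ge0.
    by rewrite lee_fin (le_trans (fM _))// lerDr ltW.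
  rewrite indicE memNset// mulr0 addr0.
  have [R1L [R1p [Thd Th1]]] : R1 w <= L%:R ^+ 2 /\ 0 < R1 w /\ (U *m (U^T *m Th w) = Th w /\ enorm (Th w) = 1).
    split; first by rewrite leNgt; apply/negP => h; apply: wb; left; rewrite /b1/=.
    split; first by rewrite ltNge; apply/negP => h; apply: wb; right; left; rewrite /b2/= expr0n/= ltNge h.
    by apply: contrapT => h; apply: wb; right; right.
  set t := Num.sqrt (R1 w).
  have t0 : 0 < t by rewrite sqrtr_gt0.
  have t2 : t ^+ 2 = R1 w by rewrite sqr_sqrtr// ltW.
  have tL : t <= L%:R by rewrite -(@ler_pXn2r _ 2)// ?nnegrE ?ler0n ?(ltW t0)// t2.
  have LN0 : (0 < L * N.+1)%N by rewrite muln_gt0 L0.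
  have AK : A (L * N.+1).-1 = L%:R by rewrite /A /grid prednK// natrM mulfK.
  have ex : exists k, t <= A k by exists (L * N.+1).-1; rewrite AK.
  (* The least node above [t] determines the cell containing [t]. *)
  case: (ex_minnP ex) => k tk kmin.
  have kK : (k < L * N.+1)%N by rewrite -(ltn_predK LN0) ltnS; apply: kmin; rewrite AK.
  have Ak1 : A k - eta = k%:R / N.+1%:R by rewrite /A /grid -natr1 mulrDl mul1r addrK.
  have tk1 : A k - eta < t.
    rewrite Ak1; case: k {tk kK Ak1} kmin => [|k] kmin; first by rewrite mul0r.
    by rewrite ltNge; apply/negP => h; have := kmin k h; rewrite ltnn.
  have Ak0 : 0 <= A k - eta by rewrite Ak1 divr_ge0.
  have AkL : A k <= L%:R by rewrite -AK ler_pM2r// ler_nat ltnS -ltnS (ltn_predK LN0).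
  have Akp : 0 <= A k by rewrite (le_trans (ltW t0)).
  rewrite (bigD1 (Ordinal kK))//= patchE mem_set; last first.
    split; rewrite -t2 /=; first by rewrite ltr_pXn2r// nnegrE ltW.
    by rewrite ler_pXn2r// nnegrE ltW.
  rewrite -addeA addeCA -[leLHS]add0e leeD//.
    by apply: sume_ge0 => i _; apply: erestrict_ge0.
  rewrite -EFinD lee_fin /G /Thu Thd.
  have Thn : `|Th w| <= 1 by rewrite -Th1 norm_le_enorm.
  have h : `|f (V *m ((Num.sqrt 2 * A k) *: Th w)) - f (V *m Phi w)| <= e.
    apply: Hf.
      apply: (le_trans (HV _)); rewrite ler_pM2l// normrZ.
      rewrite ger0_norm ?mulr_ge0 ?sqrtr_ge0//.
      apply: (@le_trans _ _ (Num.sqrt 2 * A k)); first by rewrite ler_piMr ?mulr_ge0 ?sqrtr_ge0.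
      by rewrite ler_wpM2l ?sqrtr_ge0.
    rewrite -mulmxBr; apply: le_trans Hdel; apply: (le_trans (HV _)); rewrite ler_pM2l//.
    rewrite /Phi sqrtrM// -/t -scalerBl -mulrBr normrZ.
    rewrite ger0_norm; last by rewrite mulr_ge0 ?sqrtr_ge0// subr_ge0.
    apply: (@le_trans _ _ (Num.sqrt 2 * (A k - t))).
      by rewrite ler_piMr ?mulr_ge0 ?sqrtr_ge0// subr_ge0.
    by rewrite ler_wpM2l ?sqrtr_ge0//; lra.
  move: h; rewrite ler_norml => /andP[h _]; lra.
apply: (le_trans step).
rewrite integral_add_error//; last 3 first.
- exact: ltW.
- by move=> w; apply: sume_ge0 => k _; apply: erestrict_ge0.
- apply: emeasurable_sum => k; apply/(measurable_restrictT _ (mshellQ _ _)).1.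
  exact: measurable_funTS.
rewrite integral_sum_patch// leeD2l// integral_indic// setIT.
apply: (@le_trans _ _ (e%:E + M%:E * (expR (- L%:R ^+ m))%:E)%E).
  by rewrite leeD2l// lee_wpmul2l// lee_fin.
rewrite -EFinM -EFinD lee_fin (_ : 2 * e = e + e); last by ring.
(* Here [exp (- L ^ m) <= 1 / L], since [exp (L ^ m) >= L ^ m >= L]. *)
rewrite lerD2l (le_trans _ ML)// ler_wpM2l// expRN lef_pV2 ?posrE ?expR_gt0//; last lra.
apply: le_trans (expR_ge1Dx _); apply: (@le_trans _ _ (L%:R ^+ m)); last by rewrite lerDr.
by case: (m) m0 => // k _; rewrite exprS ler_peMr// ?exprn_ege1//; lra.
Qed.

Let iso (n N i k : nat) : set Omega :=
  isolated q x c n i (grid N k - N.+1%:R^-1) (grid N k) (grid N k + N.+1%:R^-1).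

(** If [i] and [i'] differ, each of the two radii exceeds the node above the other by [eta], so each
    node would exceed the other. If they agree, the cells are disjoint unless [k = k']. *)
Let iso_inj n N i i' k k' w : (i < n)%N -> (i' < n)%N ->
  iso n N i k w -> iso n N i' k' w -> i = i' /\ k = k'.
Proof.
move=> i_n i_n'.
have eta0 : 0 < N.+1%:R^-1 :> R by rewrite invr_gt0.
move=> [[_ [a1 a2]] b] [[_ [a1' a2']] b'].
have [ii|ii] := eqVneq i i'; last first.
  have [_ h] := b i' i_n' (contra_neq (@esym _ _ _) ii).
  have [_ h'] := b' i i_n ii.
  have hh : grid N k + N.+1%:R^-1 < grid N k' by exact: lt_le_trans a2'.
  have hh' : grid N k' + N.+1%:R^-1 < grid N k by exact: lt_le_trans a2.
  have := ltrD hh hh'; rewrite addrACA [ltRHS]addrC gtrDl -mulr2n pmulrn_llt0//.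
  by rewrite ltNge ltW.
split => //; rewrite -ii in a1' a2'.
have h1 : grid N k - N.+1%:R^-1 < grid N k' by exact: lt_le_trans a2'.
have h2 : grid N k' - N.+1%:R^-1 < grid N k by exact: lt_le_trans a2.
have gE j : grid N j - N.+1%:R^-1 = j%:R / N.+1%:R by rewrite /grid -natr1 mulrDl mul1r addrK.
rewrite gE ltr_pM2r// ltr_nat ltnS in h1.
rewrite gE ltr_pM2r// ltr_nat ltnS in h2.
by apply/eqP; rewrite eqn_leq h1.
Qed.

(** At most one term of the sum is nonzero. The budget [del] is split in three: the grid cell, the
    errors of [tangent_approx] that vanish with [c n], and the influence of the other points. *)
Let pointwise_bound (e del K : R) (L N n : nat) (w : Omega) :
  0 < e -> 0 < del -> (0 < n)%N -> 0 < K -> (forall u : 'cV[R]_m.+1, `|V *m u| <= K * `|u|) ->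
  (forall z1 z2, `|z1| <= K * (Num.sqrt 2 * L%:R) -> `|z1 - z2| <= del -> `|f z1 - f z2| <= e) ->
  K * (Num.sqrt 2 * N.+1%:R^-1) <= del / 3 ->
  L%:R <= c n -> K * (L%:R ^+ 3 / c n ^+ 2 + L%:R ^+ 2 / c n) <= del / 3 ->
  2 <= beta n / c n ^+ 2 * N.+1%:R^-1 ->
  \sum_(p : 'I_(L * N.+1) * 'I_n)
    ((fun w => G (grid N p.1) (ang U (x p.2 w))) \_ (iso n N p.2 p.1)) w <=
  f (c n *: Yn q V x beta n w) + (e + M * (3 / del) * K * (2 * Num.sqrt 2) *
    expR (- (beta n / c n ^+ 2 * N.+1%:R^-1 - 2) * N.+1%:R^-1) *
    \sum_(j < n) expR (- (c n * rad q (x j w)))).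
Proof.
move=> e0 del0 n0 K0 HV Hf Hdel Lc cL b2.
have cn0 := c_gt0 n0.
set eta : R := N.+1%:R^-1 in Hdel b2 *.
have eta0 : 0 < eta by rewrite invr_gt0.
set kap := expR (- _ * _); set Wt := \sum_(j < n) expR _.
have Wt0 : 0 <= Wt by apply: sumr_ge0 => j _; exact: expR_ge0.
have kap0 : 0 <= kap by exact: expR_ge0.
have s20 : (0:R) <= Num.sqrt 2 by exact: sqrtr_ge0.
have d30 : 0 <= 3 / del by rewrite divr_ge0// ltW.
have T0 : 0 <= M * (3 / del) * K * (2 * Num.sqrt 2) * kap * Wt.
  have K0' := ltW K0; by do !apply: mulr_ge0 => //.
have [[[k i]] /= isow|noiso] := pselect (exists p : 'I_(L * N.+1) * 'I_n, iso n N p.2 p.1 w); last first.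
  rewrite big1 ?addr_ge0 ?f0 ?(ltW e0)// => p _; rewrite patchE memNset// => h.
  by apply: noiso; exists p.
rewrite (bigD1 (k, i))//= big1 ?addr0; last first.
  move=> [k' i'] /eqP pne /=; rewrite patchE memNset// => h; apply: pne.
  have [h1 h2] := iso_inj (ltn_ord i') (ltn_ord i) h isow.
  by congr pair; exact/val_inj.
rewrite patchE mem_set//.
have [[x1 [Rl Ru]] far] := isow.
have sph j : (j < n)%N -> enorm (x j w) = 1.
  by move=> jn; have [->//|ji] := eqVneq j i; have [] := far j jn ji.
have Rfar j : (j < n)%N -> j != i -> grid N k + eta < c n * rad q (x j w).
  by move=> jn ji; have [] := far j jn ji.
have near1 := nearest_dominates q1 (ltn_ord i) cn0 eta0 b2 sph Ru Rfar.
have gL : grid N k <= L%:R.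
  by rewrite /grid ler_pdivrMr// -natrM ler_nat; exact: ltn_ord.
have near2 := tangent_approx q1 UU Uq x1 cn0 (ltW Rl) Ru gL Lc.
rewrite -/kap -/Wt in near1.
(* A pointwise form of Markov's inequality: if the influence of the other points exceeds [del / 3],
   multiplying it by [3 / del] gives at least 1, and [M] times that dominates the left side. *)
have [big|small] := leP (del / 3) (K * (2 * Num.sqrt 2 * kap * Wt)).
  apply: (le_trans (fM _)); rewrite addrCA -[leLHS]add0r lerD//; first exact: ltW.
  rewrite -[leLHS]add0r lerD ?f0//.
  have -> : M * (3 / del) * K * (2 * Num.sqrt 2) * kap * Wt =
    M * (3 / del * (K * (2 * Num.sqrt 2 * kap * Wt))) by ring.
  rewrite -[leLHS]mulr1 ler_wpM2l// mulrAC ler_pdivlMr// mul1r; lra.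
have g0 : 0 <= grid N k by rewrite divr_ge0.
have h : `|f (V *m ((Num.sqrt 2 * grid N k) *: (U *m ang U (x i w)))) - f (c n *: Yn q V x beta n w)| <= e.
  apply: Hf.
    apply: (le_trans (HV _)); rewrite ler_pM2l// normrZ ger0_norm ?mulr_ge0//.
    apply: (@le_trans _ _ (Num.sqrt 2 * grid N k)); first by rewrite ler_piMr ?mulr_ge0.
    by rewrite ler_wpM2l.
  set Sm := c n *: \sum_(i0 < n) _ in near1.
  have -> : c n *: Yn q V x beta n w = V *m Sm by rewrite /Sm /Yn scalemxAr.
  rewrite -mulmxBr; apply: (le_trans (HV _)).
  set y := c n *: (x i w - q) in near1 near2.
  have tri : `|(Num.sqrt 2 * grid N k) *: (U *m ang U (x i w)) - Sm| <=
      2 * Num.sqrt 2 * kap * Wt + (L%:R ^+ 3 / c n ^+ 2 + Num.sqrt 2 * eta + L%:R ^+ 2 / c n).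
    rewrite -(subrKA y) (le_trans (ler_normD _ _))// addrC lerD// distrC//.
  apply: (le_trans (ler_wpM2l (ltW K0) tri)).
  move: small Hdel cL; rewrite !mulrDr; lra.
move: h; rewrite ler_norml => /andP[_ h].
by rewrite /G addrA -[leLHS]addr0 lerD// -lerBlDl.
Qed.

Let miso n N (i : 'I_n) k : measurable (iso n N i k).
Proof. exact: (measurable_isolated q U x_rv c _ _ _ (ltn_ord i)). Qed.

Let mang i : measurable_fun [set: Omega] (fun w => ang U (x i w)).
Proof. exact: (measurableT_comp (measurable_ang U) (measurable_rv (x_rv i))). Qed.

(** The parameters are chosen in the order [L] (tail), [del] (uniform continuity at scale [L]), [N]
    (mesh), [n]. Of the error [4 e], half arises on the sample side and half in the discretisation
    of the limit. *)
Lemma lower_bound (e : R) : 0 < e -> e < 1 -> \forall n \near \oo,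
  ((1 - e)%:E * \int[Q]_w (f (V *m Phi w))%:E <=
   \int[P]_w (f (c n *: Yn q V x beta n w))%:E + (4 * e)%:E)%E.
Proof.
move=> e0 e1; have [K K0 HV] := norm_mulmx_le V.
pose L := (Num.truncn (M / e)).+1.
have LR : 0 < L%:R :> R by rewrite ltr0n.
have ML : M / L%:R <= e.
  by rewrite ler_pdivrMr// mulrC -ler_pdivrMr// ltW// truncnS_gt.
have [del del0 Hf] := unif_continuous_ball (K * (Num.sqrt 2 * L%:R)) fc e0.
have [eta0 eta00 Hiso] := isolated_lower m0 x_rv x_indep x_id x_sphere x_pole C0 x_cap
  c_gt0 cX c_oo e0 e1 (isT : (0 < L)%N).
have [B B0 HB] := weight_integral_bound x_rv x_id x_pole C0 x_cap c_gt0 cX.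
have s20 : (0:R) < Num.sqrt 2 by rewrite sqrtr_gt0.
have [N N1 N2] : exists2 N : nat, (N.+1%:R^-1 : R) <= eta0 & K * (Num.sqrt 2 * N.+1%:R^-1) <= del / 3.
  have t0 : 0 < Num.min eta0 (del / 3 / (K * Num.sqrt 2)).
    by rewrite lt_min eta00/= !divr_gt0// mulr_gt0.
  have [N _ NP] := near_infty_natSinv_lt (PosNum t0).
  have := NP N (leqnn _); rewrite /= lt_min => /andP[h1 h2]; exists N; first exact: ltW.
  by rewrite mulrA mulrC -ler_pdivlMr ?mulr_gt0// ltW.
set eta : R := N.+1%:R^-1 in N1 N2.
have etap : 0 < eta by rewrite invr_gt0.
pose D : R := M * (3 / del) * K * (2 * Num.sqrt 2).
have D0 : 0 <= D.
  by have := ltW K0; have := ltW s20; have : 0 <= 3 / del by [rewrite divr_ge0// ltW];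
    rewrite /D => ? ? ?; do !apply: mulr_ge0 => //.
have n1 := Hiso eta etap N1.
pose X : R := 3 * K * (L%:R ^+ 3 + L%:R ^+ 2) / del.
have n2 : \forall n \near \oo, L%:R <= c n by move/cvgryPge : c_oo; exact.
have n3 : \forall n \near \oo, X <= c n by move/cvgryPge : c_oo; exact.
(* By [exp t >= 1 + t], this threshold makes [D * kap * B <= e], where [B] bounds the expected sum
   of the exponentials. *)
have n4 : \forall n \near \oo, (D * B / e / eta + 2) / eta <= beta n / c n ^+ 2.
  by move/cvgryPge : beta_oo; exact.
have n5 : \forall n \near \oo, (0 < n)%N by exact: nbhs_infty_gt.
near=> n.
have n0 : (0 < n)%N by near: n.
have nR : 0 < n%:R :> R by rewrite ltr0n.
have Lc : L%:R <= c n by near: n.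
have Xc : X <= c n by near: n.
have bn : (D * B / e / eta + 2) / eta <= beta n / c n ^+ 2 by near: n.
have Hn : forall (A : R) i B, eta <= A -> A <= L%:R -> (i < n)%N -> measurable B ->
  (((1 - e) / n%:R * ((expR (- (A - eta) ^+ m) - expR (- A ^+ m)) * s S B))%:E <=
    P ((ang U \o x i) @^-1` B `&` isolated q x c n i (A - eta) A (A + eta)))%E by near: n.
have cn0 := c_gt0 n0.
have c1 : 1 <= c n by apply: le_trans Lc; rewrite ler1n.
have e10 : 0 <= 1 - e by lra.
have cL : K * (L%:R ^+ 3 / c n ^+ 2 + L%:R ^+ 2 / c n) <= del / 3.
  apply: (@le_trans _ _ (K * (L%:R ^+ 3 / c n + L%:R ^+ 2 / c n))).
    rewrite ler_pM2l// lerD2r ler_pM2l ?exprn_gt0// lef_pV2 ?posrE ?exprn_gt0//.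
    by rewrite expr2 ler_peMl// ltW.
  rewrite -mulrDl mulrA ler_pdivrMr//.
  by move: Xc; rewrite /X ler_pdivrMr//; lra.
have DB0 : 0 <= D * B / e by exact: (divr_ge0 (mulr_ge0 D0 (ltW B0)) (ltW e0)).
move: bn; rewrite ler_pdivrMr// -lerBrDr ler_pdivrMr// => bn.
have b2 : 2 <= beta n / c n ^+ 2 * eta.
  by rewrite -subr_ge0 -(pmulr_lge0 _ etap) (le_trans DB0).
set kap : R := expR (- (beta n / c n ^+ 2 * eta - 2) * eta).
have kapB : D * kap * B <= e.
  have : kap * (1 + D * B / e) <= 1.
    rewrite /kap mulNr expRN mulrC ler_pdivrMr ?expR_gt0// mul1r.
    by apply: le_trans (expR_ge1Dx _); rewrite lerD2l.
  have k0 : 0 <= kap by exact: expR_ge0.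
  move=> h; have : kap * (e + D * B) <= e.
    have -> : kap * (e + D * B) = e * (kap * (1 + D * B / e)) by field; rewrite gt_eqF.
    by rewrite ler_piMr// ltW.
  have := mulr_ge0 k0 (ltW e0); lra.
pose Gp (p : 'I_(L * N.+1) * 'I_n) w := (G (grid N p.1) (ang U (x p.2 w)))%:E.
have mGp p : measurable_fun setT (Gp p) by exact: (measurableT_comp (mGE _) (mang _)).
have Gp0 p w : (0 <= Gp p w)%E by rewrite lee_fin; exact: f0.
pose Wt w := \sum_(j < n) expR (- (c n * rad q (x j w))).
have Wt0 w : 0 <= Wt w by apply: sumr_ge0 => j _; exact: expR_ge0.
have mWt : measurable_fun [set: Omega] Wt.
  apply: measurable_sum => j; apply: measurableT_comp => //; apply: measurableT_comp => //.
  apply: measurable_funM => //.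
  exact: (measurableT_comp (@measurable_rad R m q) (measurable_rv (x_rv j))).
have mF : measurable_fun [set: Omega] (fun w => (f (c n *: Yn q V x beta n w))%:E).
  apply/measurable_EFinP; apply: (measurableT_comp mf).
  exact: (measurableT_comp (measurable_scale_BV (c n)) (@measurable_Yn R m q V _ _ x beta x_rv n)).
have stepP : (\sum_(p : 'I_(L * N.+1) * 'I_n) \int[P]_(w in iso n N p.2 p.1) Gp p w <=
    \int[P]_w (f (c n *: Yn q V x beta n w))%:E + (2 * e)%:E)%E.
  rewrite -integral_sum_patch//.
  apply: (@le_trans _ _ (\int[P]_w ((f (c n *: Yn q V x beta n w))%:E + (e + D * kap * Wt w)%:E))%E).
    apply: ge0_integral_le => w; first by apply: sume_ge0 => p _; apply: erestrict_ge0.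
    rewrite -EFinD.
    rewrite (eq_bigr (fun p : 'I_(L * N.+1) * 'I_n => (((fun w => G (grid N p.1) (ang U (x p.2 w))) \_ (iso n N p.2 p.1)) w)%:E)); last first.
      by move=> p _; rewrite !patchE; case: ifP.
    rewrite sumEFin lee_fin.
    exact: (pointwise_bound w e0 del0 n0 K0 HV Hf N2 Lc cL b2).
  rewrite integral_add_error//; last 3 first.
  - exact: ltW.
  - by rewrite mulr_ge0// expR_ge0.
  - by move=> w; rewrite lee_fin.
  rewrite leeD2l// (_ : 2 * e = e + e); last by ring.
  rewrite EFinD leeD2l//.
  apply: (@le_trans _ _ ((D * kap)%:E * B%:E)%E); last by rewrite -EFinM lee_fin.
  by rewrite lee_wpmul2l// ?HB// lee_fin mulr_ge0// expR_ge0.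
have stepQ : ((1 - e)%:E * \sum_(k < L * N.+1) \int[Q]_(w in shellQ (grid N k - eta) (grid N k)) (G (grid N k) (Thu w))%:E
    <= \sum_(p : 'I_(L * N.+1) * 'I_n) \int[P]_(w in iso n N p.2 p.1) Gp p w)%E.
  rewrite ge0_sume_distrr; last by move=> k _; apply: integral_ge0 => w _; rewrite lee_fin; exact: f0.
  rewrite -(pair_bigA _ (fun (k : 'I_(L * N.+1)) (i : 'I_n) => (\int[P]_(w in iso n N i k) Gp (k, i) w)%E))/=.
  apply: lee_sum => k _.
  (* Each of the [n] candidates for the nearest point receives an equal share of the mass of the
     cell. *)
  have -> : (1 - e)%:E = (\sum_(i < n) ((1 - e) / n%:R)%:E)%E.
    rewrite sumEFin sumr_const card_ord -[X in _ = X%:E]mulr_natl mulrCA divff ?mulr1//.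
    exact: lt0r_neq0.
  rewrite ge0_sume_distrl; last by move=> i _; rewrite lee_fin divr_ge0.
  apply: lee_sum => i _.
  have h0 : 0 <= (1 - e) / n%:R by rewrite divr_ge0.
  apply: (integral_push_restr_le (mshellQ _ _) (miso N i k) mThu (mang i) h0 _ (mGE (grid N k))); last first.
    by move=> th; rewrite lee_fin; exact: f0.
  move=> B1 mB1.
  have gE : grid N k - eta = k%:R / N.+1%:R by rewrite /grid -natr1 mulrDl mul1r addrK.
  have g0 : 0 <= grid N k - eta by rewrite gE divr_ge0.
  have gL : grid N k <= L%:R by rewrite /grid ler_pdivrMr// -natrM ler_nat; exact: ltn_ord.
  have geta : eta <= grid N k by rewrite -subr_ge0.
  have := Hn (grid N k) i B1 geta gL (ltn_ord i) mB1.
  have := shellQ_indep (grid N k - eta) (grid N k) mB1.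
  rewrite shellQ_prob//; last by rewrite gerBl ltW.
  rewrite sE// -EFinM => E h.
  by apply: (le_trans _ h); rewrite (EFinM ((1 - e) / n%:R)) lee_wpmul2l ?lee_fin// -E.
apply: (@le_trans _ _ ((1 - e)%:E * (\sum_(k < L * N.+1) \int[Q]_(w in shellQ (grid N k - eta) (grid N k)) (G (grid N k) (Thu w))%:E + (2 * e)%:E))%E).
  rewrite lee_wpmul2l ?lee_fin//; apply: (limit_side e0 _ K0 HV Hf _ ML) => //.
  by apply: (le_trans N2); lra.
rewrite ge0_muleDr; last 2 first.
- by apply: sume_ge0 => k _; apply: integral_ge0 => w _; rewrite lee_fin; exact: f0.
- by rewrite lee_fin mulr_ge0// ltW.
apply: (le_trans (leeD (le_trans stepQ stepP) (_ : _ <= (2 * e)%:E)%E)).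
  by rewrite -EFinM lee_fin ler_piMl ?mulr_ge0 ?(ltW e0)//; lra.
by rewrite -addeA -EFinD leeD2l// lee_fin; lra.
Unshelve. all: by end_near. Qed.

End Lower_bound.

(** * Convergence *)

Section Portmanteau.
Variables (R : realType) (n : nat).
Context {d1 : measure_display} {O1 : measurableType d1} (P : probability O1 R)
  {d2 : measure_display} {O2 : measurableType d2} (Q : probability O2 R).

Lemma bounded_integrable d (T : measurableType d) (mu : probability T R) (g : T -> R) M :
  measurable_fun setT g -> (forall x, `|g x| <= M) -> mu.-integrable setT (EFin \o g).
Proof.
move=> mg gM; apply: measurable_bounded_integrable => //.
  by rewrite (le_lt_trans (probability_le1 _ _))// ltry.
exists M; split; first exact: num_real.
by move=> x Mx y _; exact: le_trans (gM y) (ltW Mx).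
Qed.

Lemma integral_addc d (T : measurableType d) (mu : probability T R) (g : T -> R) M (a : R) :
  measurable_fun setT g -> (forall x, `|g x| <= M) ->
  (\int[mu]_x (a + g x)%:E = (a + fine (\int[mu]_x (g x)%:E))%:E)%E.
Proof.
move=> mg gM; have ig := bounded_integrable mu mg gM.
have ic : mu.-integrable setT (EFin \o (fun=> a)).
  by apply: (@bounded_integrable _ _ mu _ `|a|).
have := @integralD_EFin _ _ _ mu _ measurableT (fun=> a) g ic ig.
rewrite EFinD fineK; last exact: (integrable_fin_num measurableT ig).
by rewrite integral_cst//= probability_setT mule1.
Qed.

Lemma cvg_distr_of_lower_bound (Z : nat -> O1 -> 'cV[R]_n) (X : O2 -> 'cV[R]_n) :
  (forall k, measurable_fun [set: O1] (Z k : O1 -> BV R n)) ->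
  measurable_fun [set: O2] (X : O2 -> BV R n) ->
  (forall (f : 'cV[R]_n -> R) (M : R), continuous f -> (forall z, 0 <= f z) -> (forall z, f z <= M) ->
    forall e : R, 0 < e -> e < 1 -> \forall k \near \oo,
    ((1 - e)%:E * \int[Q]_w (f (X w))%:E <= \int[P]_w (f (Z k w))%:E + (4 * e)%:E)%E) ->
  cvg_distr P Z Q X.
Proof.
move=> mZ mX LB f cf [M fM].
have mf : measurable_fun [set: BV R n] (f : BV R n -> R) by exact: continuous_measurable_BV_real.
have mfZ k : measurable_fun [set: O1] (fun w => f (Z k w)) by exact: (measurableT_comp mf (mZ k)).
have mfX : measurable_fun [set: O2] (fun w => f (X w)) by exact: (measurableT_comp mf mX).
have M0 : 0 <= M by exact: le_trans (fM 0).
have iZ k := bounded_integrable P (mfZ k) (fun w => fM (Z k w)).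
have iX := bounded_integrable Q mfX (fun w => fM (X w)).
pose J := fine (\int[Q]_w (f (X w))%:E)%E.
pose j k := fine (\int[P]_w (f (Z k w))%:E)%E.
rewrite -(fineK (integrable_fin_num measurableT iX)).
apply/fine_cvgP; split; first by apply: nearW => k; exact: (integrable_fin_num measurableT (iZ k)).
have plus : forall g : 'cV[R]_n -> R, continuous g -> (forall z, `|g z| <= M) -> forall e : R, 0 < e -> e < 1 ->
    \forall k \near \oo, (1 - e) * (M + fine (\int[Q]_w (g (X w))%:E)%E) <=
      M + fine (\int[P]_w (g (Z k w))%:E)%E + 4 * e.
  move=> g cg gM e e0 e1.
  have mg : measurable_fun [set: BV R n] (g : BV R n -> R) by exact: continuous_measurable_BV_real.
  have cMg : continuous (fun z => M + g z).
    by move=> z; exact: (cvgD (cvg_cst M) (cg z)).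
  have g0 z : 0 <= M + g z by have := gM z; rewrite ler_norml => /andP[]; lra.
  have g2 z : M + g z <= 2 * M by have := gM z; rewrite ler_norml => /andP[]; lra.
  have := LB _ _ cMg g0 g2 e e0 e1; apply: filterS => k.
  rewrite (integral_addc Q M (measurableT_comp mg mX) (fun w => gM (X w))).
  rewrite (integral_addc P M (measurableT_comp mg (mZ k)) (fun w => gM (Z k w))).
  by rewrite -EFinM -EFinD lee_fin.
have JM : `|J| <= M.
  rewrite -lee_fin /J -abse_EFin fineK; last exact: (integrable_fin_num measurableT iX).
  apply: (le_trans (le_abse_integral _ _ _)) => //; first exact/measurable_EFinP.
  apply: (@le_trans _ _ (\int[Q]_w (M%:E))%E).
    by apply: ge0_integral_le => w; rewrite ?abse_ge0// abse_EFin lee_fin.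
  by rewrite integral_cst//= probability_setT mule1.
apply/cvgrPdist_le => /= e e0.
(* The bounds for [M + f] and [M - f] lose at most [4 t + t (M + |J|) <= (4 + 2 M) t]. *)
pose t := Num.min (1 / 2) (e / (4 + 2 * M)).
have tM : 0 < 4 + 2 * M by lra.
have t0 : 0 < t by rewrite lt_min divr_gt0//= divr_gt0.
have t1 : t < 1 by rewrite gt_min; apply/orP; left; lra.
have te : (4 + 2 * M) * t <= e by rewrite mulrC -ler_pdivlMr// ge_min lexx orbT.
have Nf z : `|- f z| <= M by rewrite normrN.
have cN : continuous (fun z => - f z) by move=> z; exact: (cvgN (cf z)).
have NE d (T : measurableType d) (mu : probability T R) (Y : T -> 'cV[R]_n) :
    mu.-integrable setT (fun w => (f (Y w))%:E) ->
    fine (\int[mu]_w (- f (Y w))%:E)%E = - fine (\int[mu]_w (f (Y w))%:E)%E.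
  move=> iY; rewrite -fineN; congr fine; rewrite -integralN//.
  by rewrite integrable_add_def.
near=> k.
have h1 : (1 - t) * (M + J) <= M + j k + 4 * t.
  by near: k; exact: (plus f cf fM t t0 t1).
have h2 : (1 - t) * (M + fine (\int[Q]_w (- f (X w))%:E)%E) <= M + fine (\int[P]_w (- f (Z k w))%:E)%E + 4 * t.
  by near: k; exact: (plus _ cN Nf t t0 t1).
move: h2; rewrite (NE _ _ Q X iX) (NE _ _ P (Z k) (iZ k)) -/J -/(j k) => h2.
move: JM; rewrite ler_norml => /andP[J1 J2].
have : t * J <= t * M by rewrite ler_pM2l.
have : - (t * M) <= t * J by rewrite -mulrN ler_pM2l.
move=> h3 h4; rewrite /= -/(j k) -/J ler_norml; apply/andP; split; lra.
Unshelve. all: by end_near. Qed.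

Lemma clamp_lipschitz (a b : R) :
  `|Num.min 1 (Num.max 0 a) - Num.min 1 (Num.max 0 b)| <= `|a - b|.
Proof.
have h1 := ler_norm (a - b).
have h2 : b - a <= `|a - b| by rewrite distrC ler_norm.
have h3 := normr_ge0 (a - b).
move: `|a - b| h1 h2 h3 => N h1 h2 h3.
rewrite !minEle !maxEle; case: (leP 0 a) => a0; case: (leP 0 b) => b0; rewrite ?ler10;
  case: (leP 1 a) => a1; case: (leP 1 b) => b1; rewrite ler_norml; apply/andP; split; lra.
Qed.

(** Convergence in distribution keeps the mass of [c k * Y k] far out close to that of [X], which is
    small by tightness, while [enorm (Y k) > e] pushes [c k * Y k] arbitrarily far out. *)
Lemma cvg_prob_of_distr (Y : nat -> O1 -> 'cV[R]_n) (X : O2 -> 'cV[R]_n) (c : nat -> R) :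
  (forall k, measurable_fun [set: O1] (Y k : O1 -> BV R n)) ->
  measurable_fun [set: O2] (X : O2 -> BV R n) ->
  c k @[k --> \oo] --> +oo -> cvg_distr P (fun k w => c k *: Y k w) Q X -> cvg_prob P Y 0.
Proof.
move=> mY mX coo cY e e0.
have mset k : measurable [set w | e < enorm (Y k w - 0)].
  apply: measurable_ltr => //; under eq_fun do rewrite subr0.
  exact: (measurableT_comp (@measurable_enorm R n) (mY k)).
have mnX : measurable_fun [set: O2] (fun w => enorm (X w)).
  exact: (measurableT_comp (@measurable_enorm R n) mX).
apply/fine_cvgP; split; first by apply: nearW => k; rewrite fin_num_measure.
apply/cvgrPdist_le => /= t t0.
have t20 : 0 < t / 2 by rewrite divr_gt0.
have [A tight] : exists A : nat, (Q [set w | (A%:R < enorm (X w))%R] <= (t / 2)%:E)%E.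
  pose F (A : nat) := [set w | A%:R < enorm (X w)].
  have mF A : measurable (F A) by exact: measurable_ltr.
  have F0 : \bigcap_A F A = set0.
    apply/seteqP; split => w // /(_ (Num.truncn (enorm (X w))).+1 I) /=.
    by rewrite /F/= ltNge ltW// truncnS_gt.
  have : (Q \o F) k @[k --> \oo] --> Q (\bigcap_A F A).
    apply: nonincreasing_cvg_mu => //.
    - by rewrite (le_lt_trans (probability_le1 _ _))// ltry.
    - exact: bigcapT_measurable.
    - move=> a b ab; apply/subsetPset => w; apply: le_lt_trans; by rewrite ler_nat.
  rewrite F0 measure0 => /fine_cvgP[_ /cvgrPdist_le /(_ _ t20)] [A _ /(_ A (leqnn _))] /=.
  rewrite sub0r normrN ger0_norm ?fine_ge0// => h; exists A.
  by rewrite -lee_fin fineK in h; rewrite ?fin_num_measure.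
(* A continuous function between the indicators of [|z| >= A + 1] and of [|z| > A]. *)
pose g (z : 'cV[R]_n) : R := Num.min 1 (Num.max 0 (`|z| - A%:R)).
have g0 z : 0 <= g z by rewrite /g le_min ler01/= le_max lexx.
have g1 z : g z <= 1 by rewrite /g ge_min lexx.
have cg : continuous g.
  move=> z; apply/(@cvgrPdist_le R R _ (nbhs z) (nbhs_filter z) g (g z)) => u u0.
  have : \forall z' \near z, `|z - z'| <= u by apply/nbhs_ballP; exists u => // z'; rewrite -ball_normE => /ltW.
  apply: filterS => z' zz; apply: (le_trans (clamp_lipschitz _ _)).
  have -> : `|z| - A%:R - (`|z'| - A%:R) = `|z| - `|z'| by ring.
  exact: le_trans (ler_dist_dist _ _) zz.
have gb : exists M, forall z, `|g z| <= M by exists 1 => z; rewrite ger0_norm.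
have := cY g cg gb.
have mg : measurable_fun [set: BV R n] (g : BV R n -> R) by exact: continuous_measurable_BV_real.
have gX : (\int[Q]_w (g (X w))%:E <= (t / 2)%:E)%E.
  apply: le_trans tight.
  apply: (@le_trans _ _ (\int[Q]_w (\1_[set w | (A%:R < enorm (X w))%R] w)%:E)%E); last first.
    by rewrite integral_indic// ?setIT//; exact: measurable_ltr.
  apply: ge0_integral_le => w; rewrite lee_fin//.
  have [h|h] := leP `|X w| A%:R.
    by rewrite /g (_ : Num.max _ _ = 0) ?ge_min ?ler0n ?orbT//; apply/max_idPl; rewrite subr_le0.
  rewrite indicE mem_set//=; exact: lt_le_trans (norm_le_enorm _).
have iX : (\int[Q]_w (g (X w))%:E)%E \is a fin_num.
  apply: (integrable_fin_num measurableT (@bounded_integrable _ _ Q (g \o X) 1 (measurableT_comp mg mX) _)).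
  by move=> w; rewrite /= ger0_norm.
rewrite -(fineK iX) => /fine_cvgP[fin /cvgrPdist_le /(_ _ t20) near1].
(* The factor [n] comes from [enorm y <= n * |y|]: then [enorm (Y k) > e] implies
   [|c k * Y k| >= A + 1]. *)
have near2 : \forall k \near \oo, (A%:R + 1) * n%:R / e <= c k by move/cvgryPge : coo; exact.
have near3 : \forall k \near \oo, 1 <= c k by move/cvgryPge : coo; exact.
near=> k.
have fk : (\int[P]_w (g (c k *: Y k w))%:E)%E \is a fin_num by near: k.
have h1 : `|fine (\int[Q]_w (g (X w))%:E)%E - fine (\int[P]_w (g (c k *: Y k w))%:E)%E| <= t / 2 by near: k.
have ck : (A%:R + 1) * n%:R / e <= c k by near: k.
have ck1 : 1 <= c k by near: k.
have ck0 : 0 < c k by lra.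
rewrite sub0r normrN ger0_norm ?fine_ge0//.
have gX' : fine (\int[Q]_w (g (X w))%:E)%E <= t / 2 by rewrite -lee_fin fineK.
apply: (@le_trans _ _ (fine (\int[P]_w (g (c k *: Y k w))%:E)%E)); last first.
  by move: h1; rewrite ler_norml => /andP[? ?]; lra.
rewrite -lee_fin !fineK ?fin_num_measure//.
apply: (@le_trans _ _ (\int[P]_w (\1_[set w | (e < enorm (Y k w - 0))%R] w)%:E)%E).
  by rewrite integral_indic// setIT.
apply: ge0_integral_le => w; rewrite lee_fin// indicE.
case: (boolP (w \in _)) => //; rewrite inE/= subr0 => ew.
rewrite /g (_ : Num.min _ _ = 1)//; apply/min_idPl.
rewrite le_max; apply/orP; right; rewrite lerBrDl normrZ gtr0_norm//.
have h := lt_le_trans ew (enorm_le_norm (Y k w)).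
have nn : 0 < n%:R :> R.
  rewrite lt_def ler0n andbT; apply/eqP => n0.
  by move: h; rewrite n0 mul0r ltNge ltW.
move: ck; rewrite ler_pdivrMr// -ler_pdivlMr// => ck.
apply: (le_trans ck); rewrite -mulrA ler_pM2l// ler_pdivrMr// mulrC ltW//.
Unshelve. all: by end_near. Qed.

End Portmanteau.

Section Push_probability.
Context d d' (T1 : measurableType d) (T2 : measurableType d') (R : realType).
Variables (mu : probability T1 R) (f : T1 -> T2) (mf : measurable_fun [set: T1] f).

Let push_setT : push mu mf setT = 1%E.
Proof. by rewrite /push preimage_setT; exact: probability_setT. Qed.

HB.instance Definition _ := Measure_isProbability.Build _ _ _ (push mu mf) push_setT.

End Push_probability.

Section Uniform_direction.
Variables (R : realType) (m : nat) (q : 'cV[R]_m.+1).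
Context {dW : measure_display} {W : measurableType dW} (Q : probability W R).
Variables (Th : W -> 'cV[R]_m.+1) (U : 'M[R]_(m.+1, m)).
Hypotheses (UU : U^T *m U = 1%:M)
  (Th_unif : forall A, borel A -> Q (Th @^-1` A) =
     ((sph_int (fun y : 'cV[R]_m => (\1_A (U *m y))%:E)) * ((@sph_area R m)^-1)%:E)%E).

Lemma uniform_good : Q (Th @^-1` ~` [set z | U *m (U^T *m z) = z /\ enorm z = 1]) = 0%E.
Proof.
have mA := measurableC (measurable_tangent_sphere U).
rewrite (Th_unif mA) /sph_int /leb_int.
have H k y : iint k (fun x : 'cV[R]_m => if (0 < enorm x) && (enorm x <= 1)
    then (\1_(~` [set z | U *m (U^T *m z) = z /\ enorm z = 1]) (U *m ((enorm x)^-1 *: x)) : R)%:E else 0%E) y = 0%E.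
  elim: k y => [|k ih] y /=; last by apply: integral0_eq => t _; exact: ih.
  case: ifPn => // /andP[y0 _]; rewrite indicE memNset//=; apply; split.
    by rewrite !mulmxA -(mulmxA U) UU mulmx1.
  by rewrite enorm_isometry//; exact: enorm_dir.
by rewrite H mule0 mul0e.
Qed.

Lemma uniform_direction (B : set (BV R m)) : measurable B ->
  Q ((fun w => U^T *m Th w : BV R m) @^-1` B) =
  (m%:R%:E * Leb (cone B 1) * ((@sph_area R m)^-1)%:E)%E.
Proof.
move=> mB.
have mA : measurable ([set z | B (U^T *m z : BV R m)] : set (BV R m.+1)).
  apply: (@measurable_preimageT _ _ _ _ (fun z : BV R m.+1 => U^T *m z : BV R m)) => //.
  exact: measurable_mulmx.
rewrite [LHS](Th_unif mA) -sph_int_indic; congr (sph_int _ * _)%E.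
by apply/funext => y; rewrite !indicE; congr (_%:R%:E); congr nat_of_bool;
  apply/idP/idP; rewrite !inE/= mulmxA UU mul1mx.
Qed.

(** Deduced from the existence of [Th]: if the area were 0, so would be its inverse, and the law of
    [Th] would have total mass 0. *)
Lemma sph_area_gt0 : 0 < @sph_area R m.
Proof.
have := uniform_direction measurableT; rewrite preimage_setT probability_setT.
have [a0|a0] := ltP 0 (@sph_area R m) => //.
have aE : @sph_area R m = m%:R * fine (Leb (cone [set: BV R m] 1)).
  rewrite /sph_area; have -> : (fun _ : 'cV[R]_m => 1%E : \bar R) = (fun x : 'cV[R]_m => (\1_[set: BV R m] x)%:E).
    by apply/funext => x; rewrite indicT.
  by rewrite sph_int_indic fineM//; exact: Leb_cone_fin.
have -> : @sph_area R m = 0.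
  by apply/le_anti; rewrite a0 aE mulr_ge0// fine_ge0.
by rewrite invr0 mule0 => /eqP; rewrite onee_eq0.
Qed.

Lemma Leb_cone_uniform (B : set (BV R m)) : (0 < m)%N -> measurable B ->
  Leb (cone B 1) = ((@sph_area R m / m%:R)%:E * Q ((fun w => U^T *m Th w : BV R m) @^-1` B))%E.
Proof.
move=> m0 mB; rewrite uniform_direction//.
rewrite -(fineK (Leb_cone_fin mB)) -!EFinM; congr EFin.
by field; rewrite ?pnatr_eq0 -?lt0n m0 gt_eqF// sph_area_gt0.
Qed.

End Uniform_direction.

Theorem mainTheorem4
  (R : realType) (d : nat) (hd : (2 <= d)%N)
  (q : 'cV[R]_d) (hq : usphere d q)
  (rho : 'cV[R]_d -> R)
  (hrho_C2 : C2_on_sphere rho) (hrho_dens : sphere_density rho)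
  (hrho_q : 0 < rho q)
  (dO : measure_display) (Omega : measurableType dO) (P : probability Omega R)
  (x : nat -> Omega -> 'cV[R]_d)
  (hx_rv : forall i, random_vector (x i))
  (hx_law : forall i, has_sphere_law P rho (x i))
  (hx_indep : mutually_independent P x)
  (beta : nat -> R) (hbeta_pos : forall n, 0 < beta n)
  (V : 'M[R]_d)
  (hbeta : (fun n : nat => beta n * (n%:R `^ (- (2 / (d.-1)%:R)))) @ \oo --> +oo)
  (dW : measure_display) (W : measurableType dW) (Q : probability W R)
  (R1 : W -> R) (Theta1 : W -> 'cV[R]_d)
  (hR1_meas : measurable_fun setT R1)
  (hR1_nonneg : forall w, 0 <= R1 w)
  (hR1_law : forall r : R, 0 <= r ->
     Q [set w | r < R1 w] = (expR (- (r `^ ((d.-1)%:R / 2))))%:E)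
  (hTheta_rv : random_vector Theta1)
  (hTheta_law : uniform_tsphere Q q Theta1)
  (hindep : independent2 Q R1 Theta1) :
  let alpha : R := 2 / (d.-1)%:R in
  let Cq : R := 2 `^ (alpha^-1) * sph_area d.-1 / (d.-1)%:R * rho q in
  let a : nat -> R := fun n => (Cq * n%:R) `^ alpha in
  let Phi : W -> 'cV[R]_d := fun w => Num.sqrt (2 * R1 w) *: Theta1 w in
  cvg_distr P (fun n w => Num.sqrt (a n) *: Yn q V x beta n w)
            Q (fun w => V *m Phi w)
  /\ cvg_prob P (fun n w => Yn q V x beta n w) 0
  /\ cvg_prob P (fun n w => ATT q V x beta n w) (V *m q).
Proof.
case: d hd q hq rho hrho_C2 hrho_dens hrho_q x hx_rv hx_law hx_indep V hbeta
  Theta1 hR1_law hTheta_rv hTheta_law hindep => [//|m] m0 q q1 rho rhoC2 rhod rhoq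
  x x_rv x_law x_indep V hbeta Th R1_law Th_rv [U [UU [Uq Th_unif]]] indep alpha Cq a Phi.
rewrite /= in alpha Cq a U UU Uq Th_unif hbeta R1_law *.
have {}m0 : (0 < m)%N by [].
have mR : 0 < m%:R :> R by rewrite ltr0n.
have al0 : 0 < alpha by rewrite divr_gt0.
have area0 : 0 < sph_area m := sph_area_gt0 UU Th_unif.
have C0 : 0 < Cq by rewrite !mulr_gt0 ?powR_gt0// invr_gt0.
have mThu : measurable_fun [set: W] (fun w => U^T *m Th w : BV R m).
  exact: (measurableT_comp (measurable_mulmx U^T) (measurable_rv Th_rv)).
(* The uniform law on the unit sphere of [R^m], realised as the law of the coordinates of [Th] in
   the frame [U]. *)
pose S : probability (BV R m) R := push Q mThu.
have x_id i (A : set 'cV[R]_m.+1) : borel A -> P (x i @^-1` A) = P (x 0 @^-1` A).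
  by move=> bA; rewrite !x_law.
(* As [1 / alpha = m / 2], the power of 2 is [sqrt 2 ^ m]. The last factor is the volume of the unit
   ball of [R^m], which converts [Leb (cone B 1)] into [S B]. *)
have CE : Cq = Num.sqrt 2 ^+ m * rho q * (sph_area m / m%:R).
  rewrite /Cq; have -> : alpha^-1 = 2^-1 * m%:R by rewrite /alpha invf_div mulrC.
  rewrite powRrM powR12_sqrt// powR_mulrn ?sqrtr_ge0//; ring.
have x_cap : forall e : R, 0 < e -> e < 1 -> exists2 y0 : R, 0 < y0 &
    forall (y : R) (B : set (BV R m)), 0 < y -> y <= y0 -> measurable B ->
    (((1 - e) * Cq * y ^+ m)%:E * S B <= P (x 0%N @^-1` cap q U y B))%E /\
    (P (x 0%N @^-1` cap q U y B) <= ((1 + e) * Cq * y ^+ m)%:E * S B)%E.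
  move=> e e0 e1; have [y0 /andP[y00 _] H] := law_cap UU Uq q1 m0 rhoC2 rhod rhoq (x_law 0) e0 e1.
  exists y0 => // y B yp yy mB.
  have E t : ((t * Cq * y ^+ m)%:E * S B =
      (t * (Num.sqrt 2 ^+ m * rho q) * y ^+ m)%:E * Leb (cone B 1))%E.
    rewrite (Leb_cone_uniform UU Th_unif m0 mB) muleA -EFinM; congr (_%:E * _)%E.
    by rewrite CE; ring.
  by rewrite !E; exact: H.
pose c n : R := Num.sqrt (a n).
have Cn0 n : 0 <= Cq * n%:R by rewrite mulr_ge0// ltW.
have cX n : c n ^+ m = Cq * n%:R.
  rewrite /c -powR12_sqrt ?powR_ge0// -powR_mulrn ?powR_ge0// /a -!powRrM.
  by rewrite (_ : alpha * _ = 1) ?powRr1// /alpha; field; rewrite gt_eqF.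
have c_gt0 n : (0 < n)%N -> 0 < c n.
  by move=> n0; rewrite sqrtr_gt0 powR_gt0// mulr_gt0// ltr0n.
have c_oo : c n @[n --> \oo] --> +oo.
  (* A nonnegative threshold can be compared through its [m]-th power. *)
  apply/cvgryPge => A; pose B := Num.max A 1.
  have B0 : 0 <= B by rewrite le_max ler01 orbT.
  near=> n; apply: (@le_trans _ _ B); first by rewrite le_max lexx.
  rewrite -(@ler_pXn2r _ m)// ?nnegrE ?sqrtr_ge0// cX mulrC -ler_pdivrMr//.
  by near: n; exact: nbhs_infty_ger.
have cE n : c n ^+ 2 = Cq `^ alpha * n%:R `^ alpha.
  by rewrite sqr_sqrtr ?powR_ge0// /a powRM// ltW.
have beta_oo : beta n / c n ^+ 2 @[n --> \oo] --> +oo.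
  apply/cvgryPge => A.
  have : \forall n \near \oo, A * Cq `^ alpha <= beta n * n%:R `^ (- alpha).
    by move/cvgryPge : hbeta; exact.
  apply: filterS => n; rewrite cE powRN invfM mulrCA => h.
  by rewrite mulrC ler_pdivlMr// powR_gt0.
have R1_law' (A : R) : 0 <= A -> Q [set w | A ^+ 2 < R1 w] = (expR (- A ^+ m))%:E.
  move=> A0; rewrite R1_law ?sqr_ge0//; congr (expR (- _))%:E.
  rewrite -(powR_mulrn 2 A0) -powRrM -(powR_mulrn m A0); congr (_ `^ _).
  by field.
have Th_law B : measurable B -> S B = Q ((fun w => U^T *m Th w : BV R m) @^-1` B) by [].
have mPhi : measurable_fun [set: W] ((fun w => V *m Phi w) : W -> BV R m.+1).
  apply: (measurableT_comp (measurable_mulmx V)).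
  apply: measurable_to_BV => i; under eq_fun do rewrite mxE.
  apply: measurable_funM; last exact: (measurableT_comp (measurable_coord i) (measurable_rv Th_rv)).
  have h2 : measurable_fun [set: R] (@Num.sqrt R).
    by apply: continuous_measurable_fun; exact: sqrt_continuous.
  by apply: (measurableT_comp h2); exact: measurable_funM.
have mY n : measurable_fun [set: Omega] (Yn q V x beta n : Omega -> BV R m.+1).
  exact: (@measurable_Yn R m q V _ _ x beta x_rv n).
have D : cvg_distr P (fun n w => c n *: Yn q V x beta n w) Q (fun w => V *m Phi w).
  apply: cvg_distr_of_lower_bound => //.
    by move=> k; exact: (measurableT_comp (measurable_scale_BV (c k)) (mY k)).
  move=> f M fc f0 fM e e0 e1.
  exact: (lower_bound UU Uq q1 m0 x_rv x_indep x_id (law_sphere rhod (x_law 0))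
    (law_pole UU Uq q1 m0 rhod rhoq (x_law 0)) C0 x_cap c_gt0 cX c_oo V beta_oo
    hR1_meas R1_law' Th_rv (uniform_good UU Th_unif) Th_law indep fc f0 fM e0 e1).
have Y0 : cvg_prob P (fun n w => Yn q V x beta n w) 0.
  exact: (cvg_prob_of_distr mY mPhi c_oo D).
split; [exact: D|split; [exact: Y0|]].
move=> e e0; have := Y0 e e0.
apply: cvg_trans; apply: near_eq_cvg; near=> n.
have n0 : (0 < n)%N by near: n; exact: nbhs_infty_gt.
congr (P _); apply/seteqP; split => w /=;
  rewrite subr0 /Yn /ATT; (suff -> : \sum_(i < n) Aw q x beta n i w *: (x i w - q) =
    \sum_(i < n) Aw q x beta n i w *: x i w - q by rewrite mulmxBr);
  by (under eq_bigr do rewrite scalerBr); rewrite sumrB -scaler_suml sum_Aw// scale1r.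
Unshelve. all: by end_near. Qed.
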